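(* Let $n\ge1$. The bundle $\mathcal{G}_n$ over $\mathrm{Conf}_n(\mathbb{C})$ with its canonical flat connection, the bundle $\mathcal{H}_n$ over $\mathrm{Conf}_n(\mathbb{C})$ with the flat connection $\nabla_n$, and the bundle map $|W|:\mathcal{G}_n\to\mathcal{H}_n$ given by the holonomy maps all descend from the configuration space $\mathrm{Conf}_n(\mathbb{C})$ to the moduli space of genus zero curves $\mathcal{M}_{0,n+1}\cong\mathrm{Conf}_n(\mathbb{C})/\Gamma$.
   Context: **Base.** $\mathrm{Conf}_n=\mathrm{Conf}_n(\mathbb{C})$ is the space of $n$-tuples $z=(z_1,\dots,z_n)$ of distinct complex numbers. $\Gamma=\{z\mapsto az+b:\ a\in\mathbb{C}^*,\ b\in\mathbb{C}\}$ acts diagonally on it, and $\mathcal{M}_{0,n+1}=\mathrm{Conf}_{n+1}(\mathbb{C}P^1)/\mathrm{PSL}_2\cong\mathrm{Conf}_n(\mathbb{C})/\Gamma$ (one marked point placed at $\infty$). For $z\in\mathrm{Conf}_n$ put $\Sigma^{(z)}=\mathbb{C}\setminus\{z_1,\dots,z_n\}$. **Fibers.** $|\mathbb{C}\pi_1(\Sigma^{(z)})|=\mathbb{C}\pi_1/[\mathbb{C}\pi_1,\mathbb{C}\pi_1]$ is the vector space spanned by free homotopy classes of loops in $\Sigma^{(z)}$. $TH_1$ is the degree-completed free associative algebra over $\mathbb{C}$ on $a_1,\dots,a_n$ ($a_i$ being the class in $H_1$ of a counterclockwise loop around the $i$-th puncture), and $|TH_1|=TH_1/[TH_1,TH_1]$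 (closed span of commutators) is the completed space of cyclic words. Smoothness for $|TH_1|$-valued maps is understood degree by degree. **The bundle $\mathcal{G}_n$.** Its fiber over $z$ is $|\mathbb{C}\pi_1(\Sigma^{(z)})|$. Near $z$, choose disjoint small open disks $D_i$ centered at $z_i$; for $w\in\mathrm{Conf}_n$ with $w_i\in D_i$ the inclusion $\mathbb{C}\setminus\bigcup_iD_i\subset\Sigma^{(w)}$ is a homotopy equivalence, and this trivializes $\mathcal{G}_n$ near $z$. The canonical flat connection is the one whose local flat sections are the sections constant in these trivializations; equivalently, for a fixed closed curve $\gamma$ in $\mathbb{C}$, $w\mapsto[\gamma]$ is flat where no $w_i$ lies on $\gamma$. **The bundle $\mathcal{H}_n$.** $\mathcal{H}_n=\mathrm{Conf}_n\times|TH_1|$ with connection $$\nabla_n=d+\frac{1}{2\pi i}\sum_{1\le i<j\le n}\mathrm{ad}(t_{ij})\,d\log(z_i-z_j),$$ where $\mathrm{ad}(t_{ij})$ is the operator on $|TH_1|$ induced by the continuous derivation of $TH_1$ with $a_i\mapsto[a_i,a_j]$, $a_j\mapsto[a_j,a_i]$, $a_k\mapsto0$ for $k\ne i,j$. (This is the action of the generators $t_{ij}$ of the Drinfeld-Kohno Lie algebra $\mathfrak{t}_n\subset\mathfrak{t}_{n+1}$ by the adjoint action, with $a_i=t_{i(n+1)}$; the connection $\nabla_n$ is flat.) **The map $|W|$.** For a path $\gamma$ parametrized by $\zeta:[0,1]\to\Sigma^{(z)}$ and $A^{(z)}(\zeta)=\frac{1}{2\pi i}\sum_ia_i\,d\log(\zeta-z_i)$,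 $$\mathrm{Hol}^{(z)}_\gamma=\sum_{k\ge0}\int_{1\ge t_1\ge\dots\ge t_k\ge0}A^{(z)}(\zeta(t_1))\cdots A^{(z)}(\zeta(t_k))\in TH_1,$$ and $|W^{(z)}|:|\mathbb{C}\pi_1(\Sigma^{(z)})|\to|TH_1|$ sends the free homotopy class of a loop $\gamma$ to the class of $\mathrm{Hol}^{(z)}_\gamma$ in $|TH_1|$. These maps form the bundle map $|W|$. **$\Gamma$-actions and descent.** $\Gamma$ acts on $\mathcal{H}_n$ by its action on $\mathrm{Conf}_n$ and trivially on the fiber $|TH_1|$; on $\mathcal{G}_n$ it acts by $[\gamma]\mapsto[a\gamma+b]$, mapping the fiber over $z$ to the fiber over $az+b=(az_1+b,\dots,az_n+b)$. The quotients by $\Gamma$ are bundles over $\mathcal{M}_{0,n+1}$. A connection descends if it is the pull-back of a (flat) connection on the quotient bundle; a bundle map descends if it is induced by a bundle map of the quotient bundles, i.e. if it is $\Gamma$-equivariant. *)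

(* Defs.v *)
From HB Require Import structures.
From mathcomp Require Import all_boot all_order all_algebra.
From mathcomp Require Import generic_quotient ring_quotient complex freeg.
From mathcomp Require Import all_classical all_reals all_analysis.
From mathcomp Require Import lra.

Set Implicit Arguments.
Unset Strict Implicit.
Unset Printing Implicit Defensive.

Import Order.TTheory GRing.Theory Num.Theory.
Import numFieldNormedType.Exports.

Local Open Scope classical_set_scope.
Local Open Scope quotient_scope.
Local Open Scope complex_scope.
Local Open Scope ring_scope.

(* A manifold is presented by its points, its open sets and its sheaf of smooth
   complex-valued functions.  Functions and sections are total; only their
   values on the open set under consideration matter. *)
Record smooth_space (R : realType) := SmoothSpace {
  point :> Type ;
  is_open : set point -> Prop ;
  is_smooth : set point -> (point -> R[i]) -> Prop }.

Section Manifold.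
Variables (R : realType) (X : smooth_space R).

Definition near_pt (p : X) (P : X -> Prop) : Prop :=
  exists U : set X, [/\ is_open U, U p & forall q, U q -> P q].

Definition smooth_near (p : X) (f : X -> R[i]) : Prop :=
  exists U : set X, [/\ is_open U, U p & is_smooth U f].

(* Complexified tangent vectors, as derivations of germs of smooth functions.
   A complex connection extends uniquely to them by complex linearity.  The
   values on functions that are not smooth near p are irrelevant. *)
Definition is_tangent (p : X) (v : (X -> R[i]) -> R[i]) : Prop :=
  [/\ forall f g, smooth_near p f -> smooth_near p g ->
        near_pt p (fun q => f q = g q) -> v f = v g,
      forall c f g, smooth_near p f -> smooth_near p g ->
        v (fun q => c * f q + g q) = c * v f + v g
    & forall f g, smooth_near p f -> smooth_near p g ->
        v (fun q => f q * g q) = v f * g p + f p * v g].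

Definition is_vector_field (U : set X)
    (V : X -> (X -> R[i]) -> R[i]) : Prop :=
  (forall p, U p -> is_tangent p (V p)) /\
  (forall W f, is_open W -> W `<=` U -> is_smooth W f ->
     is_smooth W (fun p => V p f)).

Definition lie_bracket (V W : X -> (X -> R[i]) -> R[i]) :
    X -> (X -> R[i]) -> R[i] :=
  fun p f => V p (fun q => W q f) - W p (fun q => V q f).

Record bundle := Bundle {
  fiber :> X -> lmodType R[i] ;
  smooth_section : set X -> (forall p, fiber p) -> Prop }.

Variable E : bundle.

Definition section_near (p : X) (s : forall q, E q) : Prop :=
  exists U : set X, [/\ is_open U, U p & smooth_section U s].

(* [nabla p v s] is the covariant derivative at p of s along v. *)
Definition covariant_derivative : Type :=
  forall p : X, ((X -> R[i]) -> R[i]) -> (forall q, E q) -> E p.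

Record is_connection (nabla : covariant_derivative) : Prop := IsConnection {
  conn_germ_tangent : forall p v w s,
    is_tangent p v -> is_tangent p w -> section_near p s ->
    (forall f, smooth_near p f -> v f = w f) -> nabla p v s = nabla p w s ;
  conn_germ_section : forall p v s t,
    is_tangent p v -> section_near p s -> section_near p t ->
    near_pt p (fun q => s q = t q) -> nabla p v s = nabla p v t ;
  conn_tangent : forall p c v w s,
    is_tangent p v -> is_tangent p w -> section_near p s ->
    nabla p (fun f => c * v f + w f) s = c *: nabla p v s + nabla p w s ;
  conn_section : forall p v s t,
    is_tangent p v -> section_near p s -> section_near p t ->
    nabla p v (fun q => s q + t q) = nabla p v s + nabla p v t ;
  conn_leibniz : forall p v f s,
    is_tangent p v -> smooth_near p f -> section_near p s ->
    nabla p v (fun q => f q *: s q) = v f *: s p + f p *: nabla p v s ;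
  conn_smooth : forall (U : set X) V s,
    is_open U -> is_vector_field U V -> smooth_section U s ->
    smooth_section U (fun p => nabla p (V p) s) }.

Definition is_flat (nabla : covariant_derivative) : Prop :=
  forall (U : set X) V W s p,
    is_open U -> is_vector_field U V -> is_vector_field U W ->
    smooth_section U s -> U p ->
    nabla p (V p) (fun q => nabla q (W q) s)
      - nabla p (W p) (fun q => nabla q (V q) s)
    = nabla p (lie_bracket V W p) s.

Definition flat_connection (nabla : covariant_derivative) : Prop :=
  is_connection nabla /\ is_flat nabla.

End Manifold.

Section SmoothMap.
Variables (R : realType) (X : smooth_space R) (E F : bundle X).

Definition smooth_map (h : forall p, E p -> F p) : Prop :=
  forall (U : set X) s, is_open U -> smooth_section U s ->
    smooth_section U (fun p => h p (s p)).

End SmoothMap.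

Record conf (R : realType) (n : nat) := Conf {
  pts :> 'I_n -> R[i] ;
  pts_inj : injective pts }.

HB.instance Definition _ (R : realType) (n : nat) := gen_eqMixin (conf R n).
HB.instance Definition _ (R : realType) (n : nat) := gen_choiceMixin (conf R n).

Lemma conf_eq (R : realType) (n : nat) (z w : conf R n) :
  (forall i, z i = w i) -> z = w.
Proof.
case: z w => [z hz] [w hw] /= e; have ezw : z = w by apply: funext.
by rewrite ezw in hz *; congr Conf; exact: Prop_irrelevance.
Qed.

Section ConfSpace.
Variables (R : realType) (n : nat).

(* C^n is identified with R^n x R^n through real and imaginary parts. *)
Definition coords (z : conf R n) : 'rV[R]_n * 'rV[R]_n :=
  (\row_i complex.Re (z i), \row_i complex.Im (z i)).

Fixpoint class_C (k : nat) (A : set ('rV[R]_n * 'rV[R]_n))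
    (F : 'rV[R]_n * 'rV[R]_n -> R) : Prop :=
  match k with
  | 0 => forall x, A x -> {for x, continuous F}
  | k'.+1 => (forall x, A x -> differentiable F x) /\
             forall v, class_C k' A (fun x => 'D_v F x)
  end.

Definition conf_open (U : set (conf R n)) : Prop := open (coords @` U).

Definition conf_smooth (U : set (conf R n)) (f : conf R n -> R[i]) : Prop :=
  exists F G : 'rV[R]_n * 'rV[R]_n -> R,
    (forall k, class_C k (coords @` U) F /\ class_C k (coords @` U) G) /\
    (forall z, U z -> f z = F (coords z) +i* G (coords z)).

Definition conf_space : smooth_space R := SmoothSpace conf_open conf_smooth.

End ConfSpace.

Record aff (R : realType) := Aff {
  aff_a : R[i] ;
  aff_b : R[i] ;
  aff_neq0 : aff_a != 0 }.

Definition aff_map (R : realType) (g : aff R) (x : R[i]) : R[i] :=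
  aff_a g * x + aff_b g.

Lemma aff_map_inj (R : realType) (g : aff R) : injective (aff_map g).
Proof. by move=> x y /addIr /(mulfI (aff_neq0 g)). Qed.

Section Moduli.
Variables (R : realType) (n : nat).

Definition conf_act (g : aff R) (z : conf R n) : conf R n :=
  Conf (inj_comp (@aff_map_inj R g) (@pts_inj R n z)).

Definition orbit_rel (z w : conf R n) : bool :=
  `[< exists g, w = conf_act g z >].

Lemma orbit_rel_equiv : equiv_class_of orbit_rel.
Proof.
split=> [z|z w|w z y].
- apply/asboolP; exists (Aff 0 (oner_neq0 R[i])); apply: conf_eq => i /=.
  by rewrite /aff_map /= mul1r addr0.
- suff S u v : orbit_rel u v -> orbit_rel v u by apply/idP/idP; exact: S.
  move=> /asboolP[g ->]; apply/asboolP.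
  have ga0 := aff_neq0 g; have gi0 : (aff_a g)^-1 != 0 by rewrite invr_eq0.
  exists (Aff (- ((aff_a g)^-1 * aff_b g)) gi0); apply: conf_eq => i /=.
  by rewrite /aff_map /= mulrDr mulrA mulVf // mul1r addrK.
- move=> /asboolP[g ->] /asboolP[h ->]; apply/asboolP.
  have gh0 : aff_a h * aff_a g != 0 by rewrite mulf_neq0 ?aff_neq0.
  exists (Aff (aff_a h * aff_b g + aff_b h) gh0); apply: conf_eq => i /=.
  by rewrite /aff_map /= mulrDr addrA mulrA.
Qed.

Canonical orbit_rel_equiv_rel := EquivRelPack orbit_rel_equiv.

(* M_{0,n+1}, as the orbit space Conf_n / Gamma. *)
Definition moduli : Type := {eq_quot orbit_rel}.

HB.instance Definition _ := Choice.on moduli.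
HB.instance Definition _ : EqQuotient _ orbit_rel moduli := EqQuotient.on moduli.

Definition to_moduli (z : conf R n) : moduli := \pi_moduli z.

Definition moduli_space : smooth_space R :=
  @SmoothSpace R moduli
    (fun U => conf_open (to_moduli @^-1` U))
    (fun U f => conf_smooth (to_moduli @^-1` U) (f \o to_moduli)).

Definition push_tangent (v : (conf R n -> R[i]) -> R[i]) :
    (moduli -> R[i]) -> R[i] :=
  fun f => v (f \o to_moduli).

End Moduli.

Record equiv_bundle (R : realType) (n : nat) := EquivBundle {
  total :> bundle (conf_space R n) ;
  act : forall (g : aff R) (z : conf R n), {linear total z -> total (conf_act g z)} }.

Section QuotientFiber.
Variables (R : realType) (n : nat) (E : equiv_bundle R n) (p : moduli R n).

(* A point of E / Gamma over p is a Gamma-orbit in E meeting every fiber of E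
   over p once, i.e. the graph of an equivariant family on the orbit p. *)
Record qfiber := QFiber {
  family :> forall z : conf R n, to_moduli z = p -> E z ;
  familyP : forall g z (e : to_moduli z = p) (e' : to_moduli (conf_act g z) = p),
    family e' = act E g z (family e) }.

HB.instance Definition _ := gen_eqMixin qfiber.
HB.instance Definition _ := gen_choiceMixin qfiber.

Lemma qfiber_eq (x y : qfiber) : (forall z e, x z e = y z e) -> x = y.
Proof.
case: x y => [x hx] [y hy] /= e.
have exy : x = y by apply: functional_extensionality_dep => z; apply: funext.
by rewrite exy in hx *; congr QFiber; exact: Prop_irrelevance.
Qed.

Definition qzero : qfiber.
Proof. by exists (fun _ _ => 0) => *; rewrite linear0. Defined.

Definition qadd (x y : qfiber) : qfiber.
Proof.
exists (fun z e => x z e + y z e) => g z e e'.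
by rewrite (familyP x e) (familyP y e) linearD.
Defined.

Definition qopp (x : qfiber) : qfiber.
Proof.
by exists (fun z e => - x z e) => g z e e'; rewrite (familyP x e) linearN.
Defined.

Definition qscale (c : R[i]) (x : qfiber) : qfiber.
Proof.
by exists (fun z e => c *: x z e) => g z e e'; rewrite (familyP x e) linearZ.
Defined.

Fact qaddA : associative qadd.
Proof. by move=> x y t; apply: qfiber_eq => z e /=; rewrite addrA. Qed.
Fact qaddC : commutative qadd.
Proof. by move=> x y; apply: qfiber_eq => z e /=; rewrite addrC. Qed.
Fact qadd0 : left_id qzero qadd.
Proof. by move=> x; apply: qfiber_eq => z e /=; rewrite add0r. Qed.
Fact qaddN : left_inverse qzero qopp qadd.
Proof. by move=> x; apply: qfiber_eq => z e /=; rewrite addNr. Qed.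

HB.instance Definition _ := GRing.isZmodule.Build qfiber qaddA qaddC qadd0 qaddN.

Fact qscaleA a b (x : qfiber) : qscale a (qscale b x) = qscale (a * b) x.
Proof. by apply: qfiber_eq => z e /=; rewrite scalerA. Qed.
Fact qscale1 : left_id 1 qscale.
Proof. by move=> x; apply: qfiber_eq => z e /=; rewrite scale1r. Qed.
Fact qscaleDr : right_distributive qscale +%R.
Proof. by move=> a x y; apply: qfiber_eq => z e /=; rewrite scalerDr. Qed.
Fact qscaleDl (x : qfiber) : {morph qscale^~ x : a b / a + b}.
Proof. by move=> a b; apply: qfiber_eq => z e /=; rewrite scalerDl. Qed.

HB.instance Definition _ :=
  GRing.Zmodule_isLmodule.Build R[i] qfiber qscaleA qscale1 qscaleDr qscaleDl.

End QuotientFiber.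

Section QuotientBundle.
Variables (R : realType) (n : nat) (E : equiv_bundle R n).

(* The canonical map from the pull-back of E / Gamma to E. *)
Definition eval_at (z : conf R n) (x : qfiber E (to_moduli z)) : E z :=
  x z erefl.

Definition pull_section (s : forall p, qfiber E p) : forall z, E z :=
  fun z => eval_at (s (to_moduli z)).

Definition quotient_bundle : bundle (moduli_space R n) :=
  @Bundle R (moduli_space R n) (fun p => qfiber E p : lmodType R[i])
    (fun U s => @smooth_section R (conf_space R n) E (@to_moduli R n @^-1` U)
                                (pull_section s)).

(* E is the pull-back of E / Gamma, and E / Gamma has enough smooth sections. *)
Definition bundle_descends : Prop :=
  forall z : conf R n,
    bijective (@eval_at z) /\
    forall x : E z, exists s : forall p, quotient_bundle p,
      section_near (to_moduli z : moduli_space R n) s /\ pull_section s z = x.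

Definition is_pullback (nabla : covariant_derivative E)
    (nabla' : covariant_derivative quotient_bundle) : Prop :=
  forall (z : conf R n) v (s : forall p, quotient_bundle p),
    is_tangent (z : conf_space R n) v ->
    section_near (to_moduli z : moduli_space R n) s ->
    nabla z v (pull_section s)
    = eval_at (nabla' (to_moduli z) (push_tangent v) s).

Definition connection_descends (nabla : covariant_derivative E) : Prop :=
  flat_connection nabla /\
  exists nabla' : covariant_derivative quotient_bundle,
    flat_connection nabla' /\ is_pullback nabla nabla'.

End QuotientBundle.

Definition map_descends (R : realType) (n : nat) (E F : equiv_bundle R n)
    (h : forall z, E z -> F z) : Prop :=
  exists h' : forall p, quotient_bundle E p -> quotient_bundle F p,
    [/\ forall p, linear (h' p),
        forall z (x : quotient_bundle E (to_moduli z)),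
          eval_at (h' (to_moduli z) x) = h z (eval_at x)
      & smooth_map h -> smooth_map h'].

Section Loops.
Variables (R : realType) (n : nat).

Definition ccontinuous (T : topologicalType) (A : set T) (f : T -> R[i]) : Prop :=
  {within A, continuous (fun x => complex.Re (f x))} /\
  {within A, continuous (fun x => complex.Im (f x))}.

Definition unit_interval : set R := [set t | 0 <= t <= 1].

Definition unit_square : set (R * R) := unit_interval `*` unit_interval.

(* Curves are parametrized by [0, 1]; values elsewhere are irrelevant. *)
Definition closed_curve (gamma : R -> R[i]) : Prop :=
  ccontinuous unit_interval gamma /\ gamma 0 = gamma 1.

Definition is_loop (z : conf R n) (gamma : R -> R[i]) : Prop :=
  closed_curve gamma /\ forall t i, unit_interval t -> gamma t != z i.

Record loop (z : conf R n) := Loop {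
  curve :> R -> R[i] ;
  curveP : is_loop z curve }.

HB.instance Definition _ z := gen_eqMixin (loop z).
HB.instance Definition _ z := gen_choiceMixin (loop z).

Definition free_homotopy (z : conf R n) (gamma delta : R -> R[i])
    (H : R * R -> R[i]) : Prop :=
  [/\ ccontinuous unit_square H,
      forall x i, unit_square x -> H x != z i,
      forall t, unit_interval t -> H (0, t) = gamma t,
      forall t, unit_interval t -> H (1, t) = delta t
    & forall s, unit_interval s -> H (s, 0) = H (s, 1)].

Definition freely_homotopic (z : conf R n) (gamma delta : loop z) : bool :=
  `[< exists H, free_homotopy z gamma delta H >].


Lemma within_comp (T U V : topologicalType) (A : set T) (B : set U)
    (phi : T -> U) (f : U -> V) :
  continuous phi -> (forall x, A x -> B (phi x)) ->
  {within B, continuous f} -> {within A, continuous (fun x => f (phi x))}.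
Proof.
move=> cphi AB /subspace_continuousP cf; apply/subspace_continuousP => x Ax.
apply: cvg_trans (cf _ (AB _ Ax)) => W /= fW; rewrite /within /=.
have : \forall y \near x, B (phi y) -> W (f (phi y)) by exact: (cphi x _ fW).
by apply: filterS => y BW Ay; exact/BW/AB.
Qed.

Lemma ccontinuous_comp (T U : topologicalType) (A : set T) (B : set U)
    (phi : T -> U) (f : U -> R[i]) :
  continuous phi -> (forall x, A x -> B (phi x)) ->
  ccontinuous B f -> ccontinuous A (fun x => f (phi x)).
Proof.
move=> cphi AB [c1 c2]; split.
  exact: (within_comp cphi AB c1).
exact: (within_comp cphi AB c2).
Qed.

Lemma ccontinuous_eq (T : topologicalType) (A : set T) (f g : T -> R[i]) :
  (forall x, A x -> f x = g x) -> ccontinuous A f -> ccontinuous A g.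
Proof.
move=> fg [c1 c2]; split.
  apply: (@subspace_eq_continuous T A _ (fun x => complex.Re (f x))) => // x.
  by move=> /set_mem Ax /=; rewrite fg.
apply: (@subspace_eq_continuous T A _ (fun x => complex.Im (f x))) => // x.
by move=> /set_mem Ax /=; rewrite fg.
Qed.

Lemma ccontinuousU (T : topologicalType) (A B : set T) (f : T -> R[i]) :
  closed A -> closed B -> ccontinuous A f -> ccontinuous B f ->
  ccontinuous (A `|` B) f.
Proof. by move=> cA cB [? ?] [? ?]; split; exact: withinU_continuous. Qed.

Lemma closed_box (a b : R) :
  closed ([set t | a <= t <= b] `*` unit_interval).
Proof.
have e (c d : R) : [set t | c <= t <= d] = `[c, d]%classic.
  by apply/funext => t; rewrite /= in_itv.
rewrite (_ : _ `*` _ =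
  fst @^-1` [set t | a <= t <= b] `&` snd @^-1` [set t | 0 <= t <= 1]) //.
by apply: closedI; apply: closed_comp => [x _|];
  do ?[exact: cvg_fst | exact: cvg_snd]; rewrite e; exact: itv_closed.
Qed.

Lemma freely_homotopic_equiv z : equiv_class_of (@freely_homotopic z).
Proof.
have cid2 (c d : R) : continuous (fun x : R * R => (c + d * x.1, x.2)).
  have c1 : continuous (fun x : R * R => c + d * x.1).
    move=> x; apply: (@cvgD _ R^o); first exact: cvg_cst.
    by apply: cvgM; [exact: cvg_cst | exact: cvg_fst].
  by move=> [x y]; exact: (cvg_pair (c1 (x, y)) (@cvg_snd _ _ _ _ _)).
split=> [g|g h|h g k].
- apply/asboolP; exists (fun x => g x.2); have [[cg e01] gz] := curveP g.
  split=> //; last by move=> [s t] i [_ /=]; exact: gz.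
  apply: (ccontinuous_comp _ _ cg) => [x|x [_ //]].
  exact: cvg_snd.
- suff S (u v : loop z) : freely_homotopic u v -> freely_homotopic v u.
    by apply/idP/idP; exact: S.
  move=> /asboolP[H [cH Hz H0 H1 Hl]]; apply/asboolP.
  exists (fun x => H (1 + (-1) * x.1, x.2)).
  have inI t : unit_interval t -> unit_interval (1 + (-1) * t).
    by rewrite /unit_interval /=; move=> /andP[? ?]; apply/andP; split; lra.
  split=> /=.
  + by apply: (ccontinuous_comp _ _ cH) => // -[s t] [/= ? ?]; split => //; exact: inI.
  + by move=> [s t] i [/= ? ?]; apply: Hz; split => //; exact: inI.
  + by move=> t It; rewrite mulr0 addr0 H1.
  + by move=> t It; rewrite mulr1 subrr H0.
  + by move=> s Is; apply: Hl; exact: inI.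
- move=> /asboolP[H [cH Hz H0 H1 Hl]] /asboolP[K [cK Kz K0 K1 Kl]].
  apply/asboolP.
  pose L (x : R * R) := if x.1 <= 2^-1 then H (0 + 2 * x.1, x.2)
                        else K (-1 + 2 * x.1, x.2).
  have LH s t : s <= 2^-1 -> L (s, t) = H (0 + 2 * s, t) by rewrite /L /= => ->.
  have LK s t : 2^-1 <= s -> unit_interval t -> L (s, t) = K (-1 + 2 * s, t).
    move=> s2 It; rewrite /L /=; case: ifPn => // s2'.
    have -> : s = 2^-1 by apply/eqP; rewrite eq_le s2 s2'.
    by rewrite mulfV ?pnatr_eq0 // add0r addrC subrr H1 // K0.
  have h2 : 2 * 2^-1 = 1 :> R by rewrite mulfV ?pnatr_eq0.
  have inA s : 0 <= s <= 2^-1 -> unit_interval (0 + 2 * s).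
    by rewrite /unit_interval /=; move=> /andP[? ?]; apply/andP; split; lra.
  have inB s : 2^-1 <= s <= 1 -> unit_interval (-1 + 2 * s).
    by rewrite /unit_interval /=; move=> /andP[? ?]; apply/andP; split; lra.
  have split2 s : unit_interval s -> 0 <= s <= 2^-1 \/ 2^-1 <= s <= 1.
    rewrite /unit_interval /= => /andP[-> ->] /=; rewrite andbT.
    by have [?|/ltW ?] := leP s 2^-1; [left|right].
  exists L; split.
  + rewrite (_ : unit_square =
      ([set t | 0 <= t <= 2^-1] `*` unit_interval) `|`
      ([set t | 2^-1 <= t <= 1] `*` unit_interval)); last first.
      apply/seteqP; split=> -[s t] /=.
        by move=> [/split2[?|?] ?]; [left|right].
      rewrite /unit_square /unit_interval /=.
      by move=> [[/andP[? ?] ?]|[/andP[? ?] ?]]; split => //;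
        apply/andP; split => //; lra.
    apply: ccontinuousU; [exact: closed_box | exact: closed_box | |].
    * apply: (@ccontinuous_eq (R * R)%type _ (fun x => H (0 + 2 * x.1, x.2))).
        by move=> [s t] [/= /andP[_ s2] _]; rewrite LH.
      by apply: (ccontinuous_comp _ _ cH) => // -[s t] [/= ? ?]; split => //; exact: inA.
    * apply: (@ccontinuous_eq (R * R)%type _ (fun x => K (-1 + 2 * x.1, x.2))).
        by move=> [s t] [/= /andP[s2 _] ?]; rewrite LK.
      by apply: (ccontinuous_comp _ _ cK) => // -[s t] [/= ? ?]; split => //; exact: inB.
  + move=> [s t] i [/= /split2[sA|sB] It].
      by rewrite LH; [apply: Hz; split => //; exact: inA | case/andP: sA].
    by rewrite LK //; [apply: Kz; split => //; exact: inB | case/andP: sB].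
  + by move=> t It; rewrite LH ?invr_ge0 // mulr0 addr0 H0.
  + move=> t It; rewrite LK //; last by rewrite invf_le1 ?ler1n.
    by rewrite (_ : -1 + 2 * 1 = 1) ?K1 //; lra.
  + have I0 : unit_interval 0 by rewrite /unit_interval /= lexx ler01.
    have I1 : unit_interval 1 by rewrite /unit_interval /= lexx ler01.
    move=> s /split2[sA|sB].
      by case/andP: (sA) => _ s2; rewrite !LH //; exact/Hl/inA.
    by case/andP: (sB) => s2 _; rewrite !LK //; exact/Kl/inB.
Qed.

Canonical freely_homotopic_equiv_rel z := EquivRelPack (freely_homotopic_equiv z).

Definition homotopy_class (z : conf R n) : Type := {eq_quot (@freely_homotopic z)}.

HB.instance Definition _ z := Choice.on (homotopy_class z).
HB.instance Definition _ z : EqQuotient _ (@freely_homotopic z) (homotopy_class z) :=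
  EqQuotient.on (homotopy_class z).

(* |C pi_1(Sigma^(z))|, spanned by the free homotopy classes. *)
Definition loop_space (z : conf R n) : Type := {freeg (homotopy_class z) / R[i]}.

HB.instance Definition _ z := GRing.Lmodule.on (loop_space z).

(* The class of a closed curve avoiding the points of z. *)
Definition curve_class (z : conf R n) (gamma : R -> R[i]) : loop_space z :=
  if pselect (is_loop z gamma) is left h
  then << (\pi_(homotopy_class z) (Loop h)) >> else 0.

End Loops.

Section BundleG.
Variables (R : realType) (n : nat).

Lemma aff_continuous (T : topologicalType) (A : set T) (f : T -> R[i]) g :
  ccontinuous A f -> ccontinuous A (fun x => aff_map g (f x)).
Proof.
move=> [/subspace_continuousP c1 /subspace_continuousP c2].
rewrite /aff_map; case: (aff_a g) (aff_b g) => [a1 a2] [b1 b2].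
apply: (@ccontinuous_eq R T A (fun x =>
  (a1 * complex.Re (f x) - a2 * complex.Im (f x) + b1) +i*
  (a1 * complex.Im (f x) + a2 * complex.Re (f x) + b2))).
  by move=> x _; case: (f x).
split; apply/subspace_continuousP => x Ax /=;
  have {}c1 := c1 x Ax; have {}c2 := c2 x Ax.
- apply: (@cvgD _ R^o); last exact: cvg_cst.
  by apply: (@cvgB _ R^o); apply: cvgM => //; exact: cvg_cst.
- apply: (@cvgD _ R^o); last exact: cvg_cst.
  by apply: (@cvgD _ R^o); apply: cvgM => //; exact: cvg_cst.
Qed.

Lemma loop_actP g (z : conf R n) (gamma : loop z) :
  is_loop (conf_act g z) (fun t => aff_map g (gamma t)).
Proof.
have [[cg e] gz] := curveP gamma; split=> [|t i It /=].
  by split; [exact: aff_continuous | rewrite e].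
by rewrite (inj_eq (@aff_map_inj R g)) gz.
Qed.

Definition loop_act g (z : conf R n) (gamma : loop z) : loop (conf_act g z) :=
  Loop (loop_actP g gamma).

Definition class_act g (z : conf R n) (c : homotopy_class z) :
    homotopy_class (conf_act g z) :=
  \pi_(homotopy_class (conf_act g z)) (loop_act g (repr c)).

Fact fglift_linear (K : choiceType) (M : lmodType R[i]) (f : K -> M) :
  linear (fglift f : {freeg K / R[i]} -> M).
Proof.
have fgD (x y : {freeg K / R[i]}) : fglift f (x + y) = fglift f x + fglift f y.
  have := lift_is_additive f x (- y); rewrite opprK => ->.
  have := lift_is_additive f 0 y; rewrite sub0r => ->.
  have := lift_is_additive f 0 0; rewrite subrr => ->.
  by rewrite subrr sub0r opprK.
have fg0 : fglift f (0 : {freeg K / R[i]}) = 0.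
  by have := lift_is_additive f 0 0; rewrite !subrr.
move=> a x y; rewrite fgD; congr (_ + _).
rewrite -[x]freeg_sumE; elim: (dom x) => [|k s IH].
  by rewrite !big_nil scaler0 fg0 scaler0.
rewrite !big_cons scalerDr !fgD IH scalerDr; congr (_ + _).
rewrite (_ : a *: << _ *g k >> = << a * coeff k x *g k >>).
  by rewrite !liftU scalerA.
by apply/eqP/freeg_eqP => l; rewrite coeffZ !coeffU mulrA.
Qed.

Definition loop_space_act g (z : conf R n) :
    loop_space z -> loop_space (conf_act g z) :=
  fglift (fun c => << class_act g c >>).

HB.instance Definition _ g z :=
  GRing.isLinear.Build R[i] (loop_space z) (loop_space (conf_act g z)) _
    (@loop_space_act g z) (fglift_linear _).

(* Near p, in the trivialization given by the disks of radius r around the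
   points of p, the section s is the finite combination of the closed curves
   gamma_k, which avoid the disks, with smooth coefficients f_k. *)
Definition local_expression (p : conf R n) (s : forall z : conf R n, loop_space z)
    (m : nat) (f : 'I_m -> conf R n -> R[i]) (gamma : 'I_m -> R -> R[i]) : Prop :=
  exists r : R,
    [/\ 0 < r,
        forall i j, i != j -> (2 * r)%:C <= `|p i - p j|,
        forall k, closed_curve (gamma k),
        forall k t i, unit_interval t -> r%:C <= `|gamma k t - p i|
      & (forall k, smooth_near (p : conf_space R n) (f k)) /\
        near_pt (p : conf_space R n) (fun w =>
          (forall i, `|w i - p i| < r%:C) /\
          s w = \sum_(k < m) f k w *: curve_class w (gamma k))].

Definition G_section (U : set (conf R n)) (s : forall z, loop_space z) : Prop :=
  forall p, U p -> exists m f gamma, @local_expression p s m f gamma.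

Definition G_bundle : equiv_bundle R n :=
  @EquivBundle R n
    (@Bundle R (conf_space R n) (fun z => loop_space z : lmodType R[i]) G_section)
    (fun g z => @loop_space_act g z : {linear _ -> _}).

(* The sections with locally constant coefficients f_k are flat. *)
Definition nabla_G : covariant_derivative G_bundle :=
  fun p v s => xget 0 [set h : loop_space p | exists m f gamma,
    @local_expression p s m f gamma /\
    h = \sum_(k < m) v (f k) *: curve_class p (gamma k)].

End BundleG.

Section Cyclic.
Variables (R : realType) (n : nat).

(* A formal series is given by its coefficients on the words in 'I_n. *)
Definition TH : Type := seq 'I_n -> R[i]^o.

HB.instance Definition _ := GRing.Lmodule.on TH.

Definition th_mul (x y : TH) : TH :=
  fun w => \sum_(k < (size w).+1) x (take k w) * y (drop k w).

Definition th_comm (x y : TH) : TH := th_mul x y - th_mul y x.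

Definition th_word (u : seq 'I_n) : TH := fun w => (w == u)%:R.

Definition th_gen (i : 'I_n) : TH := th_word [:: i].

(* Closure, for the degree filtration, of the span of the commutators. *)
Definition comm_closure : {pred TH} := fun x =>
  `[< forall N : nat, exists l : seq (TH * TH),
        forall w, (size w <= N)%N ->
          x w = (\sum_(p <- l) th_comm p.1 p.2) w >].

Lemma th_sumE (I : Type) (l : seq I) (F : I -> TH) w :
  (\sum_(p <- l) F p) w = \sum_(p <- l) F p w.
Proof. by elim: l => [|p l IH]; rewrite ?big_nil // !big_cons -IH. Qed.

Lemma comm_closure_submod : submod_closed comm_closure.
Proof.
split=> [|a x y /asboolP cx /asboolP cy]; apply/asboolP => N.
  by exists [::] => w _; rewrite big_nil.
have [l lx] := cx N; have [k ky] := cy N.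
exists ([seq (a *: p.1, p.2) | p <- l] ++ k) => w wN.
rewrite big_cat big_map -[LHS]/(a * x w + y w) lx // ky //.
rewrite -[RHS]/((_ : TH) w + (_ : TH) w); congr (_ + _).
rewrite !th_sumE mulr_sumr; apply: eq_bigr => p _.
rewrite -[th_comm p.1 p.2 w]/(_ - _) -[RHS]/(_ - _) mulrBr !mulr_sumr.
by congr (_ - _); apply: eq_bigr => j _; [exact: mulrA | exact: mulrCA].
Qed.

HB.instance Definition _ :=
  GRing.isSubmodClosed.Build R[i] TH comm_closure comm_closure_submod.

(* |TH_1| = TH_1 / [TH_1, TH_1]. *)
Definition cTH : Type := Quotient.quot comm_closure.

HB.instance Definition _ := GRing.Zmodule.on cTH.

Definition cyc (x : TH) : cTH := \pi_(Quotient.quot comm_closure) x.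

Definition cyc_repr (x : cTH) : TH := repr (x : Quotient.quot comm_closure).

Lemma cyc_reprK x : cyc (cyc_repr x) = x.
Proof. exact: reprK. Qed.

Lemma cyc_eq x y : cyc x = cyc y <-> x - y \in comm_closure.
Proof.
split=> [/eqP|h]; first by rewrite /cyc -Quotient.idealrBE.
by apply/eqP; rewrite /cyc -Quotient.idealrBE.
Qed.

Lemma cycD x y : cyc (x + y) = cyc x + cyc y.
Proof. by rewrite /cyc piE. Qed.

Definition cscale (c : R[i]) (x : cTH) : cTH := cyc (c *: cyc_repr x).

Lemma cscale_cyc c x : cscale c (cyc x) = cyc (c *: x).
Proof.
by apply/cyc_eq; rewrite -scalerBr rpredZ //; apply/cyc_eq; rewrite cyc_reprK.
Qed.

Fact cscaleA a b x : cscale a (cscale b x) = cscale (a * b) x.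
Proof. by rewrite -[x]cyc_reprK !cscale_cyc scalerA. Qed.
Fact cscale1 : left_id 1 cscale.
Proof. by move=> x; rewrite -[x]cyc_reprK cscale_cyc scale1r. Qed.
Fact cscaleDr : right_distributive cscale +%R.
Proof.
move=> a x y; rewrite -[x]cyc_reprK -[y]cyc_reprK.
by rewrite -cycD !cscale_cyc scalerDr cycD.
Qed.
Fact cscaleDl x : {morph cscale^~ x : a b / a + b}.
Proof. by move=> a b; rewrite -[x]cyc_reprK !cscale_cyc scalerDl cycD. Qed.

HB.instance Definition _ :=
  GRing.Zmodule_isLmodule.Build R[i] cTH cscaleA cscale1 cscaleDr cscaleDl.

(* The derivation t_ij of TH: on generators, on words by the Leibniz rule, and
   on series by continuity.  It raises the degree by one, hence the sum below
   runs over the words of length (size w) - 1. *)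
Definition t_gen (i j k : 'I_n) : TH :=
  if k == i then th_comm (th_gen i) (th_gen j)
  else if k == j then th_comm (th_gen j) (th_gen i) else 0.

Fixpoint t_word (i j : 'I_n) (u : seq 'I_n) : TH :=
  match u with
  | [::] => 0
  | k :: u' => th_mul (t_gen i j k) (th_word u') + th_mul (th_gen k) (t_word i j u')
  end.

Definition t_der (i j : 'I_n) (x : TH) : TH :=
  fun w => \sum_(u : (size w).-1.-tuple 'I_n) x u * t_word i j u w.

Definition ad_t (i j : 'I_n) (x : cTH) : cTH := cyc (t_der i j (cyc_repr x)).

End Cyclic.

Section BundleH.
Variables (R : realType) (n : nat).

Definition two_pi_i : R[i] := 0 +i* (2 * pi).

(* A map to |TH_1| is smooth when it lifts to a map to TH_1 with smooth
   coefficients; in each degree, |TH_1| is a quotient of a finite-dimensional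
   space. *)
Definition smooth_lift (U : set (conf R n)) (s : conf R n -> cTH R n)
    (l : conf R n -> TH R n) : Prop :=
  (forall w, conf_smooth U (fun z => l z w)) /\ (forall z, U z -> s z = cyc (l z)).

Definition H_section (U : set (conf R n)) (s : conf R n -> cTH R n) : Prop :=
  exists l, smooth_lift U s l.

Definition H_bundle : equiv_bundle R n :=
  @EquivBundle R n
    (@Bundle R (conf_space R n) (fun=> cTH R n : lmodType R[i]) H_section)
    (fun g z => idfun : {linear _ -> _}).

Definition d_H : covariant_derivative H_bundle :=
  fun p v s => xget 0 [set h : cTH R n | exists (U : set (conf R n)) l,
    [/\ conf_open U, U p, smooth_lift U s l
      & h = cyc (fun w => v (fun z => l z w))]].

Definition dlog (p : conf R n) (v : (conf R n -> R[i]) -> R[i]) (i j : 'I_n) :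
    R[i] :=
  v (fun z => z i - z j) / (p i - p j).

Definition nabla_H : covariant_derivative H_bundle :=
  fun p v s => d_H p v s + two_pi_i^-1 *:
    \sum_(i < n) \sum_(j < n | (i < j)%N) dlog p v i j *: ad_t i j (s p).

End BundleH.

Section Holonomy.
Variables (R : realType) (n : nat).

(* The derivative, set to 0 at the points (such as the break points of a
   piecewise C^1 curve) where it does not exist. *)
Definition cderive (gamma : R -> R[i]) (t : R) : R[i] :=
  if `[< derivable (fun u => complex.Re (gamma u)) t 1 /\
         derivable (fun u => complex.Im (gamma u)) t 1 >]
  then derive1 (fun u => complex.Re (gamma u)) t +i*
       derive1 (fun u => complex.Im (gamma u)) t
  else 0.

Definition class_C1 (gamma : R -> R[i]) : Prop :=
  [/\ forall t, derivable (fun u => complex.Re (gamma u)) t 1,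
      forall t, derivable (fun u => complex.Im (gamma u)) t 1,
      continuous (derive1 (fun u => complex.Re (gamma u)))
    & continuous (derive1 (fun u => complex.Im (gamma u)))].

Definition piecewise_C1 (gamma : R -> R[i]) : Prop :=
  exists m (t : nat -> R),
    [/\ t 0%N = 0, t m = 1, forall k, (k < m)%N -> t k < t k.+1
      & forall k, (k < m)%N -> exists2 delta, class_C1 delta &
          forall u, t k <= u <= t k.+1 -> gamma u = delta u].

Definition cintegral (a b : R) (f : R -> R[i]) : R[i] :=
  (\int[lebesgue_measure]_(u in `[a, b]) complex.Re (f u)) +i*
  (\int[lebesgue_measure]_(u in `[a, b]) complex.Im (f u)).

Fixpoint iterated_integral (z : conf R n) (gamma : R -> R[i]) (w : seq 'I_n)
    (t : R) : R[i] :=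
  match w with
  | [::] => 1
  | i :: w' => cintegral 0 t (fun u =>
      (two_pi_i R)^-1 * (cderive gamma u / (gamma u - z i)) *
      iterated_integral z gamma w' u)
  end.

Definition hol (z : conf R n) (gamma : R -> R[i]) : TH R n :=
  fun w => iterated_integral z gamma w 1.

(* The common value of |Hol_gamma| on the piecewise C^1 loops gamma in the free
   homotopy class c. *)
Definition hol_class (z : conf R n) (c : homotopy_class z) : cTH R n :=
  xget 0 [set h | forall gamma : loop z,
    piecewise_C1 gamma -> \pi_(homotopy_class z) gamma = c ->
    h = cyc (hol z gamma)].

Definition holonomy_map (z : conf R n) : G_bundle R n z -> H_bundle R n z :=
  fglift (@hol_class z).

End Holonomy.

(* Main.v *)
(* Conf_n is a product of an orbit space and orbits: the slice of z is the point
   of the orbit of z with z_0 = 0 and z_(n-1) = 1, so that z = scale(z) slice(z) + z_0.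
   Both connections on the quotient are obtained by transporting along the slice
   map sigma : M_(0,n+1) -> Conf_n the formula that defines them upstairs.

   For H_n, dlog(z_i - z_j) changes by -dlog(scale z) along the slice, which is the
   same for all pairs, and the sum of all the t_ij acts on TH_1 as the inner derivation
   - [a_1 + ... + a_n, . ], hence trivially on |TH_1|.  Flatness is the Arnold relation.
   The canonical section of TH_1 -> |TH_1| given by cyclic averages turns every
   computation in |TH_1| into one on coefficients.

   For G_n, the connection is well defined because a loop space is transported to a
   nearby one by a perturbation of the identity of C that moves the punctures and fixes
   the finitely many curves in use.  The quotient has a frame given by the classes of
   scale(z) gamma + z_0; for n = 1 its equivariance uses that C^* is connected, since
   then the action of Gamma is not free.

   The holonomy is equivariant because d log(zeta - z_i) is invariant under Gamma. *)
From HB Require Import structures.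
From mathcomp Require Import all_boot all_order all_algebra.
From mathcomp Require Import generic_quotient ring_quotient complex freeg.
From mathcomp Require Import all_classical all_reals all_analysis.
From mathcomp Require Import ring lra.
Require Import Defs.

Set Implicit Arguments.
Unset Strict Implicit.
Unset Printing Implicit Defensive.

Import Order.TTheory GRing.Theory Num.Theory.
Import numFieldNormedType.Exports.

Import ComplexField.Normc.

Local Open Scope classical_set_scope.
Local Open Scope quotient_scope.
Local Open Scope complex_scope.
Local Open Scope ring_scope.

(** * Smooth functions on configuration spaces *)

(** A tangent vector of the quotient is a derivation of functions there, and it is never lifted to
    Conf_n. Precomposition with [sigma] replaces such a lift: a derivation at q acts on the
    functions of q obtained through the slice, so each connection downstairs is the formula upstairs
    with other functions u_i, or with another map to Conf_n. For this reason both connections are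
    built and proved flat over any space whose functions satisfy [function_sheaf], with fibres
    identified by [val] with |TH_1| or with a loop space; the result is then used twice, over Conf_n
    and over the moduli space. A function on the quotient is smooth when its pull-back is, so the
    smoothness of [sigma] is that of [slice], whose coordinates are quotients of differences of the
    z_i. Operators defined by a choice ([xget]) are controlled only on tangent vectors and smooth
    sections. Smoothness near the point is therefore recorded at each differentiation. *)

Section NearEq.
Variables (R : realType) (V W : normedModType R).

(** The first-order expansion of [f] at [x] only sees values near [x], so it is also one of [g];
    uniqueness of the differential then gives 'd g x = 'd f x. *)
Lemma near_eq_differentiable (f g : V -> W) x :
  (\forall y \near x, f y = g y) -> differentiable f x -> differentiable g x.
Proof.
move=> fg df.
have e : g \o shift x = cst (g x) + 'd f x +o_ 0 id.
  apply/eqaddoP => eps eps0.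
  have := diff_locally df; move=> /eqaddoP /(_ eps eps0).
  have := fg; rewrite (near_shift 0 x) subr0 => fg'.
  apply: filterS2 fg' => y; rewrite /= => e1.
  rewrite /= -[(_ - _) y]/(f (y + x) - (f x + _)) -[(_ - _) y]/(g (y + x) - (g x + _)).
  by rewrite e1 (nbhs_singleton fg).
have dg : 'd g x = 'd f x :> (V -> W).
  by apply: diff_unique e; apply: diff_continuous.
by apply/diff_locallyP; rewrite dg; split => //; apply: diff_continuous.
Qed.

End NearEq.

(** * Calculus of class C^k functions of the real coordinates *)

Section ClassC.
Variables (R : realType) (n : nat).
Local Notation V := ('rV[R]_n * 'rV[R]_n)%type.
Implicit Types (F G : V -> R) (A B : set V).

Lemma class_C_sub k A B F : A `<=` B -> class_C k B F -> class_C k A F.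
Proof.
elim: k F => [|k IH] F AB /=; first by move=> h x /AB; exact: h.
by move=> [h1 h2]; split=> [x /AB|v]; [exact: h1 | exact/IH/h2].
Qed.

Lemma class_CW k A F : class_C k.+1 A F -> class_C k A F.
Proof.
elim: k F => [|k IH] F; first by move=> [h _] x Ax; exact/differentiable_continuous/h.
by move=> [h1 h2]; split=> // v; exact/IH/h2.
Qed.

Lemma open_near A (P : V -> Prop) x : open A -> A x -> (forall y, A y -> P y) ->
  \forall y \near x, P y.
Proof. by move=> oA Ax h; apply: filterS h _; exact: open_nbhs_nbhs. Qed.

Lemma eq_class_C k A F G : open A -> (forall x, A x -> F x = G x) ->
  class_C k A F -> class_C k A G.
Proof.
move=> oA; elim: k F G => [|k IH] F G FG.
  move=> h x Ax; have FGx := open_near oA Ax FG.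
  rewrite /prop_for /continuous_at -(FG x Ax).
  by apply: cvg_trans (h x Ax); apply: near_eq_cvg; apply: filterS FGx.
move=> [h1 h2]; split=> [x Ax|v].
  by apply: near_eq_differentiable (h1 x Ax); exact: open_near FG.
apply: IH (h2 v) => x Ax; apply: near_eq_derive; exact: open_near FG.
Qed.

Lemma class_C_ext k A F G : F =1 G -> class_C k A F -> class_C k A G.
Proof. by move=> /funext ->. Qed.

Lemma class_C_cst k A c : class_C k A (fun=> c).
Proof.
elim: k c => [|k IH] c; first by move=> x _; exact: cvg_cst.
split=> [x _|v]; first exact: differentiable_cst.
by apply: (class_C_ext _ (IH 0)) => x; rewrite (derive_cst (c : R^o)).
Qed.

Lemma class_C_add k A F G : open A -> class_C k A F -> class_C k A G ->
  class_C k A (fun x => F x + G x).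
Proof.
move=> oA; elim: k F G => [|k IH] F G.
  by move=> cF cG x Ax; apply: (@cvgD _ R^o); [exact: cF | exact: cG].
move=> [dF cF] [dG cG]; split=> [x Ax|v].
  exact: (@differentiableD _ _ R^o F G _ (dF x Ax) (dG x Ax)).
apply: (@eq_class_C k A (fun x => 'D_v F x + 'D_v G x)) => //; last exact: (IH _ _ (cF v) (cG v)).
move=> x Ax; apply: esym; apply: (@deriveD _ _ R^o F G); apply: diff_derivable.
  exact: dF.
exact: dG.
Qed.

Lemma class_C_mul k A F G : open A -> class_C k A F -> class_C k A G ->
  class_C k A (fun x => F x * G x).
Proof.
move=> oA; elim: k F G => [|k IH] F G.
  by move=> cF cG x Ax; apply: cvgM; [exact: cF | exact: cG].
move=> HF HG; have [dF cF] := HF; have [dG cG] := HG; split=> [x Ax|v].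
  exact: (differentiableM (dF x Ax) (dG x Ax)).
apply: (@eq_class_C k A (fun x => F x * 'D_v G x + G x * 'D_v F x)) => //.
  move=> x Ax; apply: esym; apply: (@deriveM _ _ F G); apply: diff_derivable.
    exact: dF.
  exact: dG.
apply: (class_C_add oA); apply: IH; [exact: class_CW HF | exact: cG | exact: class_CW HG | exact: cF].
Qed.

Lemma class_C_opp k A F : open A -> class_C k A F -> class_C k A (fun x => - F x).
Proof.
move=> oA cF; apply: (@eq_class_C k A (fun x => -1 * F x)) => //.
  by move=> x _; rewrite mulN1r.
by apply: class_C_mul => //; exact: class_C_cst.
Qed.

Lemma class_C_inv k A F : open A -> (forall x, A x -> F x != 0) ->
  class_C k A F -> class_C k A (fun x => (F x)^-1).
Proof.
move=> oA F0; elim: k => [|k IH].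
  by move=> cF x Ax; apply: cvgV; [exact: F0 | exact: cF].
move=> HF; have [dF cF] := HF; split=> [x Ax|v].
  exact: (differentiableV (dF x Ax) (F0 x Ax)).
apply: (@eq_class_C k A (fun x => - ((F x)^-1 * (F x)^-1) * 'D_v F x)) => //.
  move=> x Ax; rewrite (@deriveV _ _ F) ?F0 //; last by apply: diff_derivable; exact: dF.
  by rewrite -[RHS]/(_ * _) -expr2 exprVn.
have cV : class_C k A (fun x => (F x)^-1) by apply: IH; exact: class_CW.
exact: (class_C_mul oA (class_C_opp oA (class_C_mul oA cV cV)) (cF v)).
Qed.

Lemma class_C_sum (I : Type) (r : seq I) k A (F : I -> V -> R) : open A ->
  (forall i, class_C k A (F i)) -> class_C k A (fun x => \sum_(i <- r) F i x).
Proof.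
move=> oA cF; elim: r => [|i r IH].
  by apply: (class_C_ext _ (@class_C_cst k A 0)) => x; rewrite big_nil.
by apply: (class_C_ext _ (class_C_add oA (cF i) IH)) => x; rewrite big_cons.
Qed.

Lemma class_C_linear k A (f : {linear V -> R^o}) : continuous f -> class_C k A f.
Proof.
move=> cf; case: k => [|k]; first by move=> x _; exact: cf.
split=> [x _|v]; first exact: linear_differentiable.
apply: (class_C_ext _ (@class_C_cst k A (f v))) => x.
by rewrite deriveE ?diff_lin //; exact: linear_differentiable.
Qed.

Definition coordl (i : 'I_n) (x : V) : R^o := x.1 0 i.
Definition coordr (i : 'I_n) (x : V) : R^o := x.2 0 i.

Fact coordl_linear i : linear (coordl i).
Proof. by move=> a x y; rewrite /coordl /= !mxE. Qed.
Fact coordr_linear i : linear (coordr i).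
Proof. by move=> a x y; rewrite /coordr /= !mxE. Qed.
HB.instance Definition _ i := GRing.isLinear.Build R V R^o _ (coordl i) (coordl_linear i).
HB.instance Definition _ i := GRing.isLinear.Build R V R^o _ (coordr i) (coordr_linear i).

Lemma class_C_coordl k A i : class_C k A (coordl i).
Proof.
apply: class_C_linear => x; apply: (@continuous_comp _ _ _ fst (fun y : 'rV[R]_n => y 0 i : R^o)).
  exact: cvg_fst.
exact: coord_continuous.
Qed.

Lemma class_C_coordr k A i : class_C k A (coordr i).
Proof.
apply: class_C_linear => x; apply: (@continuous_comp _ _ _ snd (fun y : 'rV[R]_n => y 0 i : R^o)).
  exact: cvg_snd.
exact: coord_continuous.
Qed.

Lemma pair_delta (x : V) :
  x = \sum_(i < n) coordl i x *: (delta_mx 0 i, 0) + \sum_(i < n) coordr i x *: (0, delta_mx 0 i).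
Proof.
case: x => a b; rewrite [RHS]surjective_pairing /=.
have s1 (F : 'I_n -> V) : (\sum_(i < n) F i).1 = \sum_(i < n) (F i).1.
  by elim/big_ind2: _ => // ? ? ? ? <- <-.
have s2 (F : 'I_n -> V) : (\sum_(i < n) F i).2 = \sum_(i < n) (F i).2.
  by elim/big_ind2: _ => // ? ? ? ? <- <-.
congr pair; rewrite ?s1 ?s2.
  by rewrite [X in _ + X]big1 ?addr0 -?row_sum_delta // => i _ /=; rewrite scaler0.
by rewrite [X in X + _]big1 ?add0r -?row_sum_delta // => i _ /=; rewrite scaler0.
Qed.

End ClassC.

Section ClassCComp.
Variables (R : realType) (n : nat).
Local Notation V := ('rV[R]_n * 'rV[R]_n)%type.

Variables (A B : set V) (phi : V -> V).
Hypotheses (oA : open A) (AB : forall x, A x -> B (phi x)).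
Hypothesis phil : forall k i, class_C k A (fun x => coordl i (phi x)).
Hypothesis phir : forall k i, class_C k A (fun x => coordr i (phi x)).

Lemma coords_differentiable x : A x -> differentiable phi x.
Proof.
move=> Ax.
rewrite (_ : phi = (\sum_(i < n) (fun y => coordl i (phi y) *: (delta_mx 0 i, 0) : V)) +
   \sum_(i < n) (fun y => coordr i (phi y) *: (0, delta_mx 0 i) : V)); last first.
  apply/funext => y; rewrite {1}[phi y]pair_delta.
  by rewrite -[RHS]/((_ : V -> V) y + (_ : V -> V) y) !fct_sumE.
apply: differentiableD; apply: differentiable_sum => i; apply: differentiableZl.
  by have [] := phil 1 i; move=> h _; exact: h.
by have [] := phir 1 i; move=> h _; exact: h.
Qed.

(** By the chain rule, a directional derivative of F o phi is a sum over the coordinates: the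
    derivative of a coordinate of [phi] times a partial derivative of [F] composed with [phi]. The
    induction hypothesis applies to the latter factor. *)
Lemma class_C_comp k F : class_C k B F -> class_C k A (F \o phi).
Proof.
elim: k F => [|k IH] F.
  move=> cF x Ax; apply: continuous_comp; last exact: cF (AB Ax).
  exact/differentiable_continuous/coords_differentiable.
move=> [dF cF].
split=> [x Ax|v].
  by apply: differentiable_comp; [exact: coords_differentiable | exact: dF (AB Ax)].
apply: (@eq_class_C _ _ k A (fun x =>
   \sum_(i < n) 'D_v (fun y => coordl i (phi y)) x * ('D_((delta_mx 0 i, 0) : V) F \o phi) x +
   \sum_(i < n) 'D_v (fun y => coordr i (phi y)) x * ('D_((0, delta_mx 0 i) : V) F \o phi) x)) => //.
  move=> x Ax; have dp := coords_differentiable Ax; have dFp := dF _ (AB Ax).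
  have Dlin (f : {linear V -> R^o}) : continuous f ->
      'D_v (fun y => f (phi y)) x = f ('d phi x v).
    move=> cf; have df y : differentiable f y by exact: linear_differentiable.
    rewrite deriveE; last by apply: differentiable_comp.
    by rewrite (@diff_comp _ _ _ _ phi f) //= diff_lin.
  rewrite [RHS]deriveE; last exact: differentiable_comp.
  rewrite (@diff_comp _ _ _ _ phi F) //= [X in _ = 'd F _ X]pair_delta.
  rewrite linearD !linear_sum; congr (_ + _); apply: eq_bigr => i _.
    rewrite (Dlin (coordl i)); last by move=> y; exact: (@class_C_coordl _ _ 0 setT).
    by rewrite linearZ /= deriveE.
  rewrite (Dlin (coordr i)); last by move=> y; exact: (@class_C_coordr _ _ 0 setT).
  by rewrite linearZ /= deriveE.
apply: (class_C_add oA); apply: (class_C_sum _ oA) => i; apply: (class_C_mul oA).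
- by have [_ h] := phil k.+1 i; exact: h.
- exact/IH/cF.
- by have [_ h] := phir k.+1 i; exact: h.
- exact/IH/cF.
Qed.

End ClassCComp.

(** * Open sets and smooth functions of Conf_n *)

Section ConfSmooth.
Variables (R : realType) (n : nat).
Local Notation V := ('rV[R]_n * 'rV[R]_n)%type.
Local Notation C := R[i].
Local Notation crd := (@coords R n).
Implicit Types (U W : set (conf R n)) (z w : conf R n).

Lemma coordl_coords z i : coordl i (coords z) = complex.Re (z i).
Proof. by rewrite /coordl /= mxE. Qed.

Lemma coordr_coords z i : coordr i (coords z) = complex.Im (z i).
Proof. by rewrite /coordr /= mxE. Qed.

Lemma complex_ext (x y : C) :
  complex.Re x = complex.Re y -> complex.Im x = complex.Im y -> x = y.
Proof. by case: x y => [a b] [c d] /= -> ->. Qed.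

Lemma coords_inj : injective crd.
Proof.
move=> z w e; apply: conf_eq => i.
by apply: complex_ext; rewrite -?coordl_coords -?coordr_coords e.
Qed.

Lemma coords_image U z : (crd @` U) (coords z) <-> U z.
Proof. by split=> [[w Uw /coords_inj <-]//|Uz]; exists z. Qed.

Definition sqdist (i j : 'I_n) (x : V) : R :=
  (coordl i x - coordl j x) ^+ 2 + (coordr i x - coordr j x) ^+ 2.

Lemma class_C_continuous (F : V -> R) : class_C 0 setT F -> continuous F.
Proof. by move=> h x; exact: h. Qed.

Lemma sqdist_continuous i j : continuous (sqdist i j).
Proof.
apply: class_C_continuous; rewrite /sqdist.
have oT : open (@setT V) by exact: openT.
have cB (f g : V -> R) : class_C 0 setT f -> class_C 0 setT g ->
    class_C 0 setT (fun x => (f x - g x) ^+ 2).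
  move=> cf cg; apply: (@class_C_ext _ _ _ _ (fun x => (f x - g x) * (f x - g x))) => //.
  by apply: (class_C_mul oT); apply: (class_C_add oT) => //; exact: (class_C_opp oT).
by apply: (class_C_add oT); apply: cB; do ?[exact: class_C_coordl | exact: class_C_coordr].
Qed.

(** Describes the image by strict inequalities between continuous functions, from which its openness
    follows. *)
Lemma conf_imageE :
  crd @` [set: conf R n] = [set x | forall i j, i != j -> 0 < sqdist i j x].
Proof.
apply/seteqP; split=> [_ [z _ <-] i j ij|x hx] /=.
  rewrite /sqdist !coordl_coords !coordr_coords lt0r addr_ge0 ?sqr_ge0 // andbT.
  apply: contra_neqN ij => /eqP; move/eqP.
  rewrite paddr_eq0 ?sqr_ge0 // !sqrf_eq0 !subr_eq0 => /andP[/eqP e1 /eqP e2].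
  by apply: (@pts_inj _ _ z); exact: complex_ext.
pose f i := coordl i x +i* coordr i x.
have fi : injective f.
  move=> i j [e1 e2]; apply/eqP; apply: contraT => /hx.
  by rewrite /sqdist e1 e2 !subrr expr0n /= addr0 ltxx.
exists (Conf fi) => //; case: x @f {hx} fi => a b /= fi.
by congr pair; apply/rowP => i; rewrite mxE.
Qed.

Lemma open_forall (T : topologicalType) (I : finType) (P : I -> set T) :
  (forall i, open (P i)) -> open [set x | forall i, P i x].
Proof.
move=> oP; rewrite openE => x /= Px; apply: filter_forall => i.
by apply: open_nbhs_nbhs; split=> //; exact: Px.
Qed.

Lemma open_continuous_lt (T : topologicalType) (f g : T -> R) :
  continuous f -> continuous g -> open [set x | f x < g x].
Proof.
move=> cf cg; rewrite (_ : mkset _ = (fun x => g x - f x) @^-1` [set t | 0 < t]); last first.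
  by apply/seteqP; split=> x /=; rewrite subr_gt0.
apply: open_comp; last exact: open_gt.
by move=> x _; apply: (@cvgB _ R^o); [exact: cg | exact: cf].
Qed.

Lemma eq_open (T : topologicalType) (A B : set T) :
  (forall x, A x <-> B x) -> open A -> open B.
Proof. by move=> AB; rewrite (_ : A = B) //; apply/seteqP; split=> x /AB. Qed.

Lemma conf_openT : conf_open [set: conf R n].
Proof.
rewrite /conf_open conf_imageE.
rewrite (_ : mkset _ = [set x | forall p : 'I_n * 'I_n,
    [set x | p.1 != p.2 -> 0 < sqdist p.1 p.2 x] x]); last first.
  by apply/seteqP; split=> x /= h => [[i j]|i j]; [exact: h | exact: (h (i, j))].
apply: open_forall => -[i j] /=; have [_|ij] := eqVneq i j.
  by apply: (eq_open _ openT) => x; split.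
apply: (@eq_open _ [set x | 0 < sqdist i j x]) => [x|]; first by split=> /= [|/(_ isT)].
apply: open_continuous_lt; [exact: cst_continuous | exact: sqdist_continuous].
Qed.

Lemma conf_imageI U (P : set V) :
  crd @` (U `&` (crd @^-1` P)) = crd @` U `&` P.
Proof.
apply/seteqP; split=> [_ [z [Uz Pz] <-]|_ [[z Uz <-] Pz]]; first by split=> //; exists z.
by exists z.
Qed.

Lemma conf_openI U W : conf_open U -> conf_open W -> conf_open (U `&` W).
Proof.
move=> oU oW; rewrite /conf_open; rewrite (_ : U `&` W = U `&` (crd @^-1` (crd @` W))).
  by rewrite conf_imageI; exact: openI.
by apply/seteqP; split=> z [Uz Wz]; split=> //; exact/coords_image.
Qed.

Lemma conf_open_coords (P : set V) : open P -> conf_open (crd @^-1` P).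
Proof.
move=> oP; rewrite /conf_open (_ : _ @^-1` _ = setT `&` crd @^-1` P).
  by rewrite conf_imageI; apply: openI => //; exact: conf_openT.
by rewrite setTI.
Qed.

Definition conf_ball z (e : R) : set (conf R n) :=
  [set w | forall i, normc (w i - z i) < e].

Lemma conf_ball_open z e : conf_open (conf_ball z e).
Proof.
pose g i (x : V) := Num.sqrt ((coordl i x - complex.Re (z i)) ^+ 2 +
                              (coordr i x - complex.Im (z i)) ^+ 2).
rewrite (_ : conf_ball z e = crd @^-1` [set x | forall i, [set x | g i x < e] x]).
  apply/conf_open_coords/open_forall => i; apply: open_continuous_lt; last exact: cst_continuous.
  move=> x; apply: continuous_comp; last exact: sqrt_continuous.
  move: x; apply: class_C_continuous.
  have oT : open (@setT V) by exact: openT.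
  have cB (f : V -> R) c : class_C 0 setT f -> class_C 0 setT (fun x => (f x - c) ^+ 2).
    move=> cf; apply: (@class_C_ext _ _ _ _ (fun x => (f x - c) * (f x - c))) => //.
    by apply: (class_C_mul oT); apply: (class_C_add oT) => //; exact: class_C_cst.
  by apply: (class_C_add oT); apply: cB; [exact: class_C_coordl | exact: class_C_coordr].
apply/seteqP; split=> w /= h i; have := h i; rewrite /g coordl_coords coordr_coords;
  by case: (w i) (z i) => [a b] [c d].
Qed.

Lemma conf_ball_center z e : 0 < e -> conf_ball z e z.
Proof. by move=> e0 i; rewrite subrr normc0. Qed.

Lemma conf_smooth_sub U W f : W `<=` U -> conf_smooth U f -> conf_smooth W f.
Proof.
move=> WU [F [G [cFG e]]]; exists F, G; split=> [k|z Wz]; last exact/e/WU.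
have [cF cG] := cFG k; have s : crd @` W `<=` crd @` U by exact: image_subset.
by split; exact: class_C_sub s _.
Qed.

Lemma eq_conf_smooth U f g :
  (forall z, U z -> f z = g z) -> conf_smooth U f -> conf_smooth U g.
Proof. by move=> fg [F [G [c e]]]; exists F, G; split=> // z Uz; rewrite -fg // e. Qed.

Lemma conf_smooth_cst U c : conf_smooth U (fun=> c).
Proof.
exists (fun=> complex.Re c), (fun=> complex.Im c); split=> [k|z _]; last by case: c.
by split; exact: class_C_cst.
Qed.

Lemma conf_smooth_add U f g : conf_open U -> conf_smooth U f -> conf_smooth U g ->
  conf_smooth U (fun z => f z + g z).
Proof.
move=> oU [F [G [c e]]] [F' [G' [c' e']]].
exists (fun x => F x + F' x), (fun x => G x + G' x); split=> [k|z Uz].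
  have [[? ?] [? ?]] := (c k, c' k).
  by split; exact: class_C_add.
by rewrite e // e'.
Qed.

Lemma conf_smooth_mul U f g : conf_open U -> conf_smooth U f -> conf_smooth U g ->
  conf_smooth U (fun z => f z * g z).
Proof.
move=> oU [F [G [c e]]] [F' [G' [c' e']]].
exists (fun x => F x * F' x - G x * G' x), (fun x => F x * G' x + G x * F' x).
split=> [k|z Uz]; last by rewrite e // e'.
have [[? ?] [? ?]] := (c k, c' k).
by split; apply: (class_C_add oU); do ?apply: (class_C_opp oU); exact: class_C_mul.
Qed.

Lemma conf_smooth_inv U f : conf_open U -> (forall z, U z -> f z != 0) ->
  conf_smooth U f -> conf_smooth U (fun z => (f z)^-1).
Proof.
move=> oU f0 [F [G [c e]]]; pose N x := F x * F x + G x * G x.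
exists (fun x => F x * (N x)^-1), (fun x => - (G x * (N x)^-1)).
have N0 x : (crd @` U) x -> N x != 0.
  move=> [z Uz <-]; have := f0 z Uz; rewrite e //; apply: contra.
  by rewrite /N -!expr2 paddr_eq0 ?sqr_ge0 // !sqrf_eq0 eq_complex.
split=> [k|z Uz]; last by rewrite e // /N -!expr2 mulrC [G _ * _]mulrC mulrC [_ * G _]mulrC.
have [cF cG] := c k.
have cN : class_C k (crd @` U) (fun x => (N x)^-1).
  by apply: (class_C_inv oU N0); apply: (class_C_add oU); exact: class_C_mul.
by split; do ?apply: (class_C_opp oU); exact: class_C_mul.
Qed.

Lemma conf_smooth_pt U i : conf_smooth U (fun z => z i).
Proof.
exists (coordl i), (coordr i); split=> [k|z _].
  by split; [exact: class_C_coordl | exact: class_C_coordr].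
by rewrite coordl_coords coordr_coords; case: (z i).
Qed.

Variable tau : conf R n -> conf R n.
Hypothesis tau_smooth : forall i, conf_smooth setT (fun z => tau z i).

(** [choice] collects the witnesses for the coordinates of [tau] into one map of R^n x R^n,
    arbitrary outside the image of Conf_n. *)
Lemma smooth_map_coords : exists phi : V -> V,
  [/\ forall z, phi (coords z) = coords (tau z),
      forall k i, class_C k (crd @` setT) (fun x => coordl i (phi x)) &
      forall k i, class_C k (crd @` setT) (fun x => coordr i (phi x))].
Proof.
have [F hF] := choice tau_smooth; have [G hG] := choice hF.
exists (fun x => (\row_i F i x, \row_i G i x)); split.
- move=> z; congr pair; apply/rowP => i; rewrite !mxE; have [_ ->//] := hG i.
- move=> k i; have [/(_ k)[cF _] _] := hG i.
  by apply: class_C_ext cF => x; rewrite /coordl mxE.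
- move=> k i; have [/(_ k)[_ cG] _] := hG i.
  by apply: class_C_ext cG => x; rewrite /coordr mxE.
Qed.

(** [phi] is continuous at the coordinates of z, being differentiable there. Since the image of
    Conf_n is open, the points nearby come from configurations, and on those [phi] is [tau]. *)
Lemma conf_open_preimage U : conf_open U -> conf_open (tau @^-1` U).
Proof.
move=> oU; have [phi [e pl pr]] := smooth_map_coords.
rewrite /conf_open openE => _ [z Uz <-].
have Tz : (crd @` setT) (coords z) by exists z.
have dp := coords_differentiable pl pr Tz.
have h1 : \forall y \near coords z, (crd @` U) (phi y).
  apply: (differentiable_continuous dp); apply: open_nbhs_nbhs; split=> //.
  by rewrite e; exists (tau z).
have h2 : \forall y \near coords z, (crd @` [set: conf R n]) y.
  by apply: open_nbhs_nbhs; split=> //; exact: conf_openT.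
apply: filterS2 h1 h2 => y hy [w _ wy]; exists w => //=.
by move: hy; rewrite -wy e; exact: (coords_image _ _).1.
Qed.

Lemma conf_smooth_preimage U f : conf_open U -> conf_smooth U f ->
  conf_smooth (tau @^-1` U) (f \o tau).
Proof.
move=> oU [F [G [c ef]]]; have [phi [e pl pr]] := smooth_map_coords.
have sub : crd @` (tau @^-1` U) `<=` crd @` [set: conf R n] by exact: image_subset.
have oV := conf_open_preimage oU.
have AB x : (crd @` (tau @^-1` U)) x -> (crd @` U) (phi x).
  by move=> [z Uz <-]; rewrite e; exists (tau z).
exists (F \o phi), (G \o phi); split=> [k|z Uz]; last by rewrite /= e ef.
have [cF cG] := c k.
by split; apply: (class_C_comp oV AB) => // j i; apply: class_C_sub sub _.
Qed.

End ConfSmooth.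

(** * Cyclic words and the operators ad(t_ij) *)

Section CyclicWords.
Variables (R : realType) (n : nat).
Local Notation C := R[i].
Local Notation TH := (TH R n).
Local Notation cTH := (cTH R n).
Local Notation word := (seq 'I_n).
Implicit Types (x y : word -> C) (w u : word) (v : 'I_n -> 'I_n -> C).

(** The left quotient of a series by a letter. It lets identities between coefficients be proved by
    induction on the word. *)
Definition lderiv (k : 'I_n) x : word -> C := fun w => x (k :: w).

Lemma th_mul_nil x y : th_mul x y [::] = x [::] * y [::].
Proof. by rewrite /th_mul big_ord_recl big_ord0 addr0. Qed.

Lemma th_mul_cons x y k w :
  th_mul x y (k :: w) = th_mul (lderiv k x) y w + x [::] * y (k :: w).
Proof. by rewrite /th_mul big_ord_recl /= addrC. Qed.

Lemma eq_th_mul x x' y y' w :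
  (forall u, x u = x' u) -> (forall u, y u = y' u) -> th_mul x y w = th_mul x' y' w.
Proof. by move=> ex ey; apply: eq_bigr => k _; rewrite ex ey. Qed.

Lemma th_mul_linearl (a : C) x x' y w :
  th_mul (fun u => a * x u + x' u) y w = a * th_mul x y w + th_mul x' y w.
Proof.
rewrite /th_mul mulr_sumr -big_split /=; apply: eq_bigr => k _.
by rewrite mulrDl mulrA.
Qed.

Lemma th_mul_scalar x y w : (forall k u, x (k :: u) = 0) -> th_mul x y w = x [::] * y w.
Proof.
move=> x0; case: w => [|k w]; first by rewrite th_mul_nil.
by rewrite th_mul_cons /th_mul big1 ?add0r // => i _; rewrite /lderiv x0 mul0r.
Qed.

Lemma th_mul_word a b w : th_mul (th_word R a) (th_word R b) w = (w == a ++ b)%:R.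
Proof.
elim: a w => [|k a IH] w; first by rewrite th_mul_scalar /th_word /= ?mul1r.
case: w => [|l w]; first by rewrite th_mul_nil /th_word /= mul0r.
rewrite th_mul_cons /th_word /= mul0r addr0 eqseq_cons.
rewrite (@eq_th_mul _ (fun u => (l == k)%:R * th_word R a u + 0) _ (th_word R b)) //.
  rewrite (th_mul_linearl _ _ (fun=> 0)) IH th_mul_scalar // mul0r addr0.
  by rewrite -natrM mulnb.
by move=> u; rewrite /lderiv eqseq_cons addr0 -natrM mulnb.
Qed.

Fixpoint der v w x : C :=
  match w with
  | k :: ((l :: w') as w1) => v k l * (x (k :: w') - x (l :: w')) + der v w1 (lderiv k x)
  | _ => 0
  end.

(* The derivation a_k |-> [a_k, sum_l v_kl a_l], read on coefficients: each pair
   of adjacent letters k l of w arises from k (with weight v_kl) and from l (with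
   weight - v_lk), where v is symmetric. *)
Definition th_der v x : word -> C := fun w => der v w x.
Arguments th_der : simpl never.

Lemma der_cons2 v x k l w :
  th_der v x (k :: l :: w) =
  v k l * (x (k :: w) - x (l :: w)) + th_der v (lderiv k x) (l :: w).
Proof. by []. Qed.

Lemma eq_th_der v x y w :
  (forall u, (size u < size w)%N -> x u = y u) -> th_der v x w = th_der v y w.
Proof.
elim: w x y => [|k [|l w] IH] x y e //.
rewrite !der_cons2 !e //; congr (_ + _); apply: IH => u su.
exact: (e (k :: u)).
Qed.

(** Two equal adjacent letters contribute x (k :: w) - x (k :: w) = 0. Hence weights that are 0 on
    the diagonal can be compared with the constant weight 1. *)
Lemma eq_th_derl v v' x w :
  (forall k l, k != l -> v k l = v' k l) -> th_der v x w = th_der v' x w.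
Proof.
move=> e; elim: w x => [|k [|l w] IH] x //.
rewrite !der_cons2 IH; congr (_ + _).
by have [->|/e ->//] := eqVneq k l; rewrite subrr !mulr0.
Qed.

Lemma th_der0 v w : th_der v (fun=> 0) w = 0.
Proof.
elim: w => [|k [|l w] IH] //; rewrite der_cons2 subrr mulr0 add0r.
exact: IH.
Qed.

Lemma th_der_linear v (a : C) x y w :
  th_der v (fun u => a * x u + y u) w = a * th_der v x w + th_der v y w.
Proof.
elim: w x y => [|k [|l w] IH] x y; do ?by rewrite /th_der /= mulr0 addr0.
rewrite !der_cons2.
rewrite -[lderiv k (fun u => _)]/(fun u => a * lderiv k x u + lderiv k y u) IH.
ring.
Qed.

Lemma th_der_linearl v v' (a : C) x w :
  th_der (fun k l => a * v k l + v' k l) x w = a * th_der v x w + th_der v' x w.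
Proof.
elim: w x => [|k [|l w] IH] x; do ?by rewrite /th_der /= mulr0 addr0.
by rewrite !der_cons2 IH; ring.
Qed.

Lemma th_der_mul v x y w :
  th_der v (th_mul x y) w = th_mul (th_der v x) y w + th_mul x (th_der v y) w.
Proof.
elim: w x y => [|k [|l w] IH] x y.
- by rewrite !th_mul_nil mul0r mulr0 addr0.
- by rewrite !th_mul_cons !th_mul_nil /th_der /lderiv /= !mul0r !mulr0 !addr0.
(* Among the cuts of a word starting with k, the one before k gives x [::] times a coefficient of y;
   the others form a product with [lderiv k x], to which the induction hypothesis applies. *)
have e : th_der v (lderiv k (th_mul x y)) (l :: w) =
    x [::] * th_der v (lderiv k y) (l :: w) + th_der v (th_mul (lderiv k x) y) (l :: w).
  rewrite -th_der_linear; apply: eq_th_der => u _.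
  by rewrite /lderiv th_mul_cons addrC.
have h1 : th_mul (th_der v x) y [:: k, l & w] =
    v k l * (th_mul (lderiv k x) y w - th_mul (lderiv l x) y w)
    + th_mul (th_der v (lderiv k x)) y (l :: w).
  rewrite th_mul_cons (th_mul_cons (lderiv k (th_der v x))) th_mul_cons.
  rewrite [th_der v x [::]]/(0 : C) [lderiv k _ [::]]/(0 : C) [th_der v (lderiv k x) [::]]/(0 : C).
  rewrite !mul0r !addr0.
  rewrite (@eq_th_mul _ (fun u => v k l * (-1 * lderiv l x u + lderiv k x u) +
     lderiv l (th_der v (lderiv k x)) u) _ y) //; last first.
    by move=> u; rewrite mulN1r [- _ + _]addrC.
  rewrite (th_mul_linearl _ (fun u => -1 * lderiv l x u + lderiv k x u)).
  by rewrite (th_mul_linearl _ (lderiv l x)); ring.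
have h2 : th_mul x (th_der v y) [:: k, l & w] =
    th_mul (lderiv k x) (th_der v y) (l :: w) +
    x [::] * (v k l * (y (k :: w) - y (l :: w)) + th_der v (lderiv k y) (l :: w)).
  by rewrite th_mul_cons der_cons2.
by rewrite der_cons2 e IH h1 h2 !(th_mul_cons x); ring.
Qed.

(** In the composite of two such derivations, three consecutive letters k l m give the terms listed
    in [expand]. All of them are symmetric in the two weights, except the coefficient of y (k :: u)
    - y (m :: u) and the last term: the hypothesis makes the former symmetric, and the induction
    hypothesis settles the latter. *)
Lemma th_der_comm v v' x w :
  (forall k l m, v' k l * v k m + v' l m * v k l - v' l m * v k m =
                 v k l * v' k m + v l m * v' k l - v l m * v' k m) ->
  th_der v' (th_der v x) w = th_der v (th_der v' x) w.
Proof.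
move=> arnold.
have expand (a b : 'I_n -> 'I_n -> C) y k l m u :
    th_der a (th_der b y) [:: k, l, m & u] =
    (a k l * b k m + a l m * b k l - a l m * b k m) * (y (k :: u) - y (m :: u))
    - (a k l * b l m + a l m * b k l) * (y (l :: u) - y (m :: u))
    + a k l * (th_der b (lderiv k y) (m :: u) - th_der b (lderiv l y) (m :: u))
    + b k l * (th_der a (lderiv k y) (m :: u) - th_der a (lderiv l y) (m :: u))
    + th_der a (th_der b (lderiv k y)) [:: l, m & u].
  rewrite der_cons2.
  (* The part of [lderiv k (th_der b y)] due to the pair formed by k and the letter that follows
     it. *)
  pose Q u := if u is p :: u' then b k p * (y (k :: u') - y (p :: u')) else 0.
  rewrite (@eq_th_der a (lderiv k (th_der b y)) (fun u =>
     1 * Q u + th_der b (lderiv k y) u)); last first.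
    by move=> [|p u'] _; rewrite /Q ?addr0 ?mulr0 // mul1r.
  rewrite th_der_linear mul1r (der_cons2 a Q).
  rewrite (@eq_th_der a (lderiv l Q) (fun u =>
     b k l * (-1 * lderiv l y u + lderiv k y u) + 0)); last first.
    by move=> u' _; rewrite /Q /lderiv; ring.
  rewrite (th_der_linear _ _ (fun u => -1 * lderiv l y u + lderiv k y u) (fun=> 0)).
  rewrite (th_der_linear _ _ (lderiv l y)) th_der0.
  by rewrite !der_cons2 /Q; ring.
elim: w x => [|k [|l [|m w]] IH] x //.
  by rewrite !der_cons2 /th_der /= !subrr !mulr0.
rewrite !expand IH arnold; ring.
Qed.

(** The element a_1 + ... + a_n. *)
Definition th_gens : word -> C := fun w => (size w == 1%N)%:R.

(** With all weights 1 the sum over adjacent pairs telescopes: the coefficient at the word with its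
    last letter deleted minus the one with its first letter deleted. These are the products by a_1 +
    ... + a_n on the right and on the left. *)
Lemma th_der1 x : th_der (fun _ _ => 1) x = th_comm x th_gens.
Proof.
apply/funext; case=> [|k w].
  by rewrite /th_comm -[RHS]/(_ - _) !th_mul_nil /th_gens /= mulr0 mul0r subrr.
have -> : th_der (fun _ _ => 1) x (k :: w) = x (belast k w) - x w.
  elim: w k x => [|l w IH] k x; first by rewrite /= subrr.
  by rewrite der_cons2 IH /lderiv /=; ring.
rewrite -[RHS]/(_ - _); congr (_ - _); last first.
  rewrite th_mul_cons /th_gens /= mul0r addr0.
  by rewrite th_mul_scalar //= mul1r.
elim: w k x => [|l w IH] k x; rewrite th_mul_cons.
  by rewrite th_mul_nil /th_gens /= mulr0 add0r mulr1.
by rewrite -IH /th_gens /= mulr0 addr0.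
Qed.

Definition pair_weight (i j k l : 'I_n) : C :=
  ((k == i) && (l == j) || (k == j) && (l == i))%:R.

(** The generators a_i and a_j are sent to opposite multiples of a_i a_j - a_j a_i, the others to 0.
    So the coefficient at w collects the adjacent pairs ij and ji of w, each with one of its two
    letters deleted. *)
Lemma t_der_th_der i j x : i != j -> t_der i j x = th_der (pair_weight i j) x.
Proof.
move=> ij; apply/funext.
have genE (m : 'I_n) y k w : th_mul (th_gen R m) y (k :: w) = (k == m)%:R * y w.
  rewrite th_mul_cons /th_gen /th_word /= mul0r addr0 th_mul_scalar /lderiv.
    by rewrite eqseq_cons andbT.
  by move=> ? ?; rewrite eqseq_cons andbF.
have commE (a b : 'I_n) w : th_comm (th_gen R a) (th_gen R b) w =
    (w == [:: a; b])%:R - (w == [:: b; a])%:R.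
  by rewrite -[LHS]/(_ - _) !th_mul_word.
have tgenE m w : t_gen R i j m w = ((m == i)%:R - (m == j)%:R) *
    ((w == [:: i; j])%:R - (w == [:: j; i])%:R).
  rewrite /t_gen; have [->|mi] := eqVneq m i.
    by rewrite commE (negPf ij) subr0 mul1r.
  have [_|mj] := eqVneq m j; first by rewrite commE sub0r mulN1r opprB.
  by rewrite subrr mul0r.
have tgen_mul m y k l w : th_mul (t_gen R i j m) y [:: k, l & w] =
    t_gen R i j m [:: k; l] * y w.
  rewrite !th_mul_cons !tgenE /lderiv !tgenE /= !eqseq_cons !andbF subrr !mulr0 !mul0r !addr0.
  rewrite th_mul_scalar ?tgenE //= => p u.
  by rewrite tgenE !eqseq_cons !andbF subrr mulr0.
have key N w x' : size w = N.+1 ->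
    \sum_(u : N.-tuple 'I_n) x' u * t_word R i j u w = th_der (pair_weight i j) x' w.
  elim: N w x' => [|N IH] [|k [|l w]] x' //=.
    by move=> _; apply: big1 => u _; rewrite (tuple0 u) /= mulr0.
  move=> [sw].
  have -> : \sum_(u : N.+1.-tuple 'I_n) x' u * t_word R i j u [:: k, l & w] =
      \sum_(p : 'I_n * N.-tuple 'I_n) x' (p.1 :: p.2) * t_word R i j (p.1 :: p.2) [:: k, l & w].
    apply: (reindex (fun p : 'I_n * N.-tuple 'I_n => [tuple of p.1 :: p.2])).
    exists (fun u : N.+1.-tuple 'I_n => (thead u, [tuple of behead u])) => [[m u] _|u _] /=.
      by congr pair; apply: val_inj.
    by rewrite [RHS]tuple_eta; apply: val_inj.
  rewrite -(pair_bigA _ (fun m (u : N.-tuple 'I_n) =>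
    x' (m :: tval u) * t_word R i j (m :: tval u) [:: k, l & w])) /=.
  rewrite der_cons2 -IH; last by rewrite /= sw.
  (* The derivation acts on the first letter m, whose image then fills the places k l and forces the
     rest to be w; or it keeps m, which must be k, and acts on the rest. *)
  rewrite (eq_bigr (fun m => x' (m :: w) * t_gen R i j m [:: k; l] +
     (k == m)%:R * \sum_(u : N.-tuple 'I_n) x' (m :: u) * t_word R i j u (l :: w))); last first.
    move=> m _; rewrite mulr_sumr.
    rewrite (eq_bigr (fun u : N.-tuple 'I_n =>
      x' (m :: u) * t_gen R i j m [:: k; l] * (w == u)%:R +
      (k == m)%:R * (x' (m :: u) * t_word R i j u (l :: w)))).
      rewrite big_split /=; congr (_ + _).
      have sw' : size w == N by rewrite sw.
      rewrite (bigD1 (Tuple sw')) //= eqxx mulr1 big1 ?addr0 // => u uw.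
      by rewrite [w == u](_ : _ = false) ?mulr0 // eq_sym;
          apply: contraNF uw => /eqP e; apply/eqP/val_inj.
    move=> u _; rewrite -[(_ + _) _]/(_ + _) tgen_mul genE /th_word; ring.
  rewrite big_split /=; congr (_ + _); last first.
    rewrite (bigD1 k) //= eqxx mul1r [X in _ + X]big1 ?addr0 // => m.
    by rewrite eq_sym => /negPf ->; rewrite mul0r.
  rewrite (eq_bigr (fun m => (m == i)%:R * (x' (m :: w) * t_gen R i j i [:: k; l]) -
      (m == j)%:R * (x' (m :: w) * t_gen R i j i [:: k; l]))); last first.
    by move=> m _; rewrite !tgenE eqxx (negPf ij) subr0 mul1r; ring.
  have pick a (F : 'I_n -> C) : \sum_m (m == a)%:R * F m = F a.
    by rewrite (bigD1 a) //= eqxx mul1r big1 ?addr0 // => m /negPf ->; rewrite mul0r.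
  rewrite sumrB !pick tgenE eqxx (negPf ij) subr0 mul1r /pair_weight !eqseq_cons !andbT.
  have [/andP[/eqP -> /eqP ->]|_] := boolP ((k == i) && (l == j)).
    by rewrite (negPf ij) /= subr0 !mulr1 mul1r.
  have [/andP[/eqP -> /eqP ->]|_] := boolP ((k == j) && (l == i)).
    by rewrite /= sub0r !mulrN1 mul1r opprK addrC.
  by rewrite subrr !mulr0 mul0r subrr.
(* For the empty word [(size w).-1] is 0 as well, so the sum is over the empty tuple, which the
   derivation kills. *)
case=> [|k w]; last exact: (key (size w) (k :: w) x).
by rewrite /t_der /th_der /=; apply: big1 => u _; rewrite (tuple0 u) /= mulr0.
Qed.

End CyclicWords.

(** * Canonical representatives in |TH_1| and the operators induced there *)

Section CyclicAverage.
Variables (R : realType) (n : nat).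
Local Notation C := R[i].
Local Notation TH := (TH R n).
Local Notation cTH := (cTH R n).
Local Notation word := (seq 'I_n).
Implicit Types (x y : TH) (w u : word) (v : 'I_n -> 'I_n -> C) (s t : cTH).

Lemma comm_closure_approx x :
  (forall N, exists2 y, y \in @comm_closure R n & forall w, (size w <= N)%N -> x w = y w) ->
  x \in @comm_closure R n.
Proof.
move=> h; apply/asboolP => N; have [y /asboolP/(_ N)[l yl] xy] := h N.
by exists l => w wN; rewrite xy // yl.
Qed.

Lemma th_comm_closure x y : th_comm x y \in @comm_closure R n.
Proof. by apply/asboolP => N; exists [:: (x, y)] => w _; rewrite big_seq1. Qed.

Lemma comm_closure_agree x N : x \in @comm_closure R n ->
  exists l : seq (TH * TH), forall w, (size w <= N)%N ->
    x w = \sum_(p <- l) th_comm p.1 p.2 w.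
Proof.
by move=> /asboolP/(_ N)[l h]; exists l => w wN; rewrite h // th_sumE.
Qed.

Lemma th_der_sum (I : Type) (r : seq I) v (F : I -> word -> C) w :
  th_der v (fun u => \sum_(i <- r) F i u) w = \sum_(i <- r) th_der v (F i) w.
Proof.
elim: r => [|i r IH].
  rewrite big_nil -[RHS](th_der0 v w).
  by apply: eq_th_der => u _; rewrite big_nil.
rewrite big_cons -IH -[th_der v (F i) w]mul1r -th_der_linear.
by apply: eq_th_der => u _; rewrite big_cons mul1r.
Qed.

(** A derivation sends [x, y] to [Dx, y] + [x, Dy]. As it raises degrees, an approximation of [x] by
    commutators up to degree N yields one of its image. *)
Lemma th_der_closure v x : x \in @comm_closure R n -> th_der v x \in @comm_closure R n.
Proof.
move=> cx; apply: comm_closure_approx => N.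
have [l xl] := comm_closure_agree N cx.
exists (\sum_(p <- l) (th_comm (th_der v p.1) p.2 + th_comm p.1 (th_der v p.2))).
  by apply: rpred_sum => p _; apply: rpredD; exact: th_comm_closure.
move=> w wN; rewrite (@eq_th_der _ _ v x (fun u => \sum_(p <- l) th_comm p.1 p.2 u)).
  rewrite th_der_sum th_sumE; apply: eq_bigr => p _.
  rewrite (@eq_th_der _ _ v _ (fun u => -1 * th_mul p.2 p.1 u + th_mul p.1 p.2 u)).
    rewrite th_der_linear !th_der_mul.
    have alg (a b c d : C) : -1 * (d + b) + (a + c) = (a - b) + (c - d) by ring.
    exact: alg.
  by move=> u _; rewrite mulN1r addrC.
by move=> u uw; apply: xl; exact: leq_trans (ltnW uw) wN.
Qed.

(** This operator vanishes on commutators and differs from the identity by the closure of their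
    span, so it singles out one representative per cyclic class. On the empty word the averaging
    formula would give 0 and lose the constant term, hence the separate case. *)
Definition cyc_avg (x : word -> C) : word -> C := fun w =>
  if w is [::] then x [::] else (size w)%:R^-1 * \sum_(k < size w) x (rot k w).

Lemma cyc_avg_linear (a : C) (x y : word -> C) w :
  cyc_avg (fun u => a * x u + y u) w = a * cyc_avg x w + cyc_avg y w.
Proof.
case: w => [|l w] //; rewrite /cyc_avg big_split /= -mulr_sumr.
by rewrite mulrDr mulrCA.
Qed.

Lemma eq_cyc_avg (x y : word -> C) w :
  (forall u, size u = size w -> x u = y u) -> cyc_avg x w = cyc_avg y w.
Proof.
case: w => [|l w] e; first exact: e.
by congr (_ * _); apply: eq_bigr => k _; apply: e; rewrite size_rot.
Qed.

Lemma sum_rot (g : word -> C) w m : (m <= size w)%N ->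
  \sum_(k < size w) g (rot m (rot k w)) = \sum_(k < size w) g (rot k w).
Proof.
have rot1 (h : word -> C) :
    \sum_(k < size w) h (rot 1 (rot k w)) = \sum_(k < size w) h (rot k w).
  have -> : \sum_(k < size w) h (rot 1 (rot k w)) = \sum_(k < size w) h (rot k.+1 w).
    by apply: eq_bigr => k _; rewrite -rotS.
  move: (fun k => h (rot k w)) (rot_size w) => f' _.
  have e : h (rot (size w) w) = h (rot 0 w) by rewrite rot_size rot0.
  case: (size w) e => [|N] e; first by rewrite !big_ord0.
  by rewrite big_ord_recr big_ord_recl /= addrC e.
elim: m g => [|m IH] g mw; first by apply: eq_bigr => k _; rewrite rot0.
rewrite -[RHS]rot1 -[RHS](IH (fun u => g (rot 1 u)) (ltnW mw)).
by apply: eq_bigr => k _; rewrite rotS ?size_rot.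
Qed.

(** Rotating by m exchanges the two factors cut at m: a cut of y x at m is a cut of x y at size w -
    m in the rotated word. Summed over all rotations, both products give the same double sum. *)
Lemma cyc_avg_comm x y w : cyc_avg (th_comm x y) w = 0.
Proof.
case: w => [|l w].
  by rewrite /cyc_avg -[th_comm _ _ _]/(_ - _) !th_mul_nil mulrC subrr.
rewrite /cyc_avg; move: (l :: w) => {l}w; rewrite [X in _ * X](_ : _ = 0) ?mulr0 //.
rewrite (eq_bigr (fun k : 'I_(size w) => th_mul x y (rot k w) - th_mul y x (rot k w))) //.
rewrite sumrB; apply/eqP; rewrite subr_eq0; apply/eqP.
pose G m (u : word) := x (take m u) * y (drop m u) : C.
have e1 (k : 'I_(size w)) : th_mul x y (rot k w) = \sum_(m < (size w).+1) G m (rot k w).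
  by rewrite /th_mul size_rot.
have e2 (k : 'I_(size w)) : th_mul y x (rot k w) =
    \sum_(m < (size w).+1) G (size w - m)%N (rot m (rot k w)).
  rewrite /th_mul size_rot; apply: eq_bigr => m _; rewrite /G mulrC.
  have sm : size (drop m (rot k w)) = (size w - m)%N by rewrite size_drop size_rot.
  move: (rot k w) sm => u sm.
  by rewrite /rot -sm take_size_cat // drop_size_cat.
rewrite (eq_bigr _ (fun k _ => e1 k)) exchange_big /=.
rewrite [RHS](eq_bigr _ (fun k _ => e2 k)) [RHS]exchange_big /=.
rewrite [RHS](reindex_inj rev_ord_inj) /=; apply: eq_bigr => m _.
have mw : (m <= size w)%N by rewrite -ltnS.
by rewrite subSS subKn // (sum_rot (G m)) // leq_subr.
Qed.

Lemma cyc_avg_closure x w : x \in @comm_closure R n -> cyc_avg x w = 0.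
Proof.
move=> cx; have [l xl] := comm_closure_agree (size w) cx.
rewrite (@eq_cyc_avg _ (fun u => \sum_(p <- l) th_comm p.1 p.2 u)); last first.
  by move=> u uw; rewrite xl // uw.
elim: l {xl} => [|p l IH].
  rewrite (@eq_cyc_avg _ (fun=> 0)); last by move=> u _; rewrite big_nil.
  by case: w => // a w; rewrite /cyc_avg big1 ?mulr0.
rewrite (@eq_cyc_avg _ (fun u => 1 * th_comm p.1 p.2 u + \sum_(q <- l) th_comm q.1 q.2 u)).
  by rewrite cyc_avg_linear IH cyc_avg_comm mulr0 addr0.
by move=> u _; rewrite big_cons mul1r.
Qed.

Lemma th_comm_word (a b w : word) :
  th_comm (th_word R a) (th_word R b) w = (w == a ++ b)%:R - (w == b ++ a)%:R.
Proof. by rewrite -[LHS]/(_ - _) !th_mul_word. Qed.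

(** A rotation of a word u differs from u by the commutator of its two pieces. In degree m,
    weighting these commutators by x (rot k u) / m and summing over u and k gives x minus its
    average. *)
Lemma sub_cyc_avg_closure x : x - cyc_avg x \in @comm_closure R n.
Proof.
apply: comm_closure_approx => N.
exists (\sum_(m < N.+1) \sum_(u : m.-tuple 'I_n) \sum_(k < m)
   (m%:R^-1 * x (rot k u) : C) *: th_comm (th_word R (drop k u)) (th_word R (take k u))).
  apply: rpred_sum => m _; apply: rpred_sum => u _; apply: rpred_sum => k _.
  by apply: rpredZ; exact: th_comm_closure.
move=> w wN; rewrite th_sumE.
pose T m (u : m.-tuple 'I_n) (k : 'I_m) : C :=
  m%:R^-1 * x (rot k u) * ((w == rot k u)%:R - (w == u)%:R).
rewrite (eq_bigr (fun m : 'I_N.+1 => \sum_(u : m.-tuple 'I_n) \sum_(k < m) T m u k)); last first.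
  move=> m _; rewrite th_sumE; apply: eq_bigr => u _; rewrite th_sumE; apply: eq_bigr => k _.
  by rewrite -[LHS]/(_ * _) th_comm_word cat_take_drop.
have w_lt : (size w < N.+1)%N by [].
rewrite (bigD1 (Ordinal w_lt)) //= [X in _ = _ + X]big1 ?addr0; last first.
  move=> m mw; apply: big1 => u _; apply: big1 => k _.
  have su (u' : word) : size u' = m -> (w == u') = false.
    by move=> su'; apply: contraNF mw => /eqP e; apply/eqP/val_inj; rewrite /= e su'.
  by rewrite /T !su ?size_tuple ?size_rot ?size_tuple // subrr mulr0.
rewrite -[LHS]/(x w - cyc_avg x w).
case: w => [|l w'] in T wN w_lt *.
  by rewrite /= subrr big1 // => u _; rewrite big_ord0.
rewrite /cyc_avg; move: (l :: w') @T {wN w_lt} (isT : (0 < size (l :: w'))%N) => {l w'}w T w0.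
have w0' : (size w)%:R != 0 :> C by rewrite pnatr_eq0 -lt0n.
rewrite (eq_bigr (fun u : (size w).-tuple 'I_n => \sum_(k < size w)
    (size w)%:R^-1 * (x (rot k u) * (w == rot k u)%:R) -
    \sum_(k < size w) (size w)%:R^-1 * (x (rot k u) * (w == u)%:R))); last first.
  by move=> u _; rewrite -sumrB; apply: eq_bigr => k _; rewrite /T; ring.
rewrite sumrB; congr (_ - _).
  rewrite exchange_big /= (eq_bigr (fun=> (size w)%:R^-1 * x w)).
    by rewrite sumr_const card_ord -[RHS]mulr_natl mulrA mulfV // mul1r.
  move=> k _; have sr : size (rotr k w) == size w by rewrite size_rotr.
  rewrite (bigD1 (Tuple sr)) //= rotrK eqxx mulr1 big1 ?addr0 // => u.
  rewrite -val_eqE /= => uw; rewrite [_ == _](_ : _ = false) ?mulr0 //.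
  by apply: contraNF uw => /eqP e; apply/eqP; exact: (canRL (rotK k) (esym e)).
rewrite (bigD1 (in_tuple w)) //= [X in _ = _ + X]big1 ?addr0 => [|u].
  by rewrite mulr_sumr; apply: eq_bigr => k _; rewrite eqxx mulr1.
rewrite -val_eqE /= eq_sym => /negPf uw; apply: big1 => k _.
by rewrite uw !mulr0.
Qed.

Lemma cyc_avgK x : cyc (cyc_avg x) = cyc x.
Proof.
by apply/cyc_eq; rewrite -opprB rpredN; exact: sub_cyc_avg_closure.
Qed.

(** Unlike [cyc_repr], which is a mere choice, this representative is linear in the class and is
    computed from any lift ([crep_cyc]), so equalities in |TH_1| can be tested on coefficients. *)
Definition crep s : word -> C := cyc_avg (cyc_repr s).

Lemma crepK s : cyc (crep s) = s.
Proof. by rewrite /crep cyc_avgK cyc_reprK. Qed.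

Lemma crep_cyc x w : crep (cyc x) w = cyc_avg x w.
Proof.
have : cyc_repr (cyc x) - x \in @comm_closure R n.
  by apply/cyc_eq; rewrite cyc_reprK.
move=> /(@cyc_avg_closure _ w) e; apply/eqP; rewrite -subr_eq0 -e; apply/eqP.
rewrite (@eq_cyc_avg (_ - _) (fun u => -1 * x u + cyc_repr (cyc x) u)).
  by rewrite cyc_avg_linear mulN1r addrC.
by move=> u _; rewrite mulN1r addrC.
Qed.

Lemma crep_inj s t : (forall w, crep s w = crep t w) -> s = t.
Proof. by move=> e; rewrite -[s]crepK -[t]crepK; congr cyc; apply/funext. Qed.

Lemma crep_linear (a : C) s t w : crep (a *: s + t) w = a * crep s w + crep t w.
Proof.
rewrite -[s]crepK -[t]crepK -[_ *: _]/(cscale _ _) cscale_cyc -cycD !crep_cyc.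
by rewrite -cyc_avg_linear.
Qed.

Definition ad_der v s : cTH := cyc (th_der v (cyc_repr s)).

Lemma th_derB v x y : th_der v (x - y) = th_der v x - th_der v y :> TH.
Proof.
apply/funext => w; rewrite -[RHS]/(_ - _).
rewrite (@eq_th_der _ _ v (x - y) (fun u => -1 * y u + x u)).
  by rewrite th_der_linear mulN1r addrC.
by move=> u _; rewrite mulN1r addrC.
Qed.

Lemma ad_der_cyc v x : ad_der v (cyc x) = cyc (th_der v x).
Proof.
apply/cyc_eq; rewrite -th_derB; apply: th_der_closure.
by apply/cyc_eq; rewrite cyc_reprK.
Qed.

Lemma crep_ad_der v s w : crep (ad_der v s) w = cyc_avg (th_der v (crep s)) w.
Proof. by rewrite -{1}[s]crepK ad_der_cyc crep_cyc. Qed.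

Lemma ad_der_linear v (a : C) s t : ad_der v (a *: s + t) = a *: ad_der v s + ad_der v t.
Proof.
apply: crep_inj => w; rewrite crep_linear !crep_ad_der -cyc_avg_linear.
apply: eq_cyc_avg => u _; rewrite -th_der_linear; apply: eq_th_der => u' _.
by rewrite crep_linear.
Qed.

Lemma ad_der_linearl v v' (a : C) s :
  ad_der (fun k l => a * v k l + v' k l) s = a *: ad_der v s + ad_der v' s.
Proof.
apply: crep_inj => w; rewrite crep_linear !crep_ad_der -cyc_avg_linear.
by apply: eq_cyc_avg => u _; rewrite -th_der_linearl.
Qed.

Lemma eq_ad_der v v' s : (forall k l, k != l -> v k l = v' k l) -> ad_der v s = ad_der v' s.
Proof.
move=> e; rewrite /ad_der; congr cyc; apply/funext => w; exact: eq_th_derl.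
Qed.

Lemma ad_der1 s : ad_der (fun _ _ => 1) s = 0.
Proof.
have cyc0 : cyc 0 = 0 :> cTH by apply: (addrI (cyc 0)); rewrite addr0 -cycD addr0.
rewrite /ad_der th_der1 -cyc0; apply/cyc_eq; rewrite subr0.
exact: th_comm_closure.
Qed.

Lemma ad_der_comm v v' s :
  (forall k l m, v' k l * v k m + v' l m * v k l - v' l m * v k m =
                 v k l * v' k m + v l m * v' k l - v l m * v' k m) ->
  ad_der v' (ad_der v s) = ad_der v (ad_der v' s).
Proof.
move=> arnold; rewrite {2}/ad_der {3}/ad_der !ad_der_cyc; congr cyc; apply/funext => w.
exact: th_der_comm.
Qed.

Lemma ad_t_ad_der i j s : i != j -> ad_t i j s = ad_der (pair_weight R i j) s.
Proof. by move=> ij; rewrite /ad_t t_der_th_der. Qed.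

(** Turns a connection form into a single [ad_der]. A pair of distinct letters k, l is met by
    exactly one t_ij with i < j, and the symmetry of [a] covers both orders of the letters. *)
Lemma sum_ad_t (a : 'I_n -> 'I_n -> C) s : (forall i j, a i j = a j i) ->
  \sum_(i < n) \sum_(j < n | (i < j)%N) a i j *: ad_t i j s = ad_der a s.
Proof.
move=> asym.
have ad0 : ad_der (fun _ _ => 0) s = 0.
  apply: (addrI (ad_der (fun _ _ => 0) s)); rewrite addr0.
  rewrite -{1}[ad_der _ s]scale1r -ad_der_linearl.
  by apply: eq_ad_der => k l _; rewrite mulr0 addr0.
have adsum (I : Type) (r : seq I) (P : pred I) (F : I -> C) (G : I -> 'I_n -> 'I_n -> C) :
    \sum_(i <- r | P i) F i *: ad_der (G i) s =
    ad_der (fun k l => \sum_(i <- r | P i) F i * G i k l) s.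
  elim: r => [|i r IH].
    rewrite big_nil -[LHS]ad0; apply: eq_ad_der => k l _; by rewrite big_nil.
  rewrite big_cons IH; case: ifP => Pi; last first.
    by apply: eq_ad_der => k l _; rewrite big_cons Pi.
  by rewrite -ad_der_linearl; apply: eq_ad_der => k l _; rewrite big_cons Pi.
rewrite (eq_bigr (fun i : 'I_n => 1 *: ad_der (fun k l => \sum_(j < n | (i < j)%N)
   a i j * pair_weight R i j k l) s)); last first.
  move=> i _; rewrite scale1r -adsum; apply: eq_bigr => j ij.
  by rewrite ad_t_ad_der // -val_eqE /= ltn_eqF.
rewrite adsum; apply: eq_ad_der => k l kl.
have pw_sym i j k' l' : pair_weight R i j k' l' = pair_weight R i j l' k'.
  rewrite /pair_weight orbC.
  by congr ((nat_of_bool (_ || _))%:R); exact: andbC.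
have Z i j : ~~ ((i == k) && (j == l) || (i == l) && (j == k)) ->
    a i j * pair_weight R i j k l = 0.
  move=> h; rewrite /pair_weight [k == i]eq_sym [l == j]eq_sym [k == j]eq_sym [l == i]eq_sym.
  have /negPf -> : ~~ ((i == k) && (j == l) || (j == k) && (i == l)).
    by apply: contra h; rewrite [(j == k) && _]andbC.
  by rewrite mulr0.
wlog kl' : k l kl Z / (k < l)%N => [W|].
  have [/W|lk|/val_inj e] := ltngtP k l; [exact | | by rewrite e eqxx in kl].
  rewrite asym -W // 1?eq_sym //; last by move=> i j h; rewrite pw_sym; apply: Z; rewrite orbC.
  apply: eq_bigr => i _; congr (_ * _); apply: eq_bigr => j _.
  by rewrite pw_sym.
rewrite (bigD1 k) //= mul1r (bigD1 l) //= [X in _ + X + _]big1 ?addr0; last first.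
  move=> j /andP[_ jl]; apply: Z; rewrite eqxx (negPf jl) /=.
  by rewrite (negPf kl).
rewrite [X in _ + X]big1 ?addr0; last first.
  move=> i ik; rewrite mul1r; apply: big1 => j ij; apply: Z; rewrite (negPf ik) /=.
  by apply/negP => /andP[/eqP ei /eqP ej]; move: ij; rewrite ei ej ltnNge ltnW.
by rewrite /pair_weight !eqxx mulr1.
Qed.

End CyclicAverage.

(** * Tangent vectors and connections *)

Section FunctionSheaf.
Variable R : realType.
Local Notation C := R[i].

(** What Conf_n and its quotient have in common; tangent vectors and connections are treated from
    these properties alone. *)
Record function_sheaf (X : smooth_space R) : Prop := FunctionSheaf {
  fs_openT : is_open [set: X] ;
  fs_openI : forall U W : set X, is_open U -> is_open W -> is_open (U `&` W) ;
  fs_sub : forall (U W : set X) f, W `<=` U -> is_smooth U f -> is_smooth W f ;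
  fs_ext : forall (U : set X) f g, (forall q, U q -> f q = g q) ->
    is_smooth U f -> is_smooth U g ;
  fs_cst : forall (U : set X) c, is_smooth U (fun=> c) ;
  fs_add : forall (U : set X) f g, is_open U -> is_smooth U f -> is_smooth U g ->
    is_smooth U (fun q => f q + g q) ;
  fs_mul : forall (U : set X) f g, is_open U -> is_smooth U f -> is_smooth U g ->
    is_smooth U (fun q => f q * g q) ;
  fs_inv : forall (U : set X) f, is_open U -> (forall q, U q -> f q != 0) ->
    is_smooth U f -> is_smooth U (fun q => (f q)^-1) }.

Variables (X : smooth_space R) (hX : function_sheaf X).
Implicit Types (p q : X) (f g : X -> C) (U W : set X) (v : (X -> C) -> C).

Lemma near_pt_singleton p P : near_pt p P -> P p.
Proof. by move=> [U [_ Up h]]; exact: h. Qed.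

Lemma near_ptW p (P Q : X -> Prop) : (forall q, P q -> Q q) -> near_pt p P -> near_pt p Q.
Proof. by move=> PQ [U [oU Up h]]; exists U; split=> // q /h/PQ. Qed.

Lemma near_ptT p (P : X -> Prop) : (forall q, P q) -> near_pt p P.
Proof. by move=> h; exists setT; split=> //; exact: fs_openT. Qed.

Lemma near_ptI p (P Q : X -> Prop) :
  near_pt p P -> near_pt p Q -> near_pt p (fun q => P q /\ Q q).
Proof.
move=> [U [oU Up hU]] [W [oW Wp hW]]; exists (U `&` W); split=> //.
  exact: fs_openI.
by move=> q [Uq Wq]; split; [exact: hU | exact: hW].
Qed.

Lemma near_pt_open p U : is_open U -> U p -> near_pt p U.
Proof. by exists U. Qed.

Lemma near_pt_near p (P : X -> Prop) : near_pt p P -> near_pt p (fun q => near_pt q P).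
Proof. by move=> [U [oU Up h]]; exists U; split=> // q Uq; exists U. Qed.

Lemma near_pt_forall (I : finType) p (P : I -> X -> Prop) :
  (forall i, near_pt p (P i)) -> near_pt p (fun q => forall i, P i q).
Proof.
move=> h; suff: near_pt p (fun q => forall i, i \in enum I -> P i q).
  by apply: near_ptW => q hq i; apply: hq; rewrite mem_enum.
elim: (enum I) => [|i s IH]; first exact: near_ptT.
apply: near_ptW (near_ptI (h i) IH) => q [Pi Ps] j.
by rewrite in_cons => /orP[/eqP ->|/Ps].
Qed.

Lemma smooth_near_cst p c : smooth_near p (fun=> c).
Proof. by exists setT; split=> //; [exact: fs_openT | exact: fs_cst]. Qed.

Lemma smooth_near2 p f g : smooth_near p f -> smooth_near p g ->
  exists U, [/\ is_open U, U p, is_smooth U f & is_smooth U g].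
Proof.
move=> [U [oU Up sf]] [W [oW Wp sg]]; exists (U `&` W).
split=> //; first exact: fs_openI.
  by apply: fs_sub sf => // q [].
by apply: fs_sub sg => // q [].
Qed.

Lemma smooth_near_add p f g : smooth_near p f -> smooth_near p g ->
  smooth_near p (fun q => f q + g q).
Proof. by move=> sf /(smooth_near2 sf)[U [oU Up ? ?]]; exists U; split=> //; exact: fs_add. Qed.

Lemma smooth_near_mul p f g : smooth_near p f -> smooth_near p g ->
  smooth_near p (fun q => f q * g q).
Proof. by move=> sf /(smooth_near2 sf)[U [oU Up ? ?]]; exists U; split=> //; exact: fs_mul. Qed.

Lemma smooth_near_inv p f : near_pt p (fun q => f q != 0) -> smooth_near p f ->
  smooth_near p (fun q => (f q)^-1).
Proof.
move=> [W [oW Wp f0]] [U [oU Up sf]]; exists (U `&` W); split=> //; first exact: fs_openI.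
apply: fs_inv => //; first exact: fs_openI.
  by move=> q [_ /f0].
by apply: fs_sub sf => // q [].
Qed.

Lemma smooth_near_sum (I : Type) (r : seq I) p (f : I -> X -> C) :
  (forall i, smooth_near p (f i)) -> smooth_near p (fun q => \sum_(i <- r) f i q).
Proof.
move=> sf; elim: r => [|i r IH].
  have -> : (fun q : X => \sum_(i <- [::]) f i q) = (fun=> 0).
    by apply/funext => q; rewrite big_nil.
  exact: smooth_near_cst.
have -> : (fun q : X => \sum_(j <- i :: r) f j q) = (fun q => f i q + \sum_(j <- r) f j q).
  by apply/funext => q; rewrite big_cons.
exact: smooth_near_add.
Qed.

Lemma smooth_near_near p f : smooth_near p f -> near_pt p (fun q => smooth_near q f).
Proof. by move=> [U [oU Up sf]]; exists U; split=> // q Uq; exists U. Qed.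

Section Tangent.
Variables (p : X) (v : (X -> C) -> C) (tv : is_tangent p v).

Lemma tangent_ext f g : smooth_near p f -> smooth_near p g ->
  near_pt p (fun q => f q = g q) -> v f = v g.
Proof. by have [h _ _] := tv; exact: h. Qed.

Lemma tangent_lin c f g : smooth_near p f -> smooth_near p g ->
  v (fun q => c * f q + g q) = c * v f + v g.
Proof. by have [_ h _] := tv; exact: h. Qed.

Lemma tangent_mul f g : smooth_near p f -> smooth_near p g ->
  v (fun q => f q * g q) = v f * g p + f p * v g.
Proof. by have [_ _ h] := tv; exact: h. Qed.

Lemma tangent0 : v (fun=> 0) = 0.
Proof.
have s0 : smooth_near p (fun=> 0) by exact: smooth_near_cst.
apply: (addrI (v (fun=> 0))); rewrite addr0 -{1}[v _]mul1r -tangent_lin //.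
by congr v; apply/funext => q; rewrite mulr0 addr0.
Qed.

Lemma tangent_cst c : v (fun=> c) = 0.
Proof.
have s x : smooth_near p (fun=> x) by exact: smooth_near_cst.
have v1 : v (fun=> 1) = 0.
  have := tangent_mul (s 1) (s 1); rewrite !mulr1 mul1r.
  by move=> e; apply: (addrI (v (fun=> 1))); rewrite addr0 -e.
have -> : (fun _ : X => c) = (fun q => c * 1 + 0) by apply/funext => q; rewrite mulr1 addr0.
by rewrite (tangent_lin c (s 1) (s 0)) v1 tangent0 mulr0 addr0.
Qed.

Lemma tangent_add f g : smooth_near p f -> smooth_near p g ->
  v (fun q => f q + g q) = v f + v g.
Proof.
move=> sf sg; rewrite -[v f]mul1r -tangent_lin //.
by congr v; apply/funext => q; rewrite mul1r.
Qed.

Lemma tangent_scale c f : smooth_near p f -> v (fun q => c * f q) = c * v f.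
Proof.
by move=> sf; rewrite tangent_mul ?tangent_cst ?mul0r ?add0r //; exact: smooth_near_cst.
Qed.

Lemma tangent_opp f : smooth_near p f -> v (fun q => - f q) = - v f.
Proof.
move=> sf; rewrite -mulN1r -tangent_scale //.
by congr v; apply/funext => q; rewrite mulN1r.
Qed.

Lemma smooth_near_opp f : smooth_near p f -> smooth_near p (fun q => - f q).
Proof.
move=> sf; have -> : (fun q => - f q) = (fun q => -1 * f q).
  by apply/funext => q; rewrite mulN1r.
by apply: smooth_near_mul => //; exact: smooth_near_cst.
Qed.

Lemma tangent_sub f g : smooth_near p f -> smooth_near p g ->
  v (fun q => f q - g q) = v f - v g.
Proof.
by move=> sf sg; rewrite tangent_add ?tangent_opp //; exact: smooth_near_opp.
Qed.

Lemma tangent_sum (I : Type) (r : seq I) (f : I -> X -> C) :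
  (forall i, smooth_near p (f i)) ->
  v (fun q => \sum_(i <- r) f i q) = \sum_(i <- r) v (f i).
Proof.
move=> sf; elim: r => [|i r IH].
  rewrite big_nil -[RHS]tangent0; congr v; apply/funext => q; exact: big_nil.
rewrite big_cons -IH -tangent_add //; last exact: smooth_near_sum.
by congr v; apply/funext => q; rewrite big_cons.
Qed.

Lemma tangent_inv f : near_pt p (fun q => f q != 0) -> smooth_near p f ->
  v (fun q => (f q)^-1) = - v f / f p ^+ 2.
Proof.
move=> f0 sf; have sV := smooth_near_inv f0 sf.
have fp : f p != 0 by exact: (near_pt_singleton f0).
have e := tangent_mul sf sV.
have e1 : v (fun q => f q * (f q)^-1) = 0.
  rewrite -[RHS](tangent_cst 1); apply: tangent_ext.
  - exact: smooth_near_mul.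
  - exact: smooth_near_cst.
  - by apply: near_ptW f0 => q fq; rewrite mulfV.
rewrite e1 in e; apply: (mulfI fp); move/eqP: e; rewrite eq_sym addr_eq0 => /eqP e.
by rewrite -[LHS]opprK -e; field.
Qed.

End Tangent.

Lemma is_tangent_comb p c v w : is_tangent p v -> is_tangent p w ->
  is_tangent p (fun f => c * v f + w f).
Proof.
move=> tv tw; split=> [f g sf sg fg|a f g sf sg|f g sf sg].
- by rewrite (tangent_ext tv sf sg fg) (tangent_ext tw sf sg fg).
- by rewrite (tangent_lin tv) // (tangent_lin tw) //; ring.
- by rewrite (tangent_mul tv) // (tangent_mul tw) //; ring.
Qed.

Lemma vector_field_smooth_near U V p f : is_open U -> is_vector_field U V -> U p ->
  smooth_near p f -> smooth_near p (fun q => V q f).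
Proof.
move=> oU [_ sV] Up [W [oW Wp sf]]; exists (U `&` W).
have oUW := fs_openI hX oU oW.
split=> //; apply: sV => //.
by apply: fs_sub sf => // q [].
Qed.

(** The mixed terms of the two Leibniz rules are symmetric in the fields and cancel. Each inner rule
    holds only at points of U where f and g are smooth, so it enters as an equality near p. *)
Lemma lie_bracket_tangent U V V' p : is_open U -> is_vector_field U V ->
  is_vector_field U V' -> U p -> is_tangent p (lie_bracket V V' p).
Proof.
move=> oU hV hV' Up.
have tV q : U q -> is_tangent q (V q) by case: hV => h _; exact: h.
have tV' q : U q -> is_tangent q (V' q) by case: hV' => h _; exact: h.
have nU := near_pt_open oU Up.
have smV f : smooth_near p f -> smooth_near p (fun q => V q f).
  by move=> sf; exact: vector_field_smooth_near hV Up sf.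
have smV' f : smooth_near p f -> smooth_near p (fun q => V' q f).
  by move=> sf; exact: vector_field_smooth_near hV' Up sf.
rewrite /lie_bracket; split.
- move=> f g sf sg e; congr (_ - _); apply: tangent_ext; try exact: tV; try exact: tV'; auto.
    have := near_ptI nU (near_ptI (near_pt_near e) (near_ptI (smooth_near_near sf) (smooth_near_near sg))).
    by apply: near_ptW => q [Uq [eq [sfq sgq]]]; apply: (tangent_ext (tV' q Uq)).
  have := near_ptI nU (near_ptI (near_pt_near e) (near_ptI (smooth_near_near sf) (smooth_near_near sg))).
  by apply: near_ptW => q [Uq [eq [sfq sgq]]]; apply: (tangent_ext (tV q Uq)).
- move=> c f g sf sg.
  have slin (h k : X -> C) : smooth_near p h -> smooth_near p k ->
      smooth_near p (fun q => c * h q + k q).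
    by move=> sh sk; apply: smooth_near_add => //; apply: smooth_near_mul => //; exact: smooth_near_cst.
  have n := near_ptI nU (near_ptI (smooth_near_near sf) (smooth_near_near sg)).
  rewrite (@tangent_ext p _ (tV p Up) (fun q => V' q (fun r => c * f r + g r))
     (fun q => c * V' q f + V' q g)); [ | auto | auto |]; last first.
    by apply: near_ptW n => q [Uq [sfq sgq]]; exact: (tangent_lin (tV' q Uq)).
  rewrite (@tangent_ext p _ (tV' p Up) (fun q => V q (fun r => c * f r + g r))
     (fun q => c * V q f + V q g)); [ | auto | auto |]; last first.
    by apply: near_ptW n => q [Uq [sfq sgq]]; exact: (tangent_lin (tV q Uq)).
  rewrite (tangent_lin (tV p Up)) //; auto; rewrite (tangent_lin (tV' p Up)) //; auto; ring.
- move=> f g sf sg.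
  have smm (h k : X -> C) : smooth_near p h -> smooth_near p k ->
      smooth_near p (fun q => h q * k q) by exact: smooth_near_mul.
  have sma (h k : X -> C) : smooth_near p h -> smooth_near p k ->
      smooth_near p (fun q => h q + k q) by exact: smooth_near_add.
  have n := near_ptI nU (near_ptI (smooth_near_near sf) (smooth_near_near sg)).
  rewrite (@tangent_ext p _ (tV p Up) (fun q => V' q (fun r => f r * g r))
     (fun q => V' q f * g q + f q * V' q g)); [ | auto | auto 6 |]; last first.
    by apply: near_ptW n => q [Uq [sfq sgq]]; exact: (tangent_mul (tV' q Uq)).
  rewrite (@tangent_ext p _ (tV' p Up) (fun q => V q (fun r => f r * g r))
     (fun q => V q f * g q + f q * V q g)); [ | auto | auto 6 |]; last first.
    by apply: near_ptW n => q [Uq [sfq sgq]]; exact: (tangent_mul (tV q Uq)).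
  have [t t'] := (tV p Up, tV' p Up).
  rewrite (tangent_add t) ?(tangent_add t') ?(tangent_mul t) ?(tangent_mul t'); auto.
  ring.
Qed.

End FunctionSheaf.

Section ConnectionTransfer.
Variables (R : realType) (X : smooth_space R) (hX : function_sheaf X) (E : bundle X).

(** Serves to replace a connection defined by a choice by an explicit formula, the two agreeing only
    on tangent vectors and smooth sections. In the curvature the inner derivatives are again smooth
    sections that agree on U, so the comparison can be iterated. *)
Lemma flat_connection_ext (nabla nabla' : covariant_derivative E) :
  (forall (U : set X) s t, is_open U -> (forall q, U q -> s q = t q) ->
     @smooth_section R X E U s -> smooth_section U t) ->
  (forall p v s, is_tangent p v -> section_near p s -> nabla' p v s = nabla p v s) ->
  (forall p (s t : forall q, E q), section_near p s -> section_near p t ->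
     section_near p (fun q => s q + t q)) ->
  (forall p f (s : forall q, E q), smooth_near p f -> section_near p s ->
     section_near p (fun q => f q *: s q)) ->
  flat_connection nabla -> flat_connection nabla'.
Proof.
move=> sext e sadd sscale [cn fl].
split.
  split.
  - by move=> p v w s tv tw ss vw; rewrite !e //; apply: (conn_germ_tangent cn).
  - by move=> p v s t tv ss st st'; rewrite !e //; apply: (conn_germ_section cn).
  - by move=> p c v w s tv tw ss; rewrite !e ?(conn_tangent cn) //; exact: is_tangent_comb.
  - by move=> p v s t tv ss st; rewrite !e ?(conn_section cn) //; exact: sadd.
  - by move=> p v f s tv sf ss; rewrite !e ?(conn_leibniz cn) //; exact: sscale.
  - move=> U V s oU hV ss; apply: sext (conn_smooth cn oU hV ss) => // q Uq.
    by rewrite e //; [case: hV => h _; exact: h | exists U].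
move=> U V W s p oU hV hW ss Up.
have [[tV _] [tW _]] := (hV, hW).
have sVs V' : is_vector_field U V' -> smooth_section U (fun q => nabla q (V' q) s).
  by move=> hV'; exact: (conn_smooth cn).
have eV V' q : is_vector_field U V' -> U q -> nabla q (V' q) s = nabla' q (V' q) s.
  by move=> [tV' _] Uq; rewrite e //; [exact: tV' | exists U].
have sVs' V' : is_vector_field U V' -> smooth_section U (fun q => nabla' q (V' q) s).
  by move=> hV'; apply: sext (sVs V' hV') => // q Uq; exact: eV.
have step V' V'' : is_vector_field U V' -> is_vector_field U V'' ->
    nabla' p (V' p) (fun q => nabla' q (V'' q) s) = nabla p (V' p) (fun q => nabla q (V'' q) s).
  move=> hV' hV''; have tp : is_tangent p (V' p) by case: hV' => h _; exact: h.
  rewrite e //; last by exists U; split=> //; exact: sVs'.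
  apply: (conn_germ_section cn) => //.
  - by exists U; split=> //; exact: sVs'.
  - by exists U; split=> //; exact: sVs.
  - by exists U; split=> // q Uq; rewrite eV.
rewrite !step // (fl U) // e //; last by exists U.
exact: lie_bracket_tangent hV hW Up.
Qed.

End ConnectionTransfer.

(** * Connections on bundles of cyclic words *)

Section CyclicConnection.
Variables (R : realType) (n : nat).
Local Notation C := R[i].
Local Notation cTH := (cTH R n).
Local Notation word := (seq 'I_n).
Variables (X : smooth_space R) (hX : function_sheaf X).

Section Coefficients.
Implicit Types (p q : X) (a : X -> 'I_n -> 'I_n -> C) (x : word -> X -> C).

Lemma is_smooth_sum (I : Type) (r : seq I) (U : set X) (f : I -> X -> C) : is_open U ->
  (forall i, is_smooth U (f i)) -> is_smooth U (fun q => \sum_(i <- r) f i q).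
Proof.
move=> oU sf; elim: r => [|i r IH].
  by apply: (fs_ext hX _ (fs_cst hX U 0)) => q _; rewrite big_nil.
by apply: (fs_ext hX _ (fs_add hX oU (sf i) IH)) => q _; rewrite big_cons.
Qed.

Lemma is_smooth_sub (U : set X) (f g : X -> C) : is_open U -> is_smooth U f ->
  is_smooth U g -> is_smooth U (fun q => f q - g q).
Proof.
move=> oU sf sg; have sN := fs_mul hX oU (fs_cst hX U (-1)) sg.
by apply: (fs_ext hX _ (fs_add hX oU sf sN)) => q _; rewrite mulN1r.
Qed.

Lemma is_smooth_th_der (U : set X) a x w : is_open U ->
  (forall k l, is_smooth U (fun q => a q k l)) -> (forall u, is_smooth U (x u)) ->
  is_smooth U (fun q => th_der (a q) (fun u => x u q) w).
Proof.
move=> oU sa; elim: w x => [|k [|l w] IH] x sx; do ?exact: (fs_cst hX U 0).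
apply: (fs_add hX oU); last by apply: (IH (fun u => x (k :: u))) => u; exact: sx.
by apply: (fs_mul hX oU) => //; exact: is_smooth_sub.
Qed.

Lemma is_smooth_cyc_avg (U : set X) x w : is_open U -> (forall u, is_smooth U (x u)) ->
  is_smooth U (fun q => cyc_avg (fun u => x u q) w).
Proof.
move=> oU sx; case: w => [|l w]; first exact: sx.
apply: (fs_mul hX oU); first exact: fs_cst.
exact: is_smooth_sum.
Qed.

Variables (p : X) (v : (X -> C) -> C) (tv : is_tangent p v).

Lemma tangent_th_der a x w :
  (forall k l, smooth_near p (fun q => a q k l)) -> (forall u, smooth_near p (x u)) ->
  smooth_near p (fun q => th_der (a q) (fun u => x u q) w) /\
  v (fun q => th_der (a q) (fun u => x u q) w) =
    th_der (fun k l => v (fun q => a q k l)) (fun u => x u p) w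
    + th_der (a p) (fun u => v (x u)) w.
Proof.
move=> sa; elim: w x => [|k [|l w] IH] x sx.
- by split; [exact: smooth_near_cst | rewrite (tangent0 hX tv) addr0].
- by split; [exact: smooth_near_cst | rewrite (tangent0 hX tv) addr0].
have [sI eI] := IH (fun u => x (k :: u)) (fun u => sx _).
have sB : smooth_near p (fun q => x (k :: w) q - x (l :: w) q).
  by apply: smooth_near_add => //; exact: smooth_near_opp.
have sM := smooth_near_mul hX (sa k l) sB.
rewrite (_ : (fun q => th_der (a q) (fun u => x u q) [:: k, l & w]) =
  (fun q => a q k l * (x (k :: w) q - x (l :: w) q) +
            th_der (a q) (fun u => x (k :: u) q) (l :: w))) //.
split; first exact: (smooth_near_add hX sM sI).
rewrite (tangent_add tv sM sI) eI (tangent_mul tv) // (tangent_sub hX tv) // !der_cons2.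
by rewrite /lderiv; ring.
Qed.

Lemma tangent_cyc_avg x w : (forall u, smooth_near p (x u)) ->
  smooth_near p (fun q => cyc_avg (fun u => x u q) w) /\
  v (fun q => cyc_avg (fun u => x u q) w) = cyc_avg (fun u => v (x u)) w.
Proof.
move=> sx; case: w => [|l w]; first by split; [exact: sx | ].
have sS := @smooth_near_sum _ _ hX _
  (index_enum _) p (fun k : 'I_(size (l :: w)) => x (rot k (l :: w))) (fun k => sx _).
split; first by apply: smooth_near_mul => //; exact: smooth_near_cst.
by rewrite /cyc_avg (tangent_scale hX tv) // (tangent_sum hX tv).
Qed.

End Coefficients.

Variables (E : bundle X) (val : forall q : X, E q -> cTH) (unval : forall q : X, cTH -> E q).
Hypothesis val_linear : forall q (a : C) (x y : E q), val (a *: x + y) = a *: val x + val y.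
Hypothesis valK : forall q, cancel (@val q) (@unval q).
Hypothesis unvalK : forall q, cancel (@unval q) (@val q).

Definition coef (s : forall q, E q) (w : word) (q : X) : C := crep (val (s q)) w.

Hypothesis section_coef : forall (U : set X) s, is_open U ->
  @smooth_section R X E U s <-> forall w, is_smooth U (coef s w).

Variable u : 'I_n -> X -> C.
Hypothesis u_smooth : forall i, is_smooth setT (u i).
Hypothesis u_inj : forall q, injective (u^~ q).
Variable c : C.

Definition log_deriv (v : (X -> C) -> C) (p : X) (i j : 'I_n) : C :=
  v (fun q => u i q - u j q) / (u i p - u j p).

Definition coef_deriv (v : (X -> C) -> C) (s : forall q, E q) : cTH :=
  cyc (fun w => v (coef s w)).

(** The operator d + c sum_(i < j) ad(t_ij) dlog(u_i - u_j), for functions u_i with distinct values,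
    with the form written as one [ad_der]. On Conf_n the u_i are the points z_i, on the quotient the
    points of the slice. *)
Definition cyc_conn : covariant_derivative E := fun p v s =>
  unval p (coef_deriv v s + c *: ad_der (log_deriv v p) (val (s p))).

Lemma val0 q : val (0 : E q) = 0.
Proof.
apply: (addrI (val (0 : E q))); rewrite addr0.
by rewrite -{1}[val 0]scale1r -val_linear scaler0 addr0.
Qed.

Lemma val_add q (x y : E q) : val (x + y) = val x + val y.
Proof. by rewrite -[val x]scale1r -val_linear scale1r. Qed.

Lemma val_scale q a (x : E q) : val (a *: x) = a *: val x.
Proof. by rewrite -[a *: x]addr0 val_linear val0 addr0. Qed.

Lemma crep_add (s t : cTH) w : crep (s + t) w = crep s w + crep t w.
Proof. by rewrite -[s]scale1r crep_linear mul1r scale1r. Qed.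

Lemma crep0 w : crep (0 : cTH) w = 0.
Proof. by apply: (addrI (crep (0 : cTH) w)); rewrite addr0 -crep_add addr0. Qed.

Lemma crep_scale a (s : cTH) w : crep (a *: s) w = a * crep s w.
Proof. by rewrite -[a *: s]addr0 crep_linear crep0 addr0. Qed.

Lemma coef_near p s : section_near p s -> forall w, smooth_near p (coef s w).
Proof. by move=> [U [oU Up /(section_coef _ oU) h]] w; exists U. Qed.

Lemma diff_smooth p i j : smooth_near p (fun q => u i q - u j q).
Proof.
have oT := fs_openT hX.
by exists setT; split=> //; exact: is_smooth_sub.
Qed.

Lemma u_neq q i j : i != j -> u i q - u j q != 0.
Proof. by move=> ij; rewrite subr_eq0 (inj_eq (@u_inj q)). Qed.

(** With w_kl = dlog(u_k - u_l), the difference of the two sides is, up to sign, the Arnold form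
    w_kl w_lm + w_lm w_mk + w_mk w_kl (wedge products) evaluated on v and v'. *)
Lemma log_deriv_arnold v v' p k l m : is_tangent p v -> is_tangent p v' ->
  let a := log_deriv v p in let b := log_deriv v' p in
  b k l * a k m + b l m * a k l - b l m * a k m =
  a k l * b k m + a l m * b k l - a l m * b k m.
Proof.
move=> tv tv' /=.
have su i : smooth_near p (u i) by exists setT; split=> //; exact: fs_openT.
have e w i j : is_tangent p w -> log_deriv w p i j = (w (u i) - w (u j)) / (u i p - u j p).
  by move=> tw; rewrite /log_deriv (tangent_sub hX tw).
rewrite !e //.
(* When two indices coincide a weight is a quotient by 0, hence 0; what is left is commutativity and
   the symmetry of the weights. *)
have [->|kl] := eqVneq k l; first by rewrite !subrr !invr0 !mulr0; ring.
have [->|km] := eqVneq k m.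
  rewrite !subrr !invr0 !mulr0 -(opprB (u m p)) invrN; ring.
have [->|lm] := eqVneq l m; first by rewrite !subrr !invr0 !mulr0; ring.
have := u_neq p kl; have := u_neq p km; have := u_neq p lm => h1 h2 h3.
by field; rewrite h1 h2 h3.
Qed.

Lemma log_deriv_smooth (U : set X) V i j : is_open U -> is_vector_field U V ->
  is_smooth U (fun q => log_deriv (V q) q i j).
Proof.
move=> oU [tV sV]; have [->|ij] := eqVneq i j.
  by apply: (fs_ext hX _ (fs_cst hX U 0)) => q _; rewrite /log_deriv subrr invr0 mulr0.
have sd : is_smooth U (fun q => u i q - u j q).
  by apply: is_smooth_sub => //; apply: fs_sub (u_smooth _).
apply: (fs_mul hX oU); first exact: sV.
by apply: (fs_inv hX oU) => // q _; exact: u_neq.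
Qed.

(** The coefficients of the canonical representative are already averages, and averaging, a finite
    linear combination, commutes with v. *)
Lemma coef_derivP p v s w : is_tangent p v -> section_near p s ->
  crep (coef_deriv v s) w = v (coef s w).
Proof.
move=> tv ss; have cs := coef_near ss.
rewrite /coef_deriv crep_cyc -(tangent_cyc_avg tv w cs).2.
congr v; apply/funext => q.
by rewrite -[RHS]/(crep _ _) -[in RHS](crepK (val (s q))) crep_cyc.
Qed.

Lemma coef_conn p v s w : is_tangent p v -> section_near p s ->
  crep (val (cyc_conn p v s) : cTH) w =
  v (coef s w) + c * cyc_avg (th_der (log_deriv v p) (fun u' => coef s u' p)) w.
Proof.
move=> tv ss; rewrite /cyc_conn unvalK crep_add crep_scale (coef_derivP w tv) //.
by rewrite crep_ad_der.
Qed.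

Lemma section_near_conn (U : set X) V s : is_open U -> is_vector_field U V ->
  smooth_section U s -> smooth_section U (fun p => cyc_conn p (V p) s : E p).
Proof.
move=> oU hV ss; have [tV sV] := hV; apply/(section_coef _ oU) => w.
have sx := (section_coef s oU).1 ss.
apply: (fs_ext hX (f := fun q => V q (coef s w) + c *
   cyc_avg (fun u' => th_der (log_deriv (V q) q) (fun u'' => coef s u'' q) u') w)).
  by move=> q Uq; rewrite /coef (@coef_conn q) //; [exact: tV | exists U].
apply: (fs_add hX oU); first exact: sV.
apply: (fs_mul hX oU); first exact: fs_cst.
apply: is_smooth_cyc_avg => // u'; apply: is_smooth_th_der => // k l.
exact: log_deriv_smooth.
Qed.

(* Leibniz rule for the pairing (a, t) |-> ad_der a t. *)
Lemma coef_deriv_ad p v a s : is_tangent p v -> section_near p s ->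
  (forall k l, smooth_near p (fun q => a q k l)) ->
  coef_deriv v (fun q => unval q (ad_der (a q) (val (s q)))) =
  ad_der (fun k l => v (fun q => a q k l)) (val (s p)) + ad_der (a p) (coef_deriv v s).
Proof.
move=> tv ss sa; have cs := coef_near ss.
apply: crep_inj => w; rewrite /coef_deriv crep_cyc crep_add !crep_ad_der.
rewrite -[cyc_avg (th_der _ _) w in X in X + _]mul1r -cyc_avg_linear.
have st u' := tangent_th_der tv u' sa cs.
rewrite (@eq_cyc_avg _ _ _ (fun u' => v (fun q =>
  cyc_avg (fun u'' => th_der (a q) (fun t => coef s t q) u'') u'))); last first.
  move=> u' _; congr v; apply/funext => q; rewrite /coef unvalK crep_ad_der.
  by [].
rewrite (@eq_cyc_avg _ _ _ (cyc_avg (fun u' =>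
  v (fun q => th_der (a q) (fun t => coef s t q) u')))); last first.
  by move=> u' _; rewrite (tangent_cyc_avg tv u' (fun t => (st t).1)).2.
rewrite -[LHS]crep_cyc cyc_avgK crep_cyc; apply: eq_cyc_avg => u' _.
rewrite (st u').2 mul1r; congr (_ + _).
apply: eq_th_der => t _.
by apply: esym; exact: (coef_derivP t tv ss).
Qed.

Lemma coef_deriv_lin p v a s t : is_tangent p v -> section_near p s -> section_near p t ->
  coef_deriv v (fun q => a *: s q + t q) = a *: coef_deriv v s + coef_deriv v t.
Proof.
move=> tv ss st; rewrite -[_ *: _]/(cscale _ _) /coef_deriv cscale_cyc -cycD.
congr cyc; apply/funext => w.
rewrite -[RHS]/(a * v (coef s w) + v (coef t w)) -(tangent_lin tv) //; try exact: coef_near.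
by congr v; apply/funext => q; rewrite /coef val_linear crep_linear.
Qed.

Lemma coef_deriv_ext p v s t : is_tangent p v -> section_near p s -> section_near p t ->
  near_pt p (fun q => s q = t q) -> coef_deriv v s = coef_deriv v t.
Proof.
move=> tv ss st e; congr cyc; apply/funext => w; apply: (tangent_ext tv); try exact: coef_near.
by apply: near_ptW e => q; rewrite /coef => ->.
Qed.

Lemma cyc_conn_connection : is_connection cyc_conn.
Proof.
have val_inj q : injective (@val q) := can_inj (@valK q).
split.
- move=> p v w s tv tw ss e; rewrite /cyc_conn; congr (unval _ (_ + _ *: _)).
    by congr cyc; apply/funext => x; apply: e; exact: coef_near.
  apply: eq_ad_der => k l _; rewrite /log_deriv; congr (_ / _).
  by apply: e; exact: diff_smooth.
- move=> p v s t tv ss st e; rewrite /cyc_conn (coef_deriv_ext tv ss st e).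
  by rewrite (near_pt_singleton e).
- move=> p a v w s tv tw ss; apply: val_inj; rewrite val_linear /cyc_conn !unvalK.
  rewrite (_ : coef_deriv _ s = a *: coef_deriv v s + coef_deriv w s); last first.
    by rewrite -[_ *: _]/(cscale _ _) /coef_deriv cscale_cyc -cycD.
  rewrite (@eq_ad_der _ _ (log_deriv _ p) (fun k l => a * log_deriv v p k l + log_deriv w p k l)).
    by rewrite ad_der_linearl; apply: crep_inj => x; rewrite !(crep_add, crep_scale); ring.
  by move=> k l _; rewrite /log_deriv; ring.
- move=> p v s t tv ss st; apply: val_inj; rewrite val_add /cyc_conn !unvalK.
  have -> : (fun q => s q + t q) = (fun q => 1 *: s q + t q).
    by apply: functional_extensionality_dep => q; rewrite scale1r.
  rewrite (coef_deriv_lin 1 tv ss st) /= !scale1r val_add.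
  rewrite -[val (s p) + _](congr2 _ (scale1r _) (erefl _)) ad_der_linear.
  by apply: crep_inj => x; rewrite !(crep_add, crep_scale); ring.
- move=> p v f s tv sf ss; apply: val_inj.
  rewrite val_add !val_scale /cyc_conn !unvalK val_scale.
  have cs := coef_near ss.
  have -> : coef_deriv v (fun q => f q *: s q) = v f *: val (s p) + f p *: coef_deriv v s.
    rewrite -[val (s p)]crepK -![_ *: _]/(cscale _ _) !cscale_cyc -cycD; congr cyc.
    apply/funext => w; transitivity (v (fun q => f q * coef s w q)).
      by congr v; apply/funext => q; rewrite /coef val_scale crep_scale.
    by rewrite (tangent_mul tv sf (cs w)).
  have -> : ad_der (log_deriv v p) (f p *: val (s p)) = f p *: ad_der (log_deriv v p) (val (s p)).
    have ad0 : ad_der (log_deriv v p) 0 = 0.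
      apply: (addrI (ad_der (log_deriv v p) 0)); rewrite addr0.
      by rewrite -{1}[ad_der _ 0]scale1r -ad_der_linear scaler0 addr0.
    by rewrite -[f p *: val (s p)]addr0 ad_der_linear ad0 addr0.
  by apply: crep_inj => x; rewrite !(crep_add, crep_scale); ring.
- by move=> U V s oU hV ss; exact: section_near_conn.
Qed.

(** The terms are sorted for the curvature: the third and fourth are exchanged when V and V' are,
    the first yields the bracket, the second the exterior derivative of the form, and the last its
    commutator. *)
Lemma cyc_conn_iter (U : set X) V V' s p : is_open U -> is_vector_field U V ->
  is_vector_field U V' -> smooth_section U s -> U p ->
  val (cyc_conn p (V p) (fun q => cyc_conn q (V' q) s)) =
  cyc (fun w => V p (fun q => V' q (coef s w))) +
  c *: ad_der (fun k l => V p (fun q => log_deriv (V' q) q k l)) (val (s p)) +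
  c *: ad_der (log_deriv (V' p) p) (coef_deriv (V p) s) +
  c *: ad_der (log_deriv (V p) p) (coef_deriv (V' p) s) +
  c *: (c *: ad_der (log_deriv (V p) p) (ad_der (log_deriv (V' p) p) (val (s p)))).
Proof.
move=> oU hV hV' ss Up; have [[tV _] [tV' sV']] := (hV, hV').
have ssp q : U q -> section_near q s by exists U.
have sx := (section_coef s oU).1 ss.
pose S1 q := unval q (coef_deriv (V' q) s).
pose S2 q := unval q (ad_der (log_deriv (V' q) q) (val (s q))).
have cS1 w q : U q -> coef S1 w q = V' q (coef s w).
  by move=> Uq; rewrite /coef unvalK (coef_derivP w (tV' q Uq)) //; exact: ssp.
have sS1 : smooth_section U S1.
  apply/(section_coef _ oU) => w; apply: (fs_ext hX _ (sV' U _ oU _ (sx w))) => // q Uq.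
  by rewrite cS1.
have sS2 : smooth_section U S2.
  apply/(section_coef _ oU) => w; apply: (fs_ext hX (f := fun q =>
     cyc_avg (fun x => th_der (log_deriv (V' q) q) (fun y => coef s y q) x) w)).
    by move=> q _; rewrite /coef unvalK crep_ad_der.
  apply: is_smooth_cyc_avg => // x; apply: is_smooth_th_der => // k l.
  exact: log_deriv_smooth.
have -> : (fun q => cyc_conn q (V' q) s) = (fun q => c *: S2 q + S1 q).
  apply: functional_extensionality_dep => q; apply: (can_inj (@valK q)).
  by rewrite val_linear !unvalK addrC.
have nS1 : section_near p S1 by exists U.
have nS2 : section_near p S2 by exists U.
rewrite /cyc_conn unvalK (coef_deriv_lin c (tV p Up) nS2 nS1) val_linear !unvalK.
have -> : coef_deriv (V p) S1 = cyc (fun w => V p (fun q => V' q (coef s w))).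
  congr cyc; apply/funext => w; apply: (tangent_ext (tV p Up)).
  - exact: coef_near.
  - by exists U; split=> //; exact: sV'.
  - by exists U; split=> // q Uq; rewrite cS1.
rewrite (coef_deriv_ad (tV p Up) (ssp p Up)); last first.
  by move=> k l; exists U; split=> //; exact: log_deriv_smooth.
rewrite ad_der_linear.
by apply: crep_inj => x; rewrite !(crep_add, crep_scale); ring.
Qed.

(** The form has closed coefficients dlog(u_k - u_l), and its values on two vectors commute by the
    Arnold relation. *)
Lemma cyc_conn_flat : flat_connection cyc_conn.
Proof.
split; first exact: cyc_conn_connection.
move=> U V W s p oU hV hW ss Up; have [[tV sV] [tW sW]] := (hV, hW).
apply/eqP; rewrite subr_eq; apply/eqP; apply: (can_inj (@valK p)).
rewrite val_add (cyc_conn_iter oU hV hW ss Up) (cyc_conn_iter oU hW hV ss Up).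
rewrite /cyc_conn unvalK.
have -> : cyc (fun w => V p (fun q => W q (coef s w))) =
    coef_deriv (lie_bracket V W p) s + cyc (fun w => W p (fun q => V q (coef s w))) :> cTH.
  rewrite /coef_deriv -cycD; congr cyc; apply/funext => w.
  by rewrite -[RHS]/(_ - _ + _) subrK.
(* Closedness of dlog: for d = u_k - u_l, V(W d / d) - W(V d / d) = [V, W] d / d. *)
have -> : ad_der (fun k l => V p (fun q => log_deriv (W q) q k l)) (val (s p)) =
    1 *: ad_der (log_deriv (lie_bracket V W p) p) (val (s p)) +
    ad_der (fun k l => W p (fun q => log_deriv (V q) q k l)) (val (s p)).
  rewrite -ad_der_linearl; apply: eq_ad_der => k l kl; rewrite mul1r.
  pose d q := u k q - u l q.
  have d0 q : d q != 0 by exact: u_neq.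
  have sd q : smooth_near q d by exact: diff_smooth.
  have nd : near_pt p (fun q => d q != 0) by exact: near_ptT.
  have sVd : smooth_near p (fun q => V q d) by exact: vector_field_smooth_near hV Up (sd p).
  have sWd : smooth_near p (fun q => W q d) by exact: vector_field_smooth_near hW Up (sd p).
  have sI := smooth_near_inv hX nd (sd p).
  rewrite /log_deriv -/d (tangent_mul (tV p Up) sWd sI) (tangent_mul (tW p Up) sVd sI).
  rewrite (tangent_inv hX (tV p Up) nd (sd p)) (tangent_inv hX (tW p Up) nd (sd p)).
  by rewrite /lie_bracket -/(d p); have := d0 p => d0p; field.
rewrite (ad_der_comm (v := log_deriv (W p) p) (v' := log_deriv (V p) p)); last first.
  by move=> k l m; exact: log_deriv_arnold (tW p Up) (tV p Up).
by apply: crep_inj => x; rewrite !(crep_add, crep_scale); ring.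
Qed.

End CyclicConnection.

(** * Descent of H_n *)

Section Slice.
Variables (R : realType) (m : nat).
Local Notation n := m.+1.
Local Notation C := R[i].
Local Notation conf := (conf R n).
Implicit Types (z w : conf) (q : moduli R n) (g : aff R).

Lemma conf_sheaf : function_sheaf (conf_space R n).
Proof.
split.
- exact: conf_openT.
- exact: conf_openI.
- by move=> U W f WU; exact: conf_smooth_sub.
- by move=> U f g; exact: eq_conf_smooth.
- exact: conf_smooth_cst.
- by move=> U f g; exact: conf_smooth_add.
- by move=> U f g; exact: conf_smooth_mul.
- by move=> U f; exact: conf_smooth_inv.
Qed.

Lemma moduli_sheaf : function_sheaf (moduli_space R n).
Proof.
split=> /=.
- exact: conf_openT.
- by move=> U W; exact: conf_openI.
- by move=> U W f WU; apply: conf_smooth_sub => z; exact: WU.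
- by move=> U f g fg; apply: eq_conf_smooth => z Uz; exact: fg.
- by move=> U c; exact: conf_smooth_cst.
- by move=> U f g; exact: conf_smooth_add.
- by move=> U f g; exact: conf_smooth_mul.
- by move=> U f oU f0; apply: conf_smooth_inv => // z; exact: f0.
Qed.

Lemma to_moduliP z w : to_moduli z = to_moduli w <-> exists g, w = conf_act g z.
Proof.
split=> [/eqmodP/asboolP//|h].
by apply/eqmodP/asboolP.
Qed.

Lemma to_moduli_act g z : to_moduli (conf_act g z) = to_moduli z.
Proof. by apply/esym/to_moduliP; exists g. Qed.

(** For n = 1 there is no second point to normalise; with the value 1 the frame is then a
    translation. *)
Definition scale z : C := if m is 0 then 1 else z ord_max - z ord0.

Lemma scale_neq0 z : scale z != 0.
Proof.
rewrite /scale; case: m z => [|k] z; first exact: oner_neq0.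
by rewrite subr_eq0 (inj_eq (@pts_inj _ _ z)).
Qed.

Definition frame z : aff R := Aff (z ord0) (scale_neq0 z).

Lemma scaleV_neq0 z : (scale z)^-1 != 0.
Proof. by rewrite invr_eq0 scale_neq0. Qed.

Definition unframe z : aff R := Aff (- ((scale z)^-1 * z ord0)) (scaleV_neq0 z).

Lemma frameK z : cancel (aff_map (unframe z)) (aff_map (frame z)).
Proof. by move=> x; rewrite /aff_map /=; field; rewrite scale_neq0. Qed.

(* The point of the orbit of z whose first point is 0 and, unless n = 1, whose last
   point is 1. *)
Definition slice z : conf := conf_act (unframe z) z.

Lemma frame_slice z : conf_act (frame z) (slice z) = z.
Proof. by apply: conf_eq => i /=; exact: frameK. Qed.

Lemma sliceE z i : slice z i = (z i - z ord0) / scale z.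
Proof. by rewrite /= /aff_map /=; field; rewrite scale_neq0. Qed.

Lemma slice_act g z : slice (conf_act g z) = slice z.
Proof.
have ga := aff_neq0 g.
apply: conf_eq => i; rewrite !sliceE /= /aff_map.
rewrite opprD addrACA subrr addr0 -mulrBr; rewrite /scale; move: z i.
case: m => [|k] z i /=; first by rewrite (ord1 i) !subrr mulr0.
rewrite /aff_map opprD addrACA subrr addr0 -mulrBr invfM mulrA.
have zz : z ord_max - z ord0 != 0 by rewrite subr_eq0 (inj_eq (@pts_inj _ _ z)).
by field; rewrite ga zz.
Qed.

Lemma to_moduli_slice z : to_moduli (slice z) = to_moduli z.
Proof. exact: to_moduli_act. Qed.

Definition sigma q : conf := slice (repr q).

Lemma sigma_to_moduli z : sigma (to_moduli z) = slice z.
Proof.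
rewrite /sigma; have /esym/to_moduliP[g ->] : to_moduli (repr (to_moduli z)) = to_moduli z.
  exact: reprK.
by rewrite slice_act.
Qed.

Lemma to_moduli_sigma q : to_moduli (sigma q) = q.
Proof. by rewrite /sigma to_moduli_slice; exact: reprK. Qed.

Lemma scale_smooth : conf_smooth setT scale.
Proof.
have oT : conf_open [set: conf] by exact: conf_openT.
apply: (@eq_conf_smooth _ _ _ (fun z =>
    (m != 0)%:R * (z ord_max + (-1) * z ord0) + (m == 0)%:R)).
  move=> z _; rewrite /scale mulN1r; case: m z => [|k] z /=.
    by rewrite mul0r add0r.
  by rewrite mul1r addr0.
apply: conf_smooth_add => //; last exact: conf_smooth_cst.
apply: conf_smooth_mul => //; first exact: conf_smooth_cst.
apply: conf_smooth_add => //; first exact: conf_smooth_pt.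
by apply: conf_smooth_mul => //; [exact: conf_smooth_cst | exact: conf_smooth_pt].
Qed.

Lemma slice_smooth i : conf_smooth setT (fun z => slice z i).
Proof.
have oT : conf_open [set: conf] by exact: conf_openT.
apply: (@eq_conf_smooth _ _ _ (fun z => (z i + (-1) * z ord0) * (scale z)^-1)).
  by move=> z _; rewrite sliceE mulN1r.
apply: conf_smooth_mul => //.
  apply: conf_smooth_add => //; first exact: conf_smooth_pt.
  by apply: conf_smooth_mul => //; [exact: conf_smooth_cst | exact: conf_smooth_pt].
apply: conf_smooth_inv => //; last exact: scale_smooth.
by move=> z _; exact: scale_neq0.
Qed.

End Slice.

Section QuotientBundleTheory.
Variables (R : realType) (m : nat) (E : equiv_bundle R m.+1).
Local Notation n := m.+1.

Lemma qfiber_eq_at (q : moduli R n) (x y : qfiber E q) z (e : to_moduli z = q) :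
  x z e = y z e -> x = y.
Proof.
move=> xy; apply: qfiber_eq => w ew.
have /to_moduliP[g wg] : to_moduli z = to_moduli w by rewrite e ew.
rewrite wg in ew *; by rewrite (familyP x e) (familyP y e) xy.
Qed.

(** Injectivity is automatic, since an equivariant family on one orbit is determined by a single
    value. *)
Lemma eval_at_bij (z : conf R n) :
  (forall x : E z, exists y : qfiber E (to_moduli z), eval_at y = x) ->
  bijective (@eval_at R n E z).
Proof.
move=> /choice[f fK]; exists f => // y.
by apply: (@qfiber_eq_at _ _ _ z erefl); exact: fK.
Qed.

End QuotientBundleTheory.

(** * The bundle of cyclic words and its connection on the quotient *)

Section DescentH.
Variables (R : realType) (m : nat).
Local Notation n := m.+1.
Local Notation C := R[i].
Local Notation cTH := (cTH R n).
Local Notation HB := (H_bundle R n).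
Local Notation word := (seq 'I_n).

Definition const_fiber (q : moduli R n) (x : cTH) : qfiber HB q :=
  @QFiber R n HB q (fun _ _ => x) (fun _ _ _ _ => erefl).

(** The cyclic average of a smooth lift is again a smooth lift, and it is the canonical one; the
    existence of a lift becomes a condition on coefficients. *)
Lemma H_sectionP (U : set (conf R n)) s : conf_open U ->
  H_section U s <-> forall w : word, conf_smooth U (fun z => crep (s z) w).
Proof.
move=> oU; split=> [[l [sl e]] w|sc].
  have := is_smooth_cyc_avg (@conf_sheaf R m) (x := fun u z => l z u) w oU sl.
  by apply: eq_conf_smooth => z Uz; rewrite e // crep_cyc.
by exists (fun z => crep (s z)); split=> // z _; rewrite crepK.
Qed.

Lemma H_bundle_descends : bundle_descends HB.
Proof.
move=> z; split.
  by apply: eval_at_bij => x; exists (const_fiber _ x).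
move=> x; exists (fun q => const_fiber q x); split=> //.
exists setT; split=> //; first exact: (@conf_openT R n).
by apply/H_sectionP => [|w]; [exact: (@conf_openT R n) | exact: (@conf_smooth_cst R n _ (crep x w))].
Qed.

Definition holonomy_scalar : C := (two_pi_i R)^-1.

Definition conf_conn : covariant_derivative HB :=
  @cyc_conn R n (conf_space R n) HB (fun _ x => x) (fun _ x => x) (fun i z => z i) holonomy_scalar.

Lemma conf_conn_flat : flat_connection conf_conn.
Proof.
apply: (@cyc_conn_flat R n (conf_space R n) (@conf_sheaf R m) HB) => //.
- by move=> U s oU; exact: H_sectionP.
- by move=> i; exact: conf_smooth_pt.
- by move=> z; exact: pts_inj.
Qed.

Lemma H_section_near_coef (p : conf R n) s : @section_near R _ HB p s ->
  forall w : word, smooth_near (p : conf_space R n) (fun z => crep (s z) w).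
Proof.
by move=> [U [oU Up /(H_sectionP _ oU) h]] w; exists U; split=> //; exact: h.
Qed.

(** Two lifts of s have the same cyclic average near p, and v commutes with averaging, so the chosen
    value does not depend on the lift. *)
Lemma d_HE (p : conf R n) v s : @is_tangent R (conf_space R n) p v ->
  @section_near R _ HB p s -> d_H p v s = cyc (fun w => v (fun z => crep (s z) w)).
Proof.
move=> tv ss; have cs := H_section_near_coef ss.
have [U [oU Up /(H_sectionP _ oU) sU]] := ss.
rewrite /d_H; apply: xget_unique => [|h [W [l [oW Wp [sl e] ->]]]].
  exists U, (fun z => crep (s z)); split=> //; split=> // z _.
  by rewrite crepK.
rewrite -cyc_avgK; congr cyc; apply/funext => w.
have sl' u : smooth_near (p : conf_space R n) (fun z => l z u).
  by exists W; split=> //; exact: sl.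
rewrite -(tangent_cyc_avg (@conf_sheaf R m) tv w sl').2.
apply: (tangent_ext tv) => //.
  exact: (tangent_cyc_avg (@conf_sheaf R m) tv w sl').1.
by exists W; split=> // z Wz; rewrite e // crep_cyc.
Qed.

Lemma nabla_HE (p : conf R n) v s : @is_tangent R (conf_space R n) p v ->
  @section_near R _ HB p s -> nabla_H p v s = conf_conn p v s.
Proof.
move=> tv ss; rewrite /nabla_H d_HE // /conf_conn /cyc_conn; congr (_ + _ *: _).
rewrite sum_ad_t // => i j; rewrite /dlog.
have sd : smooth_near (p : conf_space R n) (fun z : conf R n => z i - z j).
  apply: (@diff_smooth R n (conf_space R n) (@conf_sheaf R m) (fun i z => z i)).
  by move=> k; exact: conf_smooth_pt.
(* The symmetry of the weights required by [sum_ad_t]: numerator and denominator both change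
   sign. *)
rewrite -(opprB (p j)) invrN mulrN -mulNr -(tangent_opp (@conf_sheaf R m) tv sd).
by congr (v _ / _); apply/funext => z; rewrite opprB.
Qed.

Lemma nabla_H_flat : flat_connection (@nabla_H R n).
Proof.
apply: (flat_connection_ext (@conf_sheaf R m) _ _ _ _ conf_conn_flat).
- move=> U s t oU st [l [sl e]]; exists l; split=> // z Uz.
  by rewrite -st // e.
- by move=> p v s tv ss; exact: nabla_HE.
- move=> p s t [U [oU Up sU]] [W [oW Wp sW]]; exists (U `&` W).
  have oI : conf_open (U `&` W) by exact: conf_openI.
  split=> //; apply/(H_sectionP _ oI) => w.
  move/(H_sectionP _ oU)/(_ w): sU => sU; move/(H_sectionP _ oW)/(_ w): sW => sW.
  apply: (@eq_conf_smooth _ _ _ (fun z => crep (s z) w + crep (t z) w)).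
    by move=> z _; rewrite crep_add.
  apply: conf_smooth_add => //.
    by apply: conf_smooth_sub sU => z [].
  by apply: conf_smooth_sub sW => z [].
- move=> p f s [U [oU Up sU]] [W [oW Wp sW]]; exists (U `&` W).
  have oI : conf_open (U `&` W) by exact: conf_openI.
  split=> //; apply/(H_sectionP _ oI) => w.
  move/(H_sectionP _ oW)/(_ w): sW => sW.
  apply: (@eq_conf_smooth _ _ _ (fun z => f z * crep (s z) w)).
    by move=> z _; rewrite crep_scale.
  apply: conf_smooth_mul => //.
    by apply: conf_smooth_sub sU => z [].
  by apply: conf_smooth_sub sW => z [].
Qed.

Definition fiber_val (q : moduli R n) (x : qfiber HB q) : cTH :=
  x (sigma q) (to_moduli_sigma q).

Lemma fiber_valE q (x : qfiber HB q) z e : x z e = fiber_val x.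
Proof.
have /to_moduliP[g zg] : to_moduli (sigma q) = to_moduli z by rewrite to_moduli_sigma e.
by rewrite zg in e *; rewrite (familyP x (to_moduli_sigma q)).
Qed.

Lemma fiber_valK q : cancel (@fiber_val q) (@const_fiber q).
Proof. by move=> x; apply: qfiber_eq => z e /=; rewrite -(fiber_valE x e). Qed.

Lemma sigma_smooth i :
  @is_smooth R (moduli_space R n) setT (fun q : moduli R n => sigma q i).
Proof.
apply: (eq_conf_smooth _ (@slice_smooth R m i)) => z _.
by rewrite -sigma_to_moduli.
Qed.

Lemma quotient_coefP (U : set (moduli R n)) (s : forall q, quotient_bundle HB q) :
  @is_open R (moduli_space R n) U ->
  @smooth_section R (moduli_space R n) (quotient_bundle HB) U s <->
  forall w, @is_smooth R (moduli_space R n) U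
    (@coef R n (moduli_space R n) (quotient_bundle HB) fiber_val s w).
Proof.
move=> oU; apply: (iff_trans (H_sectionP _ oU)).
have e w z : crep (pull_section s z) w =
    @coef R n (moduli_space R n) (quotient_bundle HB) fiber_val s w (to_moduli z).
  by rewrite /coef -(fiber_valE (s (to_moduli z)) erefl).
by split=> h w; apply: (eq_conf_smooth _ (h w)) => z _; rewrite /= e.
Qed.

Definition moduli_conn : covariant_derivative (quotient_bundle HB) :=
  @cyc_conn R n (moduli_space R n) (quotient_bundle HB) fiber_val const_fiber
    (fun i q => sigma q i) holonomy_scalar.

Lemma moduli_conn_flat : flat_connection moduli_conn.
Proof.
apply: (@cyc_conn_flat R n (moduli_space R n) (@moduli_sheaf R m) (quotient_bundle HB)).
- by [].
- exact: fiber_valK.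
- by [].
- exact: quotient_coefP.
- exact: sigma_smooth.
- by move=> q; exact: pts_inj.
Qed.

Lemma smooth_near_pull (z : conf R n) f :
  @smooth_near R (moduli_space R n) (to_moduli z) f ->
  @smooth_near R (conf_space R n) z (f \o @to_moduli R n).
Proof. by move=> [U [oU Uz sf]]; exists (@to_moduli R n @^-1` U). Qed.

Lemma push_tangentP (z : conf R n) v : @is_tangent R (conf_space R n) z v ->
  @is_tangent R (moduli_space R n) (to_moduli z) (push_tangent v).
Proof.
have pull f := @smooth_near_pull z f.
move=> tv; split=> [f g /pull sf /pull sg [U [oU Uz fg]]|c f g|f g].
- apply: (tangent_ext tv sf sg); exists (@to_moduli R n @^-1` U); split=> // w; exact: fg.
- by move=> /pull sf /pull sg; exact: (tangent_lin tv c sf sg).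
- by move=> /pull sf /pull sg; exact: (tangent_mul tv sf sg).
Qed.

(* Passing to the slice changes dlog(z_i - z_j) by - dlog(scale z), which is the
   same for all pairs, and the sum of all the ad(t_ij) is inner. *)
Lemma moduli_conn_pullback : is_pullback (@nabla_H R n) moduli_conn.
Proof.
move=> z v s tv ss.
have [U [oU Uz sU]] := ss.
have sp : @section_near R _ HB z (pull_section s).
  by exists (@to_moduli R n @^-1` U).
rewrite nabla_HE // /moduli_conn /conf_conn /cyc_conn /eval_at /=.
congr (_ + _ *: _).
  congr cyc; apply/funext => w; rewrite /push_tangent; congr v; apply/funext => z'.
  by rewrite /coef /= -(fiber_valE (s (to_moduli z')) erefl).
rewrite -(fiber_valE (s (to_moduli z)) erefl) -[s (to_moduli z) z erefl]/(pull_section s z).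
have oT : conf_open [set: conf R n] by exact: conf_openT.
have hS := @conf_sheaf R m.
have sa : smooth_near (z : conf_space R n) (@scale R m).
  by exists setT; split=> //; exact: scale_smooth.
have a0 : near_pt (z : conf_space R n) (fun z => scale z != 0).
  by apply: near_ptT => // w; exact: scale_neq0.
rewrite -[RHS]addr0 -(scaler0 _ (v (@scale R m) / scale z)) -(ad_der1 (pull_section s z)).
rewrite addrC -ad_der_linearl; apply: eq_ad_der => k l kl.
rewrite /log_deriv /push_tangent /comp.
have sd : smooth_near (z : conf_space R n) (fun z : conf R n => z k - z l).
  apply: (@diff_smooth R n (conf_space R n) hS (fun i z => z i)) => i.
  exact: conf_smooth_pt.
have -> : (fun z' : conf R n => sigma (to_moduli z') k - sigma (to_moduli z') l) =
    (fun z' => (z' k - z' l) * (scale z')^-1).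
  by apply/funext => z'; rewrite sigma_to_moduli !sliceE; ring.
rewrite (tangent_mul tv sd (smooth_near_inv hS a0 sa)) (tangent_inv hS tv a0 sa).
rewrite -[aff_map _ _ - aff_map _ _]/(sigma (to_moduli z) k - sigma (to_moduli z) l).
rewrite sigma_to_moduli !sliceE.
have h1 : z k - z l != 0 by rewrite subr_eq0 (inj_eq (@pts_inj _ _ z)).
have h2 := scale_neq0 z.
rewrite (_ : (z k - z ord0) / scale z - (z l - z ord0) / scale z = (z k - z l) / scale z); last ring.
by field; rewrite h1 h2.
Qed.

Lemma H_connection_descends : connection_descends (@nabla_H R n).
Proof.
split; first exact: nabla_H_flat.
by exists moduli_conn; split; [exact: moduli_conn_flat | exact: moduli_conn_pullback].
Qed.

End DescentH.

(** * Classes of loops *)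

Section ComplexContinuity.
Variables (R : realType) (T : topologicalType).
Local Notation C := R[i].

Definition continuousC (f : T -> C) : Prop :=
  continuous (fun x => complex.Re (f x)) /\ continuous (fun x => complex.Im (f x)).

Lemma continuousC_cst c : continuousC (fun=> c).
Proof. by split; exact: cst_continuous. Qed.

Lemma continuousC_add f g : continuousC f -> continuousC g ->
  continuousC (fun x => f x + g x).
Proof.
move=> [f1 f2] [g1 g2]; split=> x.
  rewrite (_ : (fun x => _) = (fun x => complex.Re (f x) + complex.Re (g x))).
    by apply: (@cvgD _ R^o); [exact: f1 | exact: g1].
  by apply/funext => y; case: (f y) (g y) => [? ?] [? ?].
rewrite (_ : (fun x => _) = (fun x => complex.Im (f x) + complex.Im (g x))).
  by apply: (@cvgD _ R^o); [exact: f2 | exact: g2].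
by apply/funext => y; case: (f y) (g y) => [? ?] [? ?].
Qed.

Lemma continuousC_mul f g : continuousC f -> continuousC g ->
  continuousC (fun x => f x * g x).
Proof.
move=> [f1 f2] [g1 g2]; split=> x.
  rewrite (_ : (fun x => _) = (fun x => complex.Re (f x) * complex.Re (g x) -
    complex.Im (f x) * complex.Im (g x))).
    by apply: (@cvgB _ R^o); apply: cvgM; [exact: f1 | exact: g1 | exact: f2 | exact: g2].
  by apply/funext => y; case: (f y) (g y) => [? ?] [? ?].
rewrite (_ : (fun x => _) = (fun x => complex.Re (f x) * complex.Im (g x) +
    complex.Im (f x) * complex.Re (g x))).
  by apply: (@cvgD _ R^o); apply: cvgM; [exact: f1 | exact: g2 | exact: f2 | exact: g1].
by apply/funext => y; case: (f y) (g y) => [? ?] [? ?].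
Qed.

Lemma continuousC_real (h : T -> R) : continuous h -> continuousC (fun x => (h x)%:C).
Proof. by move=> ch; split=> //; exact: cst_continuous. Qed.

Lemma continuousC_sum (I : Type) (r : seq I) (f : I -> T -> C) :
  (forall i, continuousC (f i)) -> continuousC (fun x => \sum_(i <- r) f i x).
Proof.
move=> cf; elim: r => [|i r IH].
  have -> : (fun x : T => \sum_(i <- [::]) f i x) = (fun=> 0).
    by apply/funext => x; rewrite big_nil.
  exact: continuousC_cst.
have -> : (fun x : T => \sum_(j <- i :: r) f j x) = (fun x => f i x + \sum_(j <- r) f j x).
  by apply/funext => x; rewrite big_cons.
exact: continuousC_add.
Qed.

Lemma continuous_normc f : continuousC f -> continuous (fun x => normc (f x)).
Proof.
move=> [f1 f2] x.
rewrite (_ : (fun x => _) = (fun x => Num.sqrt (complex.Re (f x) * complex.Re (f x) +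
    complex.Im (f x) * complex.Im (f x)))); last first.
  by apply/funext => y; rewrite -!expr2; case: (f y).
apply: continuous_comp; last exact: sqrt_continuous.
by apply: (@cvgD _ R^o); apply: cvgM; [exact: f1 | exact: f1 | exact: f2 | exact: f2].
Qed.

End ComplexContinuity.

Section LoopClasses.
Variables (R : realType) (n : nat).
Local Notation C := R[i].
Local Notation conf := (conf R n).
Local Notation I01 := (@unit_interval R).
Implicit Types (g : aff R) (z w p : conf) (gamma delta : R -> C).

(** Tested on maps from every topological space, subspaces included, so that it applies directly to
    functions continuous within a set. *)
Definition continuous_map (psi : C -> C) : Prop :=
  forall (T : topologicalType) (f : T -> C), continuousC f -> continuousC (psi \o f).

Lemma ccontinuous_map psi (T : topologicalType) (A : set T) (f : T -> C) :
  continuous_map psi -> ccontinuous A f -> ccontinuous A (psi \o f).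
Proof. by move=> cpsi cf; exact: (cpsi (subspace A) f cf). Qed.

Lemma aff_continuous_map g : continuous_map (aff_map g).
Proof.
move=> T f cf; apply: continuousC_add; last exact: continuousC_cst.
by apply: continuousC_mul => //; exact: continuousC_cst.
Qed.

Lemma unit_interval0 : I01 0.
Proof. by rewrite /unit_interval /= lexx ler01. Qed.

Lemma unit_interval1 : I01 1.
Proof. by rewrite /unit_interval /= lexx ler01. Qed.

Lemma curve_class_loop z gamma (h : is_loop z gamma) :
  curve_class z gamma = << (\pi_(homotopy_class z) (Loop h)) >>.
Proof.
rewrite /curve_class; case: pselect => // h'.
by rewrite (Prop_irrelevance h' h).
Qed.

Lemma homotopic_class z gamma delta H : is_loop z gamma -> is_loop z delta ->
  free_homotopy z gamma delta H -> curve_class z gamma = curve_class z delta.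
Proof.
move=> lg ld h; rewrite (curve_class_loop lg) (curve_class_loop ld).
congr (<< _ >>); apply/eqmodP/asboolP; by exists H.
Qed.

Lemma eq_is_loop z gamma delta : (forall t, I01 t -> gamma t = delta t) ->
  is_loop z gamma -> is_loop z delta.
Proof.
move=> e [[cg e01] gz]; split=> [|t i It]; last by rewrite -e // gz.
split; first exact: ccontinuous_eq e cg.
by rewrite -!e //; [exact: unit_interval1 | exact: unit_interval0].
Qed.

Lemma curve_square gamma : ccontinuous I01 gamma ->
  ccontinuous (@unit_square R) (fun x => gamma x.2).
Proof.
move=> cg; apply: (ccontinuous_comp _ _ cg) => [x|x [_ //]]; exact: cvg_snd.
Qed.

Lemma eq_curve_class z gamma delta : (forall t, I01 t -> gamma t = delta t) ->
  curve_class z gamma = curve_class z delta.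
Proof.
move=> e; have [lg|lg] := pselect (is_loop z gamma); last first.
  rewrite /curve_class; case: pselect => // _; case: pselect => // ld.
  by case: lg; apply: eq_is_loop ld => t It; rewrite e.
have ld := eq_is_loop e lg; apply: (homotopic_class (H := fun x => gamma x.2)) => //.
have [[cg e01] gz] := lg; split=> //; first exact: curve_square.
by move=> [s t] i [_ /=]; exact: gz.
Qed.

Lemma straight_line_class z gamma delta : closed_curve gamma -> closed_curve delta ->
  (forall s t i, I01 s -> I01 t -> (1 - s)%:C * gamma t + s%:C * delta t != z i) ->
  curve_class z gamma = curve_class z delta.
Proof.
move=> [cg eg] [cd ed] h.
have lg : is_loop z gamma.
  split=> // t i It; have := h 0 t i unit_interval0 It.
  by rewrite subr0 mul1r mul0r addr0.
have ld : is_loop z delta.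
  split=> // t i It; have := h 1 t i unit_interval1 It.
  by rewrite subrr mul1r mul0r add0r.
apply: (homotopic_class lg ld (H := fun x => (1 - x.1)%:C * gamma x.2 + x.1%:C * delta x.2)).
split.
- have c1 : continuous ((fun x : R * R => x.1) : subspace (@unit_square R) -> R).
    by apply: continuous_subspaceT => x; exact: cvg_fst.
  have c2 : continuous ((fun x : R * R => 1 - x.1) : subspace (@unit_square R) -> R).
    by move=> x; apply: (@cvgB _ R^o); [exact: cvg_cst | exact: c1].
  have Sg := curve_square cg; have Sd := curve_square cd.
  apply: (@continuousC_add R (subspace (@unit_square R))).
    by apply: (@continuousC_mul R (subspace (@unit_square R))) => //; exact: continuousC_real.
  by apply: (@continuousC_mul R (subspace (@unit_square R))) => //; exact: continuousC_real.
- by move=> [s t] i [Is It] /=; exact: h.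
- by move=> t It /=; rewrite subr0 mul1r mul0r addr0.
- by move=> t It /=; rewrite subrr mul1r mul0r add0r.
- by move=> s Is /=; rewrite eg ed.
Qed.

Lemma normc_ge0 (x : C) : 0 <= normc x.
Proof. by case: x => a b; exact: sqrtr_ge0. Qed.

Lemma normc_triangle (x y : C) : normc (x + y) <= normc x + normc y.
Proof. exact: le_normcD. Qed.

Lemma normc_real (x : R) : 0 <= x -> normc x%:C = x.
Proof. by move=> x0; rewrite /= expr0n addr0 sqrtr_sqr ger0_norm. Qed.

Lemma normc_gt0 (x : C) : x != 0 -> 0 < normc x.
Proof.
by move=> x0; rewrite lt_neqAle normc_ge0 andbT eq_sym; apply: contra_neq x0; exact: eq0_normc.
Qed.

Lemma normc_sub (x y : C) : normc (x - y) = normc (y - x).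
Proof. by rewrite -opprB; exact: normcN. Qed.

(** The leash argument: a puncture met by the straight-line homotopy at (s, t) would lie at distance
    s |gamma t - delta t| from gamma t, which is at most |delta t - gamma t|. *)
Lemma close_curves_class z gamma delta : closed_curve gamma -> closed_curve delta ->
  (forall t i, I01 t -> normc (delta t - gamma t) < normc (gamma t - z i)) ->
  curve_class z gamma = curve_class z delta.
Proof.
move=> cg cd h; apply: straight_line_class => // s t i Is It.
apply/eqP => e; have := h t i It; apply/negP; rewrite -leNgt.
rewrite -e (_ : gamma t - _ = s%:C * (gamma t - delta t)); last first.
  by rewrite rmorphB /=; ring.
have [s0 s1] := andP Is.
by rewrite normcM normc_real // normc_sub ler_piMl // normc_ge0.
Qed.

Lemma liftU1 (K : choiceType) (M : lmodType C) (f : K -> M) k : fglift f << k >> = f k.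
Proof. by rewrite liftU scale1r. Qed.

Lemma repr_loop_homotopic z gamma (h : is_loop z gamma) :
  exists H, free_homotopy z (repr (\pi_(homotopy_class z) (Loop h))) gamma H.
Proof.
have e : \pi_(homotopy_class z) (repr (\pi_(homotopy_class z) (Loop h))) =
   \pi_(homotopy_class z) (Loop h) by rewrite reprK.
by move/eqmodP/asboolP: e.
Qed.

Section Push.
Variables (w p : conf) (psi : C -> C).
Hypothesis cpsi : continuous_map psi.
Hypothesis psi_avoid : forall x, (forall i, x != w i) -> forall i, psi x != p i.

Lemma push_loop gamma : is_loop w gamma -> is_loop p (psi \o gamma).
Proof.
move=> [[cg e] gw]; split=> [|t i It]; last by apply: psi_avoid => j; exact: gw.
by split; [exact: ccontinuous_map | rewrite /= e].
Qed.

Lemma push_homotopy gamma delta H : free_homotopy w gamma delta H ->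
  free_homotopy p (psi \o gamma) (psi \o delta) (psi \o H).
Proof.
move=> [cH Hw H0 H1 He]; split.
- exact: ccontinuous_map.
- by move=> x i Ux; apply: psi_avoid => j; exact: Hw.
- by move=> t It /=; rewrite H0.
- by move=> t It /=; rewrite H1.
- by move=> s Is /=; rewrite He.
Qed.

(** Defined on the chosen representative of each class; [push_homotopy] makes the choice
    harmless. *)
Definition push : loop_space w -> loop_space p :=
  fglift (fun c : homotopy_class w => curve_class p (psi \o repr c)).

Lemma push_linear : linear push.
Proof. exact: fglift_linear. Qed.

Lemma push_class gamma : is_loop w gamma ->
  push (curve_class w gamma) = curve_class p (psi \o gamma).
Proof.
move=> lg; rewrite (curve_class_loop lg) /push liftU1.
have [H hH] := repr_loop_homotopic lg.
apply: (homotopic_class _ _ (push_homotopy hH)); apply: push_loop => //.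
exact: curveP.
Qed.

End Push.

Lemma aff_inv_neq0 g : (aff_a g)^-1 != 0.
Proof. by rewrite invr_eq0 aff_neq0. Qed.

Definition aff_inv g : aff R := Aff (- ((aff_a g)^-1 * aff_b g)) (aff_inv_neq0 g).

Lemma aff_mapK g : cancel (aff_map g) (aff_map (aff_inv g)).
Proof. by move=> x; rewrite /aff_map /=; field; rewrite aff_neq0. Qed.

Lemma aff_mapVK g : cancel (aff_map (aff_inv g)) (aff_map g).
Proof. by move=> x; rewrite /aff_map /=; field; rewrite aff_neq0. Qed.

Lemma is_loop_act g z gamma : is_loop (conf_act g z) (aff_map g \o gamma) <-> is_loop z gamma.
Proof.
split; last first.
  apply: push_loop; first exact: aff_continuous_map.
  by move=> x h i; rewrite /= (inj_eq (@aff_map_inj _ g)).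
move=> l; suff : is_loop z (aff_map (aff_inv g) \o (aff_map g \o gamma)).
  by apply: eq_is_loop => t _; exact: aff_mapK.
apply: push_loop l; first exact: aff_continuous_map.
move=> x h i; have := h i; apply: contraNN => /eqP e.
by rewrite /= -e aff_mapVK.
Qed.

(** Valid for every curve: if [gamma] is not a loop for [z], its image is not one for the moved
    configuration, and both classes take the default value 0. *)
Lemma act_curve_class g z gamma :
  loop_space_act g (curve_class z gamma) = curve_class (conf_act g z) (aff_map g \o gamma).
Proof.
have [lg|lg] := pselect (is_loop z gamma); last first.
  have e0 : curve_class z gamma = 0 by rewrite /curve_class; case: pselect.
  rewrite e0 linear0 /curve_class; case: pselect => // h.
  by case: lg; exact: (is_loop_act g z gamma).1 h.
have lg' := (is_loop_act g z gamma).2 lg.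
rewrite (curve_class_loop lg) (curve_class_loop lg') /loop_space_act liftU1 /class_act.
congr (<< _ >>); apply/eqmodP/asboolP.
have [H hH] := repr_loop_homotopic lg.
exists (aff_map g \o H); apply: push_homotopy hH; first exact: aff_continuous_map.
by move=> x h i; rewrite /= (inj_eq (@aff_map_inj _ g)) h.
Qed.

Lemma loop_space_span z (x : loop_space z) : exists m (a : 'I_m -> C) (gamma : 'I_m -> R -> C),
  (forall k, is_loop z (gamma k)) /\ x = \sum_(k < m) a k *: curve_class z (gamma k).
Proof.
pose s := dom x; have [k0|/negP s0] := pselect (size s == 0)%N.
  exists 0%N, (fun=> 0), (fun _ _ => 0); split; first by case.
  by rewrite big_ord0 -[x]freeg_sumE -/s; move: k0 => /nilP ->; rewrite big_nil.
have : (0 < size s)%N by rewrite lt0n.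
case E : s => [//|c0 s'] _.
exists (size s), (fun k => coeff (nth c0 s k) x), (fun k => repr (nth c0 s k)); split.
  by move=> k; exact: curveP.
rewrite -{1}[x]freeg_sumE -/s (big_nth c0) big_mkord; apply: eq_bigr => k _.
rewrite (curve_class_loop (curveP _)).
set l := Loop _; have -> : l = repr (nth c0 s k) by case: (repr _) @l.
by rewrite reprK; apply/eqP/freeg_eqP => c; rewrite coeffZ !coeffU mul1r.
Qed.

Lemma coeff_sum z (I : Type) (r : seq I) (a : I -> C) (x : I -> loop_space z) c :
  coeff c (\sum_(k <- r) a k *: x k) = \sum_(k <- r) a k * coeff c (x k).
Proof.
elim: r => [|k r IH]; first by rewrite !big_nil coeff0.
by rewrite !big_cons coeffD IH coeffZ.
Qed.

Lemma loop_space_ext z (x y : loop_space z) : (forall c, coeff c x = coeff c y) -> x = y.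
Proof. by move=> h; apply/eqP/freeg_eqP. Qed.

End LoopClasses.

(** * Transport of loop classes between nearby configurations *)

Section Transport.
Variables (R : realType) (n : nat).
Local Notation C := R[i].
Local Notation conf := (conf R n).
Local Notation I01 := (@unit_interval R).
Implicit Types (z w p : conf) (gamma delta : R -> C).

Lemma uniform_radius (I : finType) (P : I -> R -> Prop) :
  (forall i (e e' : R), 0 < e' -> e' <= e -> P i e -> P i e') ->
  (forall i, exists e, 0 < e /\ P i e) -> exists e, 0 < e /\ forall i, P i e.
Proof.
move=> mono h.
suff [e [e0 he]] : exists e, 0 < e /\ forall i, i \in enum I -> P i e.
  by exists e; split=> // i; apply: he; rewrite mem_enum.
elim: (enum I) => [|i s [e [e0 he]]]; first by exists 1; split.
have [e' [e'0 he']] := h i; exists (Num.min e e'); split.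
  by rewrite lt_min e0 e'0.
have m0 : 0 < Num.min e e' by rewrite lt_min e0 e'0.
move=> j; rewrite in_cons => /orP[/eqP ->|js].
  by apply: mono he' => //; rewrite ge_min lexx orbT.
by apply: mono (he j js) => //; rewrite ge_min lexx.
Qed.

Lemma loop_distance z gamma : is_loop z gamma ->
  exists r, 0 < r /\ forall i t, I01 t -> r <= normc (gamma t - z i).
Proof.
move=> [[cg _] gz]; apply: uniform_radius => [i e e' e'0 ee' h t It|i].
  exact: le_trans ee' (h t It).
have I01E : I01 = `[0, 1]%classic by apply/seteqP; split=> t /=; rewrite in_itv.
have cn : {within `[0, 1]%classic, continuous (fun t => normc (gamma t - z i))}.
  rewrite -I01E; apply: (@continuous_normc R (subspace I01)).
  by apply: continuousC_add => //; exact: continuousC_cst.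
have [c c01 hc] := EVT_min ler01 cn.
exists (normc (gamma c - z i)); split.
  apply: normc_gt0; rewrite subr_eq0; apply: gz.
  by rewrite /unit_interval /=; move: c01; rewrite in_itv.
by move=> t It; apply: hc; rewrite in_itv.
Qed.

Lemma normc_lipschitz (x y : C) : `|normc x - normc y| <= normc (x - y).
Proof.
have := normc_triangle (x - y) y; have := normc_triangle (y - x) x.
by rewrite !subrK (normc_sub y) ler_norml => h1 h2; apply/andP; split; lra.
Qed.

Lemma normc_sum (I : Type) (s : seq I) (f : I -> C) :
  normc (\sum_(i <- s) f i) <= \sum_(i <- s) normc (f i).
Proof.
elim: s => [|i s IH]; first by rewrite !big_nil normc0.
by rewrite !big_cons (le_trans (normc_triangle _ _)) // lerD2l.
Qed.

Section Bump.
Variable rho : R.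
Hypothesis rho0 : 0 < rho.

(** A tent function: continuity is all that homotopies ask for, and its Lipschitz constant 1 / rho
    controls the perturbation built from it. *)
Definition bump (a : R) : R := Num.max 0 (1 - a / rho).

Lemma bump0 : bump 0 = 1.
Proof. by rewrite /bump mul0r subr0 max_r // ler01. Qed.

Lemma bump_out a : rho <= a -> bump a = 0.
Proof. by move=> ra; rewrite /bump max_l // subr_le0 ler_pdivlMr // mul1r. Qed.

Lemma bump_lipschitz a b : `|bump a - bump b| <= `|a - b| / rho.
Proof.
have max_lip (x y : R) : `|Num.max 0 x - Num.max 0 y| <= `|x - y|.
  have [x0|x0] := leP 0 x; have [y0|y0] := leP 0 y; rewrite ?subrr ?normr0 //.
  - by rewrite subr0 ger0_norm // (le_trans _ (ler_norm _)) //; lra.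
  - by rewrite sub0r normrN ger0_norm // distrC (le_trans _ (ler_norm _)) //; lra.
apply: le_trans (max_lip _ _) _.
rewrite (_ : 1 - _ - _ = (b - a) / rho); last by ring.
by rewrite normrM distrC [X in _ * X]gtr0_norm // invr_gt0.
Qed.

Lemma bump_continuous (T : topologicalType) (h : T -> R) : continuous h ->
  continuous (fun x => bump (h x)).
Proof.
move=> ch x; apply/cvgrPdist_lt => e e0.
have er : 0 < e * rho by rewrite mulr_gt0.
have /cvgrPdist_lt/(_ _ er) := ch x.
apply: filterS => y hy; apply: le_lt_trans (bump_lipschitz _ _) _.
by rewrite ltr_pdivrMr.
Qed.

Variables (p w : conf).

(* A perturbation of the identity moving w_i to p_i and supported near the w_i. *)
Definition move_points (x : C) : C :=
  x + \sum_(i < n) (bump (normc (x - w i)))%:C * (p i - w i).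

Lemma move_points_continuous : continuous_map move_points.
Proof.
move=> T f cf; apply: continuousC_add => //; apply: continuousC_sum => i.
apply: continuousC_mul; last exact: continuousC_cst.
apply: continuousC_real; apply: bump_continuous; apply: continuous_normc.
by apply: continuousC_add => //; exact: continuousC_cst.
Qed.

Lemma move_points_id x : (forall i, rho <= normc (x - w i)) -> move_points x = x.
Proof.
move=> h; rewrite /move_points big1 ?addr0 // => i _.
by rewrite bump_out // mul0r.
Qed.

Hypothesis w_sep : forall i j, i != j -> rho <= normc (w j - w i).

Lemma move_points_w j : move_points (w j) = p j.
Proof.
rewrite /move_points (bigD1 j) //= subrr normc0 bump0 mul1r big1 ?addr0.
  by rewrite addrC subrK.
by move=> i ij; rewrite bump_out ?mul0r // w_sep.
Qed.

Hypothesis close : forall i, normc (p i - w i) <= rho / n.+1%:R.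

(** The displacement is a sum of n terms, each with Lipschitz constant (1 / rho) (rho / (n + 1)). If
    x and w_j had the same image, then |x - w_j| <= n / (n + 1) |x - w_j|, which forces x = w_j. *)
Lemma move_points_avoid x : (forall i, x != w i) -> forall j, move_points x != p j.
Proof.
move=> xw j; apply/eqP => e; have : normc (x - w j) <= n%:R / n.+1%:R * normc (x - w j).
  have {e} : move_points x = move_points (w j) by rewrite move_points_w.
  move/eqP; rewrite /move_points -subr_eq0 opprD addrACA -sumrB addr_eq0 => /eqP ex.
  rewrite {1}ex [X in X <= _]normcN; apply: le_trans (normc_sum _ _) _.
  have -> : n%:R / n.+1%:R * normc (x - w j) =
      \sum_(i < n) (normc (x - w j) / n.+1%:R).
    by rewrite sumr_const card_ord -[RHS]mulr_natl; ring.
  apply: ler_sum => i _; rewrite -mulrBl -rmorphB normcM.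
  have -> : normc (x - w j) / n.+1%:R = (normc (x - w j) / rho) * (rho / n.+1%:R).
    by rewrite [RHS]mulrA divfK // gt_eqF.
  apply: ler_pM => //; [exact: normc_ge0 | exact: normc_ge0 |].
  rewrite /= expr0n addr0 sqrtr_sqr; apply: le_trans (bump_lipschitz _ _) _.
  rewrite ler_pM2r ?invr_gt0 //; apply: le_trans (normc_lipschitz _ _) _.
  by rewrite (_ : x - w i - _ = x - w j) //; ring.
have d0 : 0 < normc (x - w j) by apply: normc_gt0; rewrite subr_eq0.
apply/negP; rewrite -ltNge -[X in _ < X]mul1r ltr_pM2r //.
by rewrite ltr_pdivrMr ?ltr0n // mul1r ltr_nat.
Qed.

End Bump.

Lemma conf_distance z : exists r, 0 < r /\ forall i j, i != j -> r <= normc (z i - z j).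
Proof.
have [r [r0 hr]] : exists r, 0 < r /\ forall ij : 'I_n * 'I_n,
    ij.1 != ij.2 -> r <= normc (z ij.1 - z ij.2).
  apply: uniform_radius => [ij e e' e'0 ee' h /h|[i j]]; first exact: le_trans.
  have [-> /=|ij] := eqVneq i j; first by exists 1; split=> //; rewrite eqxx.
  exists (normc (z i - z j)); split=> //=.
  by apply: normc_gt0; rewrite subr_eq0 (inj_eq (@pts_inj _ _ z)).
by exists r; split=> // i j ij; exact: (hr (i, j)).
Qed.

Lemma loop_near z gamma : is_loop z gamma ->
  near_pt (z : conf_space R n) (fun w => is_loop w gamma).
Proof.
move=> lg; have [r [r0 hr]] := loop_distance lg.
exists (conf_ball z r); split; [exact: conf_ball_open | exact: conf_ball_center |].
move=> w wz; have [cg _] := lg; split=> // t i It.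
by apply: contraTN (hr i t It) => /eqP ->; rewrite -ltNge.
Qed.

Lemma transport p (I : finType) (gamma : I -> R -> C) : (forall k, is_loop p (gamma k)) ->
  near_pt (p : conf_space R n) (fun w => exists phi : loop_space w -> loop_space p,
     linear phi /\ forall k, phi (curve_class w (gamma k)) = curve_class p (gamma k)).
Proof.
move=> lg.
have [r1 [r10 h1]] := conf_distance p.
have [r2 [r20 h2]] : exists r, 0 < r /\
    forall k i t, I01 t -> r <= normc (gamma k t - p i).
  apply: uniform_radius => [k e e' e'0 ee' h i t It|k]; last exact: loop_distance.
  exact: le_trans ee' (h i t It).
pose r := Num.min r1 r2.
have r0 : 0 < r by rewrite lt_min r10.
have {}h1 i j : i != j -> r <= normc (p i - p j).
  by move=> ij; apply: le_trans (h1 i j ij); rewrite ge_min lexx.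
have {}h2 k i t : I01 t -> r <= normc (gamma k t - p i).
  by move=> It; apply: le_trans (h2 k i t It); rewrite ge_min lexx orbT.
(* One half of r is the radius of the bumps, the other absorbs the motion of the points. The divisor
   n + 2 in d gives both 2 d <= rho, used for the distances to the w_j, and d <= rho / (n + 1), the
   bound on the displacements. *)
pose rho := r / 2; have rho0 : 0 < rho by rewrite divr_gt0.
pose d := rho / n.+2%:R.
have d0 : 0 < d by rewrite divr_gt0 // ltr0n.
have d2 : 2 * d <= rho.
  rewrite /d mulrCA ler_piMr ?(ltW rho0) //.
  by rewrite ler_pdivrMr ?ltr0n // mul1r ler_nat.
have rE : r = rho + rho by rewrite /rho; lra.
have near w j : normc (w j - p j) < d -> forall x : C,
    r <= normc (x - p j) -> rho + d <= normc (x - w j).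
  move=> wj x hx; have := normc_triangle (x - w j) (w j - p j).
  by rewrite subrKA; lra.
exists (conf_ball p d); split; [exact: conf_ball_open | exact: conf_ball_center |].
move=> w wp.
have sep i j : i != j -> rho <= normc (w j - w i).
  move=> ij; have hp : r <= normc (p j - p i) by apply: h1; rewrite eq_sym.
  have hw : rho + d <= normc (p j - w i) by exact: near.
  have := normc_triangle (p j - w j) (w j - w i); rewrite subrKA normc_sub.
  by have := wp j; lra.
have cl i : normc (p i - w i) <= rho / n.+1%:R.
  rewrite normc_sub; apply: le_trans (ltW (wp i)) _.
  by rewrite /d ler_pM2l // lef_pV2 ?posrE ?ltr0n // ler_nat.
have av := move_points_avoid rho0 sep cl.
have cm := move_points_continuous rho0 p w.
exists (@push R n w p (move_points rho p w)); split; first exact: push_linear.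
move=> k.
have lw : is_loop w (gamma k).
  have [cg _] := lg k; split=> // t i It; rewrite -subr_eq0; apply/eqP => e0.
  have := near w i (wp i) _ (h2 k i t It); rewrite e0 normc0; lra.
rewrite push_class //; apply: eq_curve_class => t It /=.
apply: move_points_id => // i.
by apply: le_trans (near w i (wp i) _ (h2 k i t It)); rewrite lerDl ltW.
Qed.

End Transport.

(** * Connections on bundles of loop classes *)

Section LoopConnection.
Variables (R : realType) (n : nat).
Local Notation C := R[i].
Local Notation conf := (conf R n).
Variables (X : smooth_space R) (hX : function_sheaf X) (E : bundle X).
Variable tau : X -> conf.
Hypothesis tau_open : forall U : set conf, conf_open U -> is_open (tau @^-1` U).
Variables (val : forall q : X, E q -> loop_space (tau q))
  (unval : forall q : X, loop_space (tau q) -> E q).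
Hypothesis val_linear : forall q (a : C) (x y : E q), val (a *: x + y) = a *: val x + val y.
Hypothesis valK : forall q, cancel (@val q) (@unval q).
Hypothesis unvalK : forall q, cancel (@unval q) (@val q).

(** A form of [local_expression] without the radius, which the compactness of the curves provides,
    and for any space over Conf_n through [tau]. *)
Definition loop_expr (p : X) (s : forall q, E q) m (f : 'I_m -> X -> C)
    (gamma : 'I_m -> R -> C) : Prop :=
  [/\ forall k, is_loop (tau p) (gamma k),
      forall k, smooth_near p (f k)
    & near_pt p (fun q => val (s q) = \sum_(k < m) f k q *: curve_class (tau q) (gamma k))].

Hypothesis section_expr : forall (U : set X) s, is_open U ->
  @smooth_section R X E U s <-> forall p, U p -> exists m f gamma, @loop_expr p s m f gamma.

Definition loop_conn : covariant_derivative E := fun p v s =>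
  unval (xget 0 [set h : loop_space (tau p) | exists m f gamma,
    @loop_expr p s m f gamma /\ h = \sum_(k < m) v (f k) *: curve_class (tau p) (gamma k)]).

Lemma near_tau p P : near_pt (tau p : conf_space R n) P -> near_pt p (fun q => P (tau q)).
Proof.
move=> [U [oU Up h]]; exists (tau @^-1` U); split=> //; first exact: tau_open.
by move=> q; exact: h.
Qed.

Lemma loop_expr_near p s m f gamma : @loop_expr p s m f gamma ->
  near_pt p (fun q => @loop_expr q s m f gamma).
Proof.
move=> [lg sf e].
have n1 := near_pt_forall hX (fun k => near_tau (loop_near (lg k))).
have n2 := near_pt_forall hX (fun k => smooth_near_near (sf k)).
apply: near_ptW (near_ptI hX n1 (near_ptI hX n2 (near_pt_near e))).
by move=> q [h1 [h2 h3]]; split.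
Qed.

(** Free homotopy classes over p are a basis, so coefficients can be compared there. Transport to p
    turns the equality of two expressions over each nearby q into an equality of functions near p,
    which v can differentiate. *)
Lemma loop_expr_unique p v s t m f gamma m' f' gamma' : is_tangent p v ->
  @loop_expr p s m f gamma -> @loop_expr p t m' f' gamma' ->
  near_pt p (fun q => s q = t q) ->
  \sum_(k < m) v (f k) *: curve_class (tau p) (gamma k) =
  \sum_(k < m') v (f' k) *: curve_class (tau p) (gamma' k).
Proof.
move=> tv [lg sf e] [lg' sf' e'] st; apply: loop_space_ext => c.
rewrite !coeff_sum.
pose g (k : 'I_m + 'I_m') := match k with inl k => gamma k | inr k => gamma' k end.
have lG k : is_loop (tau p) (g k) by case: k => k; [exact: lg | exact: lg'].
pose a k := coeff c (curve_class (tau p) (gamma k)).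
pose a' k := coeff c (curve_class (tau p) (gamma' k)).
have sfa k : smooth_near p (fun q => a k * f k q).
  by apply: smooth_near_mul => //; exact: smooth_near_cst.
have sfa' k : smooth_near p (fun q => a' k * f' k q).
  by apply: smooth_near_mul => //; exact: smooth_near_cst.
have : v (fun q => \sum_(k < m) a k * f k q) = v (fun q => \sum_(k < m') a' k * f' k q).
  apply: (tangent_ext tv); [exact: smooth_near_sum | exact: smooth_near_sum |].
  (* The curves of both expressions are transported together: the same linear map has to act on the
     two sides. *)
  have nt := near_tau (transport lG).
  apply: near_ptW (near_ptI hX nt (near_ptI hX st (near_ptI hX e e'))).
  move=> q [[phi [lphi phig]] [stq [eq e'q]]].
  pose F : {linear loop_space (tau q) -> loop_space (tau p)} :=
    HB.pack phi (GRing.isLinear.Build C _ _ _ phi lphi).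
  have : coeff c (F (\sum_(k < m) f k q *: curve_class (tau q) (gamma k))) =
         coeff c (F (\sum_(k < m') f' k q *: curve_class (tau q) (gamma' k))).
    by rewrite -eq -e'q stq.
  rewrite !linear_sum.
  rewrite (eq_bigr (fun k => f k q *: curve_class (tau p) (gamma k))); last first.
    by move=> k _; rewrite linearZ /=; congr (_ *: _); exact: (phig (inl k)).
  rewrite [in RHS](eq_bigr (fun k => f' k q *: curve_class (tau p) (gamma' k))); last first.
    by move=> k _; rewrite linearZ /=; congr (_ *: _); exact: (phig (inr k)).
  rewrite !coeff_sum => h.
  by under eq_bigr do rewrite mulrC; under [RHS]eq_bigr do rewrite mulrC.
rewrite !(tangent_sum hX tv) // => h.
transitivity (\sum_(k < m) v (fun q => a k * f k q)).
  by apply: eq_bigr => k _; rewrite (tangent_scale hX tv) // mulrC.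
by rewrite h; apply: eq_bigr => k _; rewrite (tangent_scale hX tv) // mulrC.
Qed.

Lemma loop_connE p v s m f gamma : is_tangent p v -> @loop_expr p s m f gamma ->
  val (loop_conn p v s) = \sum_(k < m) v (f k) *: curve_class (tau p) (gamma k).
Proof.
move=> tv h; rewrite /loop_conn unvalK; apply: xget_unique => [|x [m' [f' [g' [h' ->]]]]].
  by exists m, f, gamma.
by apply: loop_expr_unique h' h _ => //; exact: near_ptT.
Qed.

Lemma eq_loop_expr p s t m f gamma : near_pt p (fun q => s q = t q) ->
  @loop_expr p s m f gamma -> @loop_expr p t m f gamma.
Proof.
move=> st [lg sf e]; split=> //.
by apply: near_ptW (near_ptI hX st e) => q [<-].
Qed.

Lemma section_near_expr p s : section_near p s -> exists m f gamma, @loop_expr p s m f gamma.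
Proof. by move=> [U [oU Up /(section_expr _ oU)]]; apply. Qed.

Lemma expr_section_near p s m f gamma : @loop_expr p s m f gamma -> section_near p s.
Proof.
move=> /loop_expr_near[U [oU Up h]]; exists U; split=> //.
by apply/(section_expr _ oU) => q Uq; exists m, f, gamma; exact: h.
Qed.

Lemma loop_val0 q : val (0 : E q) = 0.
Proof.
apply: (addrI (val (0 : E q))); rewrite addr0.
by rewrite -{1}[val 0]scale1r -val_linear scaler0 addr0.
Qed.

Lemma loop_val_add q (x y : E q) : val (x + y) = val x + val y.
Proof. by rewrite -[val x]scale1r -val_linear scale1r. Qed.

Lemma loop_val_scale q a (x : E q) : val (a *: x) = a *: val x.
Proof. by rewrite -[a *: x]addr0 val_linear loop_val0 addr0. Qed.

Definition case_ord (T : Type) m m' (f : 'I_m -> T) (g : 'I_m' -> T) (k : 'I_(m + m')) : T :=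
  match fintype.split k with inl i => f i | inr j => g j end.

Lemma case_ordl T m m' (f : 'I_m -> T) (g : 'I_m' -> T) k : case_ord f g (lshift m' k) = f k.
Proof. by rewrite /case_ord (unsplitK (inl k)). Qed.

Lemma case_ordr T m m' (f : 'I_m -> T) (g : 'I_m' -> T) k : case_ord f g (rshift m k) = g k.
Proof. by rewrite /case_ord (unsplitK (inr k)). Qed.

Lemma loop_expr_add p s t m f gamma m' f' gamma' :
  @loop_expr p s m f gamma -> @loop_expr p t m' f' gamma' ->
  @loop_expr p (fun q => s q + t q) (m + m') (case_ord f f') (case_ord gamma gamma').
Proof.
move=> [lg sf e] [lg' sf' e']; split.
- by move=> k; rewrite /case_ord; case: (fintype.split k) => i; [exact: lg | exact: lg'].
- by move=> k; rewrite /case_ord; case: (fintype.split k) => i; [exact: sf | exact: sf'].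
- apply: near_ptW (near_ptI hX e e') => q [h h'].
  rewrite loop_val_add h h' big_split_ord; congr (_ + _); apply: eq_bigr => k _.
    by rewrite !case_ordl.
  by rewrite !case_ordr.
Qed.

Lemma loop_expr_scale p g s m f gamma : smooth_near p g ->
  @loop_expr p s m f gamma ->
  @loop_expr p (fun q => g q *: s q) m (fun k q => g q * f k q) gamma.
Proof.
move=> sg [lg sf e]; split=> //; first by move=> k; exact: smooth_near_mul.
apply: near_ptW e => q h; rewrite loop_val_scale h scaler_sumr.
by apply: eq_bigr => k _; rewrite scalerA.
Qed.

(** The derivative keeps the curves and differentiates the coefficients, so curvature reduces to the
    definition of the bracket on each coefficient. *)
Lemma loop_expr_conn (U : set X) V p s m f gamma : is_open U -> is_vector_field U V -> U p ->
  @loop_expr p s m f gamma ->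
  @loop_expr p (fun q => loop_conn q (V q) s) m (fun k q => V q (f k)) gamma.
Proof.
move=> oU hV Up h; have [lg sf _] := h; split=> //.
  by move=> k; exact: vector_field_smooth_near hV Up (sf k).
apply: near_ptW (near_ptI hX (near_pt_open oU Up) (loop_expr_near h)) => q [Uq hq].
by rewrite (loop_connE _ hq) //; case: hV => tV _; exact: tV.
Qed.

Lemma loop_conn_flat : flat_connection loop_conn.
Proof.
have val_inj q : injective (@val q) := can_inj (@valK q).
split; first split.
- move=> p v w s tv tw /section_near_expr[m [f [g h]]] vw; apply: val_inj.
  rewrite (loop_connE tv h) (loop_connE tw h); apply: eq_bigr => k _.
  by rewrite vw //; case: h.
- move=> p v s t tv /section_near_expr[m [f [g h]]] _ st; apply: val_inj.
  by rewrite (loop_connE tv h) (loop_connE tv (eq_loop_expr st h)).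
- move=> p c v w s tv tw /section_near_expr[m [f [g h]]]; apply: val_inj.
  have tvw := is_tangent_comb c tv tw.
  rewrite val_linear (loop_connE tv h) (loop_connE tw h) (loop_connE tvw h).
  rewrite scaler_sumr -big_split /=; apply: eq_bigr => k _.
  by rewrite scalerDl scalerA.
- move=> p v s t tv /section_near_expr[m [f [g h]]] /section_near_expr[m' [f' [g' h']]].
  apply: val_inj; rewrite loop_val_add (loop_connE tv h) (loop_connE tv h').
  rewrite (loop_connE tv (loop_expr_add h h')) big_split_ord.
  congr (_ + _); apply: eq_bigr => k _; first by rewrite !case_ordl.
  by rewrite !case_ordr.
- move=> p v f s tv sf /section_near_expr[m [a [g h]]]; apply: val_inj.
  rewrite loop_val_add !loop_val_scale (loop_connE tv h) (loop_connE tv (loop_expr_scale sf h)).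
  have [_ sa e] := h; rewrite (near_pt_singleton e) !scaler_sumr -big_split /=.
  apply: eq_bigr => k _.
  by rewrite (tangent_mul tv sf (sa k)) scalerDl !scalerA.
- move=> U V s oU hV ss; apply/(section_expr _ oU) => p Up.
  have [m [f [g h]]] := (section_expr s oU).1 ss p Up.
  by exists m, (fun k q => V q (f k)), g; exact: loop_expr_conn hV Up h.
move=> U V W s p oU hV hW ss Up.
have [m [f [g h]]] := (section_expr s oU).1 ss p Up.
have [[tV _] [tW _]] := (hV, hW).
have tVW := lie_bracket_tangent hX oU hV hW Up.
apply/eqP; rewrite subr_eq; apply/eqP; apply: val_inj; rewrite loop_val_add.
rewrite (loop_connE (tV p Up) (loop_expr_conn oU hW Up h)).
rewrite (loop_connE (tW p Up) (loop_expr_conn oU hV Up h)) (loop_connE tVW h).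
rewrite -big_split /=; apply: eq_bigr => k _.
by rewrite -scalerDl /lie_bracket subrK.
Qed.

End LoopConnection.

(** * Descent of G_n *)

Section LocalExpressions.
Variables (R : realType) (m : nat).
Local Notation n := m.+1.
Local Notation C := R[i].
Local Notation conf := (conf R n).
Local Notation GB := (G_bundle R n).
Local Notation I01 := (@unit_interval R).

Definition conf_expr (p : conf) (s : forall z : conf, loop_space z) k
    (f : 'I_k -> conf -> C) (gamma : 'I_k -> R -> C) : Prop :=
  @loop_expr R n (conf_space R n) GB (fun z => z) (fun _ x => x) p s k f gamma.

(** Conversely to forgetting the radius, the curves are compact and avoid the finitely many points
    of p, which leaves room for disks. *)
Lemma local_expressionP p s k f gamma :
  @local_expression R n p s k f gamma <-> @conf_expr p s k f gamma.
Proof.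
have nE (x : C) : `|x| = (normc x)%:C by [].
split.
  move=> [r [r0 rp cg gp [sf [U [oU Up h]]]]]; split=> //.
    move=> j; split=> // t i It; rewrite -subr_eq0; apply/eqP => e.
    by have := gp j t i It; rewrite e normr0 lecR leNgt r0.
  by exists U; split=> // q /h[].
move=> [lg sf e].
have [r1 [r10 h1]] := conf_distance p.
have [r2 [r20 h2]] : exists r, 0 < r /\
    forall j i t, I01 t -> r <= normc (gamma j t - p i).
  apply: uniform_radius => [j a a' a'0 aa' h i t It|j]; last exact: loop_distance.
  exact: le_trans aa' (h i t It).
(* The first bound makes the disks disjoint, the second keeps the curves outside them. *)
pose r := Num.min (r1 / 2) r2.
have r0 : 0 < r by rewrite lt_min r20 divr_gt0.
exists r; split=> //.
- move=> i j ij; rewrite nE lecR; apply: le_trans (h1 i j ij).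
  by rewrite mulrC -ler_pdivlMr // ge_min lexx.
- by move=> j; have [] := lg j.
- move=> j t i It; rewrite nE lecR; apply: le_trans (h2 j i t It).
  by rewrite ge_min lexx orbT.
split=> //; have hS := @conf_sheaf R m.
have nb : near_pt (p : conf_space R n) (conf_ball p r).
  by exists (conf_ball p r); split=> //; [exact: conf_ball_open | exact: conf_ball_center].
apply: near_ptW (near_ptI hS nb e) => w [wp hw]; split=> // i.
by rewrite nE ltcR.
Qed.

Lemma G_sectionP (U : set conf) s :
  G_section U s <-> forall p, U p -> exists k f gamma, @conf_expr p s k f gamma.
Proof.
by split=> h p Up; have [k [f [g hg]]] := h p Up; exists k, f, g; exact/local_expressionP.
Qed.

Lemma nabla_GE : @nabla_G R n =
  @loop_conn R n (conf_space R n) GB (fun z => z) (fun _ x => x) (fun _ x => x).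
Proof.
apply: functional_extensionality_dep => p; apply/funext => v; apply/funext => s.
rewrite /nabla_G /loop_conn; congr (xget 0 _); apply/seteqP.
by split=> h [k [f [g [hg e]]]]; exists k, f, g; split=> //; exact/local_expressionP.
Qed.

Lemma nabla_G_flat : flat_connection (@nabla_G R n).
Proof.
rewrite nabla_GE; apply: loop_conn_flat => //; first exact: conf_sheaf.
by move=> U s _; exact: G_sectionP.
Qed.

Lemma nabla_G_expr (p : conf) v s k f gamma : @is_tangent R (conf_space R n) p v ->
  @conf_expr p s k f gamma ->
  nabla_G p v s = \sum_(j < k) v (f j) *: curve_class p (gamma j).
Proof.
move=> tv h; rewrite nabla_GE.
exact: (@loop_connE R n (conf_space R n) (@conf_sheaf R m) GB (fun z => z)
  (fun _ oU => oU) (fun _ x => x) (fun _ x => x) (fun _ _ => erefl) p v s k f gamma tv h).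
Qed.

End LocalExpressions.

(** * Loops around a single puncture *)

Section OnePuncture.
Variable R : realType.
Local Notation C := R[i].

(** The homotopy multiplies gamma - w_0 by (1 - s) + s b. If this factor vanished, its real part
    would force s = 1, and then b = 0. *)
Lemma scale_class_half (w : conf R 1) (b : C) gamma : b != 0 -> 0 <= complex.Re b ->
  is_loop w gamma ->
  curve_class w gamma = curve_class w (fun t => w ord0 + b * (gamma t - w ord0)).
Proof.
move=> b0 rb [cg gw]; apply: straight_line_class => //.
  have -> : (fun t => w ord0 + b * (gamma t - w ord0)) =
      aff_map (Aff (w ord0 - b * w ord0) b0) \o gamma.
    by apply/funext => t; rewrite /= /aff_map /=; ring.
  have [c e] := cg; split; last by rewrite /= e.
  by apply: ccontinuous_map => //; exact: aff_continuous_map.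
move=> s t i Is It; rewrite (ord1 i); have := gw t ord0 It; rewrite -subr_eq0 => g0.
rewrite -subr_eq0 (_ : _ - w ord0 = ((1 - s)%:C + s%:C * b) * (gamma t - w ord0)); last first.
  by rewrite rmorphB /=; ring.
rewrite mulf_neq0 //; apply/eqP => e; have [s0 s1] := andP Is.
have re : (1 - s) + s * complex.Re b = 0.
  have := congr1 (@complex.Re R) e; case: (b) => b1 b2 /=.
  by rewrite mul0r subr0.
have sb : 0 <= s * complex.Re b by rewrite mulr_ge0.
have s1' : s = 1 by lra.
by move: e; rewrite s1' subrr mul1r add0r => /eqP; rewrite (negPf b0).
Qed.

(* C^* is connected: with b^2 = a and Re b >= 0, neither segment from 1 to b nor
   its image under b, from b to a, meets 0. *)
Lemma scale_class (w : conf R 1) (a : C) gamma : a != 0 ->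
  is_loop w gamma ->
  curve_class w gamma = curve_class w (fun t => w ord0 + a * (gamma t - w ord0)).
Proof.
move=> a0 lg; pose b := sqrtc a.
have b2 : b * b = a by rewrite -expr2 sqr_sqrtc.
have b0 : b != 0 by rewrite /b sqrtc_eq0.
have rb : 0 <= complex.Re b by rewrite /b; case: (a) => x y; exact: sqrtr_ge0.
have e1 := scale_class_half b0 rb lg.
have [cg gw] := lg.
have lg' : is_loop w (fun t => w ord0 + b * (gamma t - w ord0)).
  have [c e] := cg; split=> [|t i It].
    split; last by rewrite e.
    have := ccontinuous_map (@aff_continuous_map R (Aff (w ord0 - b * w ord0) b0)) c.
    by apply: ccontinuous_eq => t _; rewrite /= /aff_map /=; ring.
  rewrite (ord1 i) -subr_eq0 addrAC subrr add0r mulf_neq0 // subr_eq0.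
  exact: gw.
rewrite e1 (scale_class_half b0 rb lg'); apply: eq_curve_class => t _.
by rewrite -b2; ring.
Qed.

End OnePuncture.

(** * Equivariant families of loop classes and the quotient of G_n *)

Section FramedClasses.
Variables (R : realType) (m : nat).
Local Notation n := m.+1.
Local Notation C := R[i].
Local Notation conf := (conf R n).
Local Notation GB := (G_bundle R n).
Local Notation I01 := (@unit_interval R).
Implicit Types (gamma : R -> C) (q : moduli R n) (z w : conf).

Definition framed_class gamma z : loop_space z :=
  curve_class z (aff_map (frame z) \o gamma).

(** For n >= 2 the frame of g z is g composed with the frame of z, and the two curves are equal. For
    n = 1 the frame is a translation, and the curves differ by multiplication by [aff_a g] about the
    puncture; if one of them is not a loop neither is the other, and both classes are 0. *)
Lemma framed_class_act g z gamma :
  framed_class gamma (conf_act g z) = loop_space_act g (framed_class gamma z).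
Proof.
rewrite /framed_class act_curve_class; case: m z => [|k] z; last first.
  apply: eq_curve_class => t _; rewrite /= /aff_map /= /aff_map.
  ring.
have [lg|lg] := pselect (is_loop (conf_act g z) (aff_map (frame (conf_act g z)) \o gamma)).
  rewrite (scale_class (aff_neq0 g) lg); apply: eq_curve_class => t _.
  by rewrite /= /aff_map /= /aff_map; ring.
rewrite /curve_class; case: pselect => // _; case: pselect => // h.
case: lg; have ga := aff_neq0 g; have gi : (aff_a g)^-1 != 0 by rewrite invr_eq0.
pose w0 := conf_act g z ord0.
have := @push_loop R 1 (conf_act g z) (conf_act g z)
  (aff_map (Aff (w0 - (aff_a g)^-1 * w0) gi)) (@aff_continuous_map R _) _ _ h.
have fx x : aff_map (Aff (w0 - (aff_a g)^-1 * w0) gi) x = w0 + (aff_a g)^-1 * (x - w0).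
  by rewrite /aff_map /=; ring.
move=> H; have {}H := H _; apply: eq_is_loop (H _) => [t _|x h' i].
  by rewrite [LHS]fx /w0 /= /aff_map /= /aff_map; field; rewrite ga.
rewrite fx (ord1 i) -subr_eq0 -/w0 addrAC subrr add0r mulf_neq0 // subr_eq0.
exact: h'.
Qed.

Definition framed_fiber gamma q : qfiber GB q :=
  @QFiber R n GB q (fun z _ => framed_class gamma z)
    (fun g z _ _ => framed_class_act g z gamma).

Lemma qfiber_sumE (I : Type) (r : seq I) q (x : I -> qfiber GB q) z e :
  (\sum_(k <- r) x k) z e = \sum_(k <- r) x k z e.
Proof.
elim: r => [|k r IH]; first by rewrite !big_nil.
by rewrite !big_cons -IH.
Qed.

Lemma qfiber_combE k (a : 'I_k -> C) (gamma : 'I_k -> R -> C) q z (e : to_moduli z = q) :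
  (\sum_(j < k) a j *: framed_fiber (gamma j) q) z e =
  \sum_(j < k) a j *: framed_class (gamma j) z.
Proof. by rewrite qfiber_sumE. Qed.

Lemma scale_slice z : scale (slice z) = 1.
Proof.
rewrite /scale; case: m z => // k z; rewrite !sliceE subrr mul0r subr0.
by rewrite /scale mulfV // subr_eq0 (inj_eq (@pts_inj _ _ z)).
Qed.

Lemma framed_class_sigma gamma q : framed_class gamma (sigma q) = curve_class (sigma q) gamma.
Proof.
apply: eq_curve_class => t _; rewrite /sigma; set z := repr q.
rewrite -[LHS]/(scale (slice z) * gamma t + slice z ord0).
by rewrite scale_slice sliceE subrr mul0r addr0 mul1r.
Qed.

Lemma qfiber_span z (x : loop_space z) : exists k (a : 'I_k -> C) (gamma : 'I_k -> R -> C),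
  (forall j, is_loop (slice z) (gamma j)) /\ x = \sum_(j < k) a j *: framed_class (gamma j) z.
Proof.
have [k [a [g [lg ->]]]] := loop_space_span x.
exists k, a, (fun j => aff_map (unframe z) \o g j); split.
  by move=> j; apply/is_loop_act.
apply: eq_bigr => j _; congr (_ *: _); apply: eq_curve_class => t _ /=.
by rewrite frameK.
Qed.

Definition loop_val q (x : qfiber GB q) : loop_space (sigma q) := x (sigma q) (to_moduli_sigma q).

(** A class at the slice point is a combination of framed classes, and these extend equivariantly to
    the orbit. *)
Lemma loop_val_surj q (x : loop_space (sigma q)) : exists y, loop_val y = x :> loop_space (sigma q).
Proof.
have [k [a [g [_ ->]]]] := qfiber_span x.
by exists (\sum_(j < k) a j *: framed_fiber (g j) q : qfiber GB q); rewrite /loop_val qfiber_combE.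
Qed.

Definition loop_unval q (x : loop_space (sigma q)) : qfiber GB q :=
  sval (cid (loop_val_surj x)).

Lemma loop_unvalK q : cancel (@loop_unval q) (@loop_val q).
Proof. by move=> x; rewrite /loop_unval; case: cid. Qed.

Lemma loop_valK q : cancel (@loop_val q) (@loop_unval q).
Proof.
by move=> x; apply: (@qfiber_eq_at _ _ _ _ _ _ (sigma q) (to_moduli_sigma q)); exact: loop_unvalK.
Qed.

Lemma loop_val_linear q (a : C) (x y : qfiber GB q) :
  loop_val (a *: x + y) = a *: loop_val x + loop_val y.
Proof. by []. Qed.

Lemma sigma_open (U : set conf) : conf_open U -> @is_open R (moduli_space R n) (@sigma R m @^-1` U).
Proof.
move=> oU; have oS := conf_open_preimage (@slice_smooth R m) oU.
rewrite /=; set A := _ @^-1` _; suff -> : A = @slice R m @^-1` U by [].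
by apply/seteqP; split=> z /=; rewrite /A /= sigma_to_moduli.
Qed.

Lemma smooth_near_sigma q f : smooth_near (sigma q : conf_space R n) f ->
  @smooth_near R (moduli_space R n) q (fun q' => f (sigma q')).
Proof.
move=> [U [oU Uq sf]]; exists (@sigma R m @^-1` U); split=> //; first exact: sigma_open.
have := conf_smooth_preimage (@slice_smooth R m) oU sf.
move=> /(@conf_smooth_sub _ _ _ (@to_moduli R n @^-1` (@sigma R m @^-1` U))) h.
have {}h := h _; apply: eq_conf_smooth (h _) => [z _|z] /=; rewrite ?sigma_to_moduli //.
Qed.

Lemma pull_sectionE (s : forall q, quotient_bundle GB q) q z (e : to_moduli z = q) :
  s q z e = pull_section s z.
Proof. by case: q / e. Qed.

Definition moduli_expr q (s : forall q, quotient_bundle GB q) k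
    (f : 'I_k -> moduli R n -> C) (gamma : 'I_k -> R -> C) : Prop :=
  @loop_expr R n (moduli_space R n) (quotient_bundle GB) (@sigma R m) loop_val q s k f gamma.

Lemma curve_bounded gamma : closed_curve gamma ->
  exists M, 0 <= M /\ forall t, I01 t -> normc (gamma t) <= M.
Proof.
move=> [cg _].
have I01E : I01 = `[0, 1]%classic by apply/seteqP; split=> t /=; rewrite in_itv.
have cn : {within `[0, 1]%classic, continuous (fun t => normc (gamma t))}.
  by rewrite -I01E; apply: (@continuous_normc R (subspace I01)).
have [c _ hc] := EVT_max ler01 cn.
exists (normc (gamma c)); split; first exact: normc_ge0.
by move=> t It; apply: hc; rewrite in_itv.
Qed.

(** A framed class is flat along Conf_n: a curve is bounded, so a small change of frame moves it
    uniformly little, and the leash argument applies. *)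
Lemma framed_class_near z gamma : is_loop (slice z) gamma ->
  near_pt (z : conf_space R n) (fun w =>
    framed_class gamma w = curve_class w (aff_map (frame z) \o gamma)).
Proof.
move=> lg; have lz : is_loop z (aff_map (frame z) \o gamma).
  by rewrite -{1}[z]frame_slice; apply/is_loop_act.
have [r [r0 hr]] := loop_distance lz.
have [cg _] := lg; have [M [M0 hM]] := curve_bounded cg.
have M3 : 0 < 2 * M + 3 by lra.
(* If the points move by less than d, the scale moves by at most 2 d and the curve by less than 2 d
   M + d, while its distance to w_i stays above r - d = 2 d M + 2 d. *)
pose d := r / (2 * M + 3); have d0 : 0 < d by rewrite divr_gt0.
have rE : r = d * (2 * M + 3) by rewrite /d divfK // gt_eqF.
exists (conf_ball z d); split; [exact: conf_ball_open | exact: conf_ball_center |].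
have cf w : closed_curve (aff_map (frame w) \o gamma).
  have [c e] := cg; split; last by rewrite /= e.
  by apply: ccontinuous_map => //; exact: aff_continuous_map.
move=> w wz; apply/esym; apply: close_curves_class => // t i It.
have sc : normc (scale w - scale z) <= 2 * d.
  move: w wz {cf}; rewrite /scale; case: m z {lg lz hr} => [|k] z w wz.
    by rewrite subrr normc0; lra.
  rewrite (_ : _ - _ = (w ord_max - z ord_max) - (w ord0 - z ord0)); last by ring.
  apply: le_trans (normc_triangle _ _) _; rewrite normcN.
  by have := wz ord_max; have := wz ord0; lra.
have h1 : normc ((scale w - scale z) * gamma t) <= 2 * d * M.
  by rewrite normcM ler_pM ?normc_ge0 ?hM.
have -> : (aff_map (frame w) \o gamma) t - (aff_map (frame z) \o gamma) t =
    (scale w - scale z) * gamma t + (w ord0 - z ord0).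
  by rewrite /= /aff_map /=; ring.
apply: le_lt_trans (normc_triangle _ _) _.
have := hr i t It; set x := (_ \o _) t => hx.
have := normc_triangle (x - w i) (w i - z i); rewrite subrKA => hy.
have w0 := wz ord0; have wi := wz i.
have dM : r = 2 * d * M + 3 * d by rewrite rE; ring.
lra.
Qed.

Lemma moduli_expr_fiber q (s : forall q, quotient_bundle GB q) k f
    (gamma : 'I_k -> R -> C) : @moduli_expr q s k f gamma ->
  @near_pt R (moduli_space R n) q (fun q' =>
    s q' = \sum_(j < k) f j q' *: framed_fiber (gamma j) q' :> qfiber GB q').
Proof.
move=> [_ _ e]; apply: near_ptW e => q' e.
apply: (@qfiber_eq_at _ _ _ _ _ _ (sigma q') (to_moduli_sigma q')).
rewrite qfiber_combE -[LHS]/(loop_val (s q')) e.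
by apply: eq_bigr => j _; rewrite framed_class_sigma.
Qed.

(** The pull-back is expressed through frames that vary with w; [framed_class_near] freezes them at
    z, so the curves become constant while the coefficients are only pulled back. *)
Lemma moduli_conf_expr z (s : forall q, quotient_bundle GB q) k f
    (gamma : 'I_k -> R -> C) : @moduli_expr (to_moduli z) s k f gamma ->
  @conf_expr R m z (pull_section s) k (fun j w => f j (to_moduli w))
    (fun j => aff_map (frame z) \o gamma j).
Proof.
move=> h; have [lg sf _] := h; have hS := @conf_sheaf R m.
have lg' j : is_loop (slice z) (gamma j) by rewrite -sigma_to_moduli; exact: lg.
split.
- by move=> j; rewrite -{1}[z]frame_slice; apply/is_loop_act.
- by move=> j; have := smooth_near_pull (sf j).
have n1 : near_pt (z : conf_space R n) (fun w => s (to_moduli w) =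
    \sum_(j < k) f j (to_moduli w) *: framed_fiber (gamma j) (to_moduli w) :> qfiber GB _).
  have [U [oU Uz hU]] := moduli_expr_fiber h.
  by exists (@to_moduli R n @^-1` U); split=> // w; exact: hU.
have n2 := near_pt_forall hS (fun j => framed_class_near (lg' j)).
apply: near_ptW (near_ptI hS n1 n2) => w [e1 e2].
rewrite /pull_section /eval_at e1 qfiber_combE.
by apply: eq_bigr => j _; rewrite e2.
Qed.

Lemma conf_moduli_expr q (s : forall q, quotient_bundle GB q) k f
    (gamma : 'I_k -> R -> C) : @conf_expr R m (sigma q) (pull_section s) k f gamma ->
  @moduli_expr q s k (fun j q' => f j (sigma q')) gamma.
Proof.
move=> [lg sf [U [oU Uq e]]]; split=> //; first by move=> j; exact: smooth_near_sigma.
exists (@sigma R m @^-1` U); split=> //; first exact: sigma_open.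
by move=> q' Uq'; rewrite /loop_val pull_sectionE e.
Qed.

Lemma moduli_sectionP (U : set (moduli R n)) (s : forall q, quotient_bundle GB q) :
  @is_open R (moduli_space R n) U ->
  @smooth_section R (moduli_space R n) (quotient_bundle GB) U s <->
  forall q, U q -> exists k f (gamma : 'I_k -> R -> C), @moduli_expr q s k f gamma.
Proof.
move=> oU; apply: (iff_trans (G_sectionP _ _)); split=> [h q Uq|h z Uz].
  have [|k [f [g hg]]] := h (sigma q); first by rewrite /= to_moduli_sigma.
  by exists k, (fun j q' => f j (sigma q')), g; exact: conf_moduli_expr.
have [k [f [g hg]]] := h _ Uz.
by do 3 eexists; exact: moduli_conf_expr hg.
Qed.

Definition moduli_G_conn : covariant_derivative (quotient_bundle GB) :=
  @loop_conn R n (moduli_space R n) (quotient_bundle GB) (@sigma R m) loop_val loop_unval.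

Lemma moduli_G_conn_flat : flat_connection moduli_G_conn.
Proof.
apply: (@loop_conn_flat R n (moduli_space R n) (@moduli_sheaf R m) (quotient_bundle GB)).
- exact: sigma_open.
- exact: loop_val_linear.
- exact: loop_valK.
- exact: loop_unvalK.
- exact: moduli_sectionP.
Qed.

Lemma G_bundle_descends : bundle_descends GB.
Proof.
move=> z.
have sec (x : loop_space z) : exists s : forall q, quotient_bundle GB q,
    @section_near R _ (quotient_bundle GB) (to_moduli z : moduli_space R n) s /\
    pull_section s z = x.
  have [k [a [g [lg xE]]]] := qfiber_span x.
  exists (fun q => \sum_(j < k) a j *: framed_fiber (g j) q : qfiber GB q); split.
    apply: (@expr_section_near R n (moduli_space R n) (@moduli_sheaf R m) (quotient_bundle GB)
      (@sigma R m) sigma_open loop_val moduli_sectionP _ _ k (fun j _ => a j) g).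
    split.
    - by move=> j; rewrite sigma_to_moduli; exact: lg.
    - by move=> j; apply: smooth_near_cst; exact: moduli_sheaf.
    - apply: near_ptT; first exact: moduli_sheaf.
      move=> q; rewrite /loop_val qfiber_combE.
      by apply: eq_bigr => j _; rewrite framed_class_sigma.
  by rewrite /pull_section /eval_at qfiber_combE xE.
split; last exact: sec.
apply: eval_at_bij => x; have [s [_ sx]] := sec x.
by exists (s (to_moduli z)).
Qed.

(** Corresponding expressions upstairs and downstairs have coefficients f o [to_moduli] and f, and
    the derivative of the former along v is [push_tangent v f] by definition. *)
Lemma moduli_G_conn_pullback : is_pullback (@nabla_G R n) moduli_G_conn.
Proof.
move=> z v s tv ss.
have [k [f [g h]]] := @section_near_expr R n (moduli_space R n) (quotient_bundle GB)
  (@sigma R m) loop_val moduli_sectionP _ _ ss.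
rewrite (nabla_G_expr tv (moduli_conf_expr h)).
have tv' := push_tangentP tv.
have hc := @loop_connE R n (moduli_space R n) (@moduli_sheaf R m) (quotient_bundle GB)
  (@sigma R m) sigma_open loop_val loop_unval loop_unvalK _ _ _ _ _ _ tv' h.
have -> : moduli_G_conn (to_moduli z) (push_tangent v) s =
    \sum_(j < k) push_tangent v (f j) *: framed_fiber (g j) (to_moduli z) :> qfiber GB _.
  apply: (@qfiber_eq_at _ _ _ _ _ _ (sigma (to_moduli z)) (to_moduli_sigma (to_moduli z))).
  rewrite qfiber_combE; apply: etrans hc _.
  by apply: eq_bigr => j _; rewrite framed_class_sigma.
by rewrite /eval_at qfiber_combE.
Qed.

Lemma G_connection_descends : connection_descends (@nabla_G R n).
Proof.
split; first exact: nabla_G_flat.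
by exists moduli_G_conn; split; [exact: moduli_G_conn_flat | exact: moduli_G_conn_pullback].
Qed.

End FramedClasses.

(** * Equivariance of the holonomy *)

Section HolonomyDescends.
Variables (R : realType) (n : nat).
Local Notation C := R[i].
Local Notation conf := (conf R n).
Implicit Types (g : aff R) (z : conf) (gamma : R -> C).

Definition derivableC gamma (t : R) : Prop :=
  derivable (fun u => complex.Re (gamma u)) t 1 /\
  derivable (fun u => complex.Im (gamma u)) t 1.

Lemma aff_Re g gamma : (fun u => complex.Re (aff_map g (gamma u))) =
  (fun u => complex.Re (aff_a g) * complex.Re (gamma u)
          - complex.Im (aff_a g) * complex.Im (gamma u) + complex.Re (aff_b g)).
Proof.
apply/funext => u; rewrite /aff_map.
by case: (aff_a g) (gamma u) (aff_b g) => [? ?] [? ?] [? ?].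
Qed.

Lemma aff_Im g gamma : (fun u => complex.Im (aff_map g (gamma u))) =
  (fun u => complex.Re (aff_a g) * complex.Im (gamma u)
          + complex.Im (aff_a g) * complex.Re (gamma u) + complex.Im (aff_b g)).
Proof.
apply/funext => u; rewrite /aff_map.
by case: (aff_a g) (gamma u) (aff_b g) => [? ?] [? ?] [? ?].
Qed.

Lemma is_derive_comb (f h : R -> R) (a b c t : R) :
  derivable f t 1 -> derivable h t 1 ->
  is_derive t (1 : R) (fun u => a * f u + b * h u + c) (a * derive1 f t + b * derive1 h t).
Proof.
move=> /derivableP df /derivableP dh.
have -> : (fun u => a * f u + b * h u + c) = a *: f + b *: h + cst c by [].
by apply: is_derive_eq; rewrite addr0 -!derive1E.
Qed.

Lemma derivableC_aff g gamma t : derivableC gamma t ->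
  [/\ derivableC (aff_map g \o gamma) t,
      derive1 (fun u => complex.Re (aff_map g (gamma u))) t =
        complex.Re (aff_a g) * derive1 (fun u => complex.Re (gamma u)) t
        - complex.Im (aff_a g) * derive1 (fun u => complex.Im (gamma u)) t
    & derive1 (fun u => complex.Im (aff_map g (gamma u))) t =
        complex.Re (aff_a g) * derive1 (fun u => complex.Im (gamma u)) t
        + complex.Im (aff_a g) * derive1 (fun u => complex.Re (gamma u)) t].
Proof.
move=> [d1 d2].
have D1 := is_derive_comb (complex.Re (aff_a g)) (- complex.Im (aff_a g))
  (complex.Re (aff_b g)) d1 d2.
have D2 := is_derive_comb (complex.Re (aff_a g)) (complex.Im (aff_a g))
  (complex.Im (aff_b g)) d2 d1.
have e1 : (fun u => complex.Re (aff_map g (gamma u))) =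
    (fun u => complex.Re (aff_a g) * complex.Re (gamma u)
   + - complex.Im (aff_a g) * complex.Im (gamma u) + complex.Re (aff_b g)).
  by rewrite aff_Re; apply/funext => u; rewrite mulNr.
rewrite -e1 in D1; rewrite -aff_Im in D2.
have [[x1 v1] [x2 v2]] := (D1, D2).
split; first by split.
  by rewrite derive1E v1 mulNr.
by rewrite derive1E v2.
Qed.

Lemma derivableC_affP g gamma t : derivableC (aff_map g \o gamma) t <-> derivableC gamma t.
Proof.
split=> [|d]; last by have [] := derivableC_aff g d.
move=> /(derivableC_aff (aff_inv g))[+ _ _].
have -> : aff_map (aff_inv g) \o (aff_map g \o gamma) = gamma; last by [].
by apply/funext => u /=; rewrite aff_mapK.
Qed.

(** Derivability of the curve and of its image must be equivalent, so that the default value 0 is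
    taken at the same points. *)
Lemma cderive_aff g gamma t : cderive (aff_map g \o gamma) t = aff_a g * cderive gamma t.
Proof.
rewrite /cderive; case: asboolP => [/derivableC_affP d|nd].
  have [_ e1 e2] := derivableC_aff g d.
  rewrite asboolT // e1 e2; case: (aff_a g) => a b /=.
  by congr (_ +i* _); ring.
rewrite asboolF ?mulr0 // => d; apply: nd; exact/derivableC_affP.
Qed.

Lemma piecewise_C1_aff g gamma : piecewise_C1 gamma -> piecewise_C1 (aff_map g \o gamma).
Proof.
move=> [m [t [t0 tm tk h]]]; exists m, t; split=> // k km.
have [delta [d1 d2 c1 c2] e] := h k km.
exists (aff_map g \o delta) => [|u hu]; last by rewrite /= e.
have D u := derivableC_aff g (conj (d1 u) (d2 u)).
split.
- by move=> u; have [[]] := D u.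
- by move=> u; have [[]] := D u.
- rewrite (_ : derive1 _ =
    (fun u => complex.Re (aff_a g) * derive1 (fun u => complex.Re (delta u)) u
        - complex.Im (aff_a g) * derive1 (fun u => complex.Im (delta u)) u)); last first.
    by apply/funext => u; have [_ ->] := D u.
  move=> u; apply: (@cvgB _ R^o); apply: cvgM; try exact: cvg_cst; [exact: c1 | exact: c2].
- rewrite (_ : derive1 _ =
    (fun u => complex.Re (aff_a g) * derive1 (fun u => complex.Im (delta u)) u
        + complex.Im (aff_a g) * derive1 (fun u => complex.Re (delta u)) u)); last first.
    by apply/funext => u; have [_ _ ->] := D u.
  move=> u; apply: (@cvgD _ R^o); apply: cvgM; try exact: cvg_cst; [exact: c2 | exact: c1].
Qed.

Lemma iterated_integral_aff g z gamma w t :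
  iterated_integral (conf_act g z) (aff_map g \o gamma) w t = iterated_integral z gamma w t.
Proof.
elim: w t => [|i w IH] t //=; congr cintegral; apply/funext => u.
rewrite IH cderive_aff; congr (_ * _ * _).
rewrite /= /aff_map opprD addrACA subrr addr0 -mulrBr invfM mulrACA.
by rewrite mulfV ?mul1r // aff_neq0.
Qed.

Lemma hol_aff g z gamma : hol (conf_act g z) (aff_map g \o gamma) = hol z gamma.
Proof. by apply/funext => w; exact: iterated_integral_aff. Qed.

Lemma class_act_pi g z (gamma : loop z) :
  class_act g (\pi_(homotopy_class z) gamma) =
  \pi_(homotopy_class (conf_act g z)) (loop_act g gamma).
Proof.
rewrite /class_act; apply/eqmodP/asboolP.
have /eqmodP/asboolP[H hH] : \pi_(homotopy_class z) (repr (\pi_(homotopy_class z) gamma)) =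
  \pi_(homotopy_class z) gamma by rewrite reprK.
exists (aff_map g \o H); apply: push_homotopy hH; first exact: aff_continuous_map.
by move=> x h i; rewrite /= (inj_eq (@aff_map_inj _ g)) h.
Qed.

Lemma eq_free_homotopy z gamma gamma' delta delta' H :
  gamma =1 gamma' -> delta =1 delta' ->
  free_homotopy z gamma delta H -> free_homotopy z gamma' delta' H.
Proof. by move=> /funext -> /funext ->. Qed.

Lemma unact_avoid g z x : (forall i, x != conf_act g z i) ->
  forall i, aff_map (aff_inv g) x != z i.
Proof.
by move=> h i; have := h i; apply: contraNN => /eqP e; rewrite /= -e aff_mapVK.
Qed.

(** The two sets from which the values are chosen coincide, because g and its inverse match the
    piecewise C^1 loops of the two classes; the choice, default included, is then the same. *)
Lemma hol_class_act g z c : hol_class (class_act g c) = @hol_class R n z c.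
Proof.
rewrite /hol_class; congr (xget 0 _); apply/seteqP; split=> h hh.
  move=> gamma pg gc; rewrite -(hol_aff g).
  apply: (hh (loop_act g gamma)); first exact: piecewise_C1_aff.
  by rewrite -gc class_act_pi.
move=> gamma pg gc.
have lg' : is_loop z (aff_map (aff_inv g) \o gamma).
  apply: (push_loop (w := conf_act g z)) (curveP gamma).
    exact: aff_continuous_map.
  exact: unact_avoid.
have e : aff_map g \o (aff_map (aff_inv g) \o gamma) = gamma.
  by apply/funext => t /=; rewrite aff_mapVK.
rewrite -[in RHS]e hol_aff; apply: (hh (Loop lg')).
  exact: (piecewise_C1_aff (aff_inv g) pg).
rewrite -[c]reprK; apply/eqmodP/asboolP.
have : \pi_(homotopy_class (conf_act g z)) gamma =
       \pi_(homotopy_class (conf_act g z)) (loop_act g (repr c)) by rewrite gc.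
move=> /eqmodP/asboolP[H hH]; exists (aff_map (aff_inv g) \o H).
have := push_homotopy (@aff_continuous_map R (aff_inv g)) (@unact_avoid g z) hH.
by apply: eq_free_homotopy => t //=; rewrite aff_mapK.
Qed.

Lemma freeg_linear_ext (K : choiceType) (M : lmodType C) (F G : {freeg K / C} -> M) :
  linear F -> linear G -> (forall k, F << k >> = G << k >>) -> F =1 G.
Proof.
move=> lF lG FG x.
have z0 (H : {freeg K / C} -> M) : linear H -> H 0 = 0.
  by move=> lH; apply: (addrI (H 0)); rewrite addr0 -{1}[H 0]scale1r -lH scaler0 addr0.
rewrite -[x]freeg_sumE; elim: (dom x) => [|k s IH]; first by rewrite big_nil !z0.
have e : << coeff k x *g k >> = coeff k x *: << k >> :> {freeg K / C}.
  by apply/eqP/freeg_eqP => l; rewrite coeffZ !coeffU mul1r.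
by rewrite big_cons e lF lG IH FG.
Qed.

Lemma holonomy_map_act g z (x : loop_space z) :
  holonomy_map (loop_space_act g x) = @holonomy_map R n z x.
Proof.
apply: (@freeg_linear_ext (homotopy_class z) (cTH R n)
  (fun y => holonomy_map (loop_space_act g y)) (@holonomy_map R n z)).
- move=> a y y'; rewrite -[loop_space_act g _]/(fglift _ _) fglift_linear.
  exact: fglift_linear.
- exact: fglift_linear.
- by move=> c; rewrite /loop_space_act /holonomy_map !liftU1 hol_class_act.
Qed.

Definition quotient_holonomy (q : moduli R n) (x : quotient_bundle (G_bundle R n) q) :
    quotient_bundle (H_bundle R n) q :=
  @QFiber R n (H_bundle R n) q (fun z e => holonomy_map (x z e))
    (fun g z e e' => etrans (congr1 (@holonomy_map R n _) (familyP x e e'))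
                            (holonomy_map_act g (x z e))).

(** Smoothness passes to the quotient because a section there is smooth by definition when its
    pull-back is, and the pull-back commutes with the holonomy. *)
Lemma holonomy_descends : map_descends (@holonomy_map R n).
Proof.
exists quotient_holonomy; split.
- by move=> q a x y; apply: qfiber_eq => z e; exact: fglift_linear.
- by [].
- by move=> sm U s oU ss; exact: (sm _ _ oU ss).
Qed.

End HolonomyDescends.

Theorem theorem3p6 (R : realType) (n : nat) (n_ge1 : (1 <= n)%N) :
  [/\ bundle_descends (G_bundle R n),
      connection_descends (@nabla_G R n),
      bundle_descends (H_bundle R n),
      connection_descends (@nabla_H R n)
    & map_descends (@holonomy_map R n)].
Proof.
(* Writing n as m + 1 provides the first and last points on which the slice rests. *)
case: n n_ge1 => // m _; split.
- exact: G_bundle_descends.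
- exact: G_connection_descends.
- exact: H_bundle_descends.
- exact: H_connection_descends.
- exact: holonomy_descends.
Qed.
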